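(* Let $(g_\beta,J_\beta)$ be the separable geometry (with functions $A_{ir}$) associated to the product Segre–Veronese factorization structure with partition $m=d_1+\dots+d_k$ which is distinct from the Veronese and Segre factorization structures (i.e. $k\ge2$ and not all $d_i=1$), and let $S=\{i\in\{1,\ldots,k\}\mid\exists r\in\{1,\ldots,d_i\}:\beta_{ir}\ne0\}$. The geometry is extremal if and only if one of the following holds: (1) $\varphi(\beta)=t\cdot(1,0)^{\otimes m}$ for some $t\in\mathbb R\setminus\{0\}$, i.e. $\langle\mu,\beta\rangle=t$, and for $p=1,\ldots,k$ and $q=1,\ldots,d_p$ $$A_{pq}(x_{pq})=\tilde\Upsilon_p(x_{pq})+\nu_{pq}^0+\nu_{pq}^1x_{pq},$$ where $\tilde\Upsilon_p$ is a $q$-independent polynomial of degree at most $d_p+2$, and $\nu_{pq}^0,\nu_{pq}^1\in\mathbb R$ for any $p,q$. (2) For some $p$, $\varphi(\beta)=\mathrm{ins}_p\big(t\cdot(a,b)^{\otimes d_p}\otimes(1,0)^{\otimes(m-d_p)}\big)$ for some $t\in\mathbb R\setminus\{0\}$, $b\ne0$, i.e. $\langle\mu,\beta\rangle=t\prod_{q=1}^{d_p}(a+bx_{pq})$, and $$A_{pq}(x_{pq})=(a+bx_{pq})^{m+1}\int\!\!\int\frac{\Upsilon_p(x_{pq})}{(a+bx_{pq})^{m+3}}dx_{pq}dx_{pq},\quad q=1,\ldots,d_p,$$ $$A_{ir}(x_{ir})=\int\!\!\int\Upsilon_i(x_{ir})dx_{ir}dx_{ir},\quad i\ne p,\ r=1,\ldots,d_i,$$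 with $\deg\Upsilon_p\le d_p+1$ and $\deg\Upsilon_i\le d_i-1$ ($i\ne p$) such that $$\frac{\gamma_p^{d_p+1}}{b^2}+\sum_{i\ne p}\gamma_i^{d_i-1}=0.$$ (3) The geometry corresponds to the factorization structure $S^dW_1^*\otimes\langle(1,0)\rangle+\langle(1,0)^{\otimes d}\rangle\otimes W_2^*$ (i.e. $k=2$, $d_1=d$, $d_2=1$, $m=d+1$), there exists $q\in\{1,\ldots,d\}$ such that $\langle\mu,\beta\rangle$ and $\partial_{x_{1q}}\langle\mu,\beta\rangle$ are linearly independent over $\mathbb R[x_{1q}]$, $A_2$ is a polynomial of degree at most two and $A_{1r}(x_{1r})=\Upsilon(x_{1r})$, $r=1,\ldots,d$, where $\Upsilon$ is an $r$-independent polynomial of degree at most $m$, such that $2\gamma^m+A_2''=0$ (where $\gamma^m$ is the coefficient of $\Upsilon$ at $x^m$). (4) There exist $p\in\{1,\ldots,k\}$ and $q\in\{1,\ldots,d_p\}$ such that $\langle\mu,\beta\rangle$ and $\partial_{x_{pq}}\langle\mu,\beta\rangle$ are linearly independent over $\mathbb R[x_{pq}]$, the factorization structure is not isomorphic with the one in (3), and for $$A_{jq}(x_{jq})=\Upsilon_j(x_{jq}),\quad q=1,\ldots,d_j,\ j\in S,$$ where $\Upsilon_j$ is a $q$-independent polynomial of degree at most $d_j+1$, and $$A_{ir}(x_{ir})=\int\!\!\int\Upsilon_i(x_{ir})dx_{ir}dx_{ir},\quad r=1,\ldots,d_i,\ i\notin S,$$ where $\Upsilon_i$ is an $r$-independent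 polynomial of degree at most $d_i-1$, exactly one of the following holds: (a) $S=\{p\}$, and $(m-d_p)(m+1-d_p)\gamma_p^{d_p+1}+\sum_{i\notin S}\gamma_i^{d_i-1}=0$. (b) $S=\{p,\tilde p\}$, $m=d_p+d_{\tilde p}$, i.e. the geometry corresponds to the factorization structure $S^{d_p}W_p^*\otimes\langle(1,0)^{\otimes d_{\tilde p}}\rangle+\langle(1,0)^{\otimes d_p}\rangle\otimes S^{d_{\tilde p}}W_{\tilde p}^*$, and $\gamma_p^{d_p+1}+\gamma_{\tilde p}^{d_{\tilde p}+1}=0$. (c) $|S|\ge2$, $k\ge3$, $\deg\Upsilon_j\le d_j$ for $j\in S$, and $\sum_{i\notin S}\gamma_i^{d_i-1}=0$.
   Context: Let $m=d_1+\cdots+d_k$, $d_j\ge1$, $W_1=\dots=W_k=\mathbb R^2$, $V^*=\bigotimes_{i=1}^k(W_i^* )^{\otimes d_i}$ with slots labelled $(i,r)$, $1\le r\le d_i$; $\mathrm{ins}_j$ reorders tensor factors so that the first $d_j$ factors are put into the slots $(j,1),\dots,(j,d_j)$. The product Segre–Veronese factorization structure is the inclusion $\varphi$ of $\mathfrak h=\sum_{j=1}^k\mathrm{ins}_j\big(S^{d_j}W_j^*\otimes\langle(1,0)^{\otimes(m-d_j)}\rangle\big)$, of dimension $m+1$, into $V^*$. It is the Veronese one if $k=1$ and the (product) Segre one if $d_1=\dots=d_k=1$. With real variables $x_{ir}$ and the pairing $\langle(u,v),(a,b)\rangle=ua+vb$ put $\langle\mu,\alpha\rangle=\langle\bigotimes_{i,r}(1,x_{ir}),\varphi(\alpha)\rangle$,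 $\alpha\in\mathfrak h$. Writing $\sigma_r(x_{i1},\dots,x_{id_i})$ for elementary symmetric polynomials, for $\beta\in\mathfrak h$ we have $\langle\mu,\beta\rangle=\beta_0+\sum_{i=1}^k\sum_{r=1}^{d_i}\beta_{ir}\sigma_r(x_{i1},\dots,x_{id_i})$ with arbitrary real coefficients. Put $\Delta_{ir}=\prod_{s\ne r}(x_{ir}-x_{is})$ ($=1$ if $d_i=1$), $\mu_\beta=\mu/\langle\mu,\beta\rangle$, and $\psi_{ir}(x)\in\mathfrak h$ with $\varphi(\psi_{ir}(x))=\mathrm{ins}_i((x,-1)^{\otimes d_i}\otimes(1,0)^{\otimes(m-d_i)})$. Given $0\ne\beta\in\mathfrak h$ and smooth non-vanishing functions $A_{ir}$ on open intervals $I_{ir}$ such that $\Delta_{ir}$ and $\langle\mu,\beta\rangle$ do not vanish on $\prod I_{ir}$, the separable geometry is the (local) toric Kähler structure in coordinates $(x_{ir},t)$, $t\in\mathfrak t=\mathfrak h/\langle\beta\rangle$, $$g_\beta=\sum_{i,r}\Big(\tfrac{\Delta_{ir}}{A_{ir}(x_{ir})\langle\mu,\beta\rangle}dx_{ir}^2+\tfrac{A_{ir}(x_{ir})\langle\mu,\beta\rangle}{\Delta_{ir}}\langle\partial_{x_{ir}}\mu_\beta,dt\rangle^2\Big),\quad\omega_\beta=\sum_{i,r}dx_{ir}\wedge\langle\partial_{x_{ir}}\mu_\beta,dt\rangle,$$ $$J_\beta dx_{ir}=\tfrac{A_{ir}(x_{ir})\langle\mu,\beta\rangle}{\Delta_{ir}}\langle\partial_{x_{ir}}\mu_\beta,dt\rangle,\quad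 J_\beta dt=\sum_{i,r}\tfrac{\psi_{ir}(x_{ir})\ \mathrm{mod}\ \beta}{A_{ir}(x_{ir})}dx_{ir}$$ ($A_{ir}$ such that $g_\beta$ is positive definite). It is extremal if its scalar curvature is a Killing potential; for this geometry this amounts to the existence of $\alpha\in\mathfrak h$ with $$\sum_{i=1}^k\sum_{r=1}^{d_i}\frac{\langle\mu,\beta\rangle^{m+3}}{\Delta_{ir}}\partial_{x_{ir}}^2\Big(\frac{A_{ir}(x_{ir})}{\langle\mu,\beta\rangle^{m+1}}\Big)=\langle\mu,\alpha\rangle .$$ Conventions: polynomials are written $\Upsilon_i(x)=\sum_j\gamma_i^jx^j$ (upper indices of $\gamma$ are indices of coefficients, $\gamma_i^j$ is the coefficient at $x^j$); ``$q$-independent'' means the same polynomial for all $q$, and $\Upsilon_i$ never depends on the second index; partitions are unordered (groups may be relabelled); $A_2=A_{21}$ when $d_2=1$; $\int\!\int F\,dx\,dx$ denotes some second antiderivative of $F$ (determined up to adding an affine function, whose choice may depend on the index pair). *)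

(* Defs.v *)
(* MathComp and MathComp-Analysis, over an arbitrary [R : realType]. *)
From HB Require Import structures.
From mathcomp Require Import all_boot all_order all_algebra all_fingroup.
From mathcomp Require Import all_classical all_reals all_analysis.

Set Implicit Arguments.
Unset Strict Implicit.
Unset Printing Implicit Defensive.

Import Order.TTheory GRing.Theory Num.Theory.
Import numFieldNormedType.Exports.

Local Open Scope classical_set_scope.
Local Open Scope ring_scope.

(* Tensors in the tensor product of copies of R^2 (or of its dual) indexed by a
   finite set [I] of slots, by their coordinates in the standard product basis:
   a multi-index [f] selects (1,0) in the slots where it is [false] and (0,1)
   where it is [true]. *)
Definition tensor (R : realType) (I : finType) := {ffun {ffun I -> bool} -> R^o}.

Definition coord2 (R : realType) (v : R * R) (b : bool) : R :=
  if b then v.2 else v.1.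

Definition ptensor (R : realType) (I : finType) (v : I -> R * R) : tensor R I :=
  [ffun f : {ffun I -> bool} => \prod_(s : I) coord2 (v s) (f s)].

Definition tpow (R : realType) (n : nat) (v : R * R) : tensor R 'I_n :=
  ptensor (fun _ => v).

(* The contraction of a tensor with a dual one. *)
Definition tpair (R : realType) (I : finType) (T U : tensor R I) : R :=
  \sum_(f : {ffun I -> bool}) T f * U f.

(* B belongs to S^n W^*. *)
Definition symmetric_tensor (R : realType) (n : nat) (B : tensor R 'I_n) : Prop :=
  forall (p : {perm 'I_n}) (f : {ffun 'I_n -> bool}),
    B [ffun r => f (p r)] = B f.

(* The slots (i, r). Both indices start at 0. *)
Definition slot (k : nat) (d : 'I_k -> nat) : finType := {i : 'I_k & 'I_(d i)}.

Definition sl (k : nat) (d : 'I_k -> nat) (i : 'I_k) (r : 'I_(d i)) : slot d :=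
  Tagged (fun j => 'I_(d j)) r.

Definition mdim (k : nat) (d : 'I_k -> nat) : nat := (\sum_(i < k) d i)%N.

(* ins_j (B (x) (1,0)^{(x) (m - d_j)}). *)
Definition ins10 (R : realType) (k : nat) (d : 'I_k -> nat) (j : 'I_k)
    (B : tensor R 'I_(d j)) : tensor R (slot d) :=
  [ffun f : {ffun slot d -> bool} =>
     B [ffun r => f (sl r)] *
     \prod_(s : slot d | tag s != j) coord2 (1, 0) (f s)].

(* Membership in the product Segre-Veronese subspace h of V^*, which is the sum
   over j of the subspaces ins_j (S^{d_j} W_j^* (x) <(1,0)^{(x) (m - d_j)}>);
   the factorization structure phi is its inclusion, so that an element of h
   and its image under phi are the same tensor. *)
Definition in_h (R : realType) (k : nat) (d : 'I_k -> nat)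
    (T : tensor R (slot d)) : Prop :=
  exists B : forall j : 'I_k, tensor R 'I_(d j),
    (forall j, symmetric_tensor (B j)) /\ T = \sum_(j < k) ins10 (B j).

(* x |-> <mu, alpha>, with mu the tensor product of the vectors (1, x_ir). *)
Definition mu_pair (R : realType) (k : nat) (d : 'I_k -> nat)
    (alpha : tensor R (slot d)) (x : slot d -> R) : R :=
  tpair (ptensor (fun s => (1, x s))) alpha.

(* [coef0 beta] is beta_0, and [coef beta r] with [r : 'I_(d i)] is the
   coefficient beta_{i,r+1} at the elementary symmetric polynomial sigma_{r+1}
   of the i-th group of variables, see [mu_pairE] below. *)
Definition coef0 (R : realType) (k : nat) (d : 'I_k -> nat)
    (beta : tensor R (slot d)) : R := beta [ffun => false].

Definition coef (R : realType) (k : nat) (d : 'I_k -> nat)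
    (beta : tensor R (slot d)) (i : 'I_k) (r : 'I_(d i)) : R :=
  beta [ffun s : slot d => (tag s == i) && (tagged s <= r)%N].

(* The set S. *)
Definition Sset (R : realType) (k : nat) (d : 'I_k -> nat)
    (beta : tensor R (slot d)) : {set 'I_k} :=
  [set i | [exists r : 'I_(d i), coef beta r != 0]]%SET.

Definition elem_sym (R : realType) (n : nat) (r : nat) (y : 'I_n -> R) : R :=
  \sum_(E : {set 'I_n} | #|E| == r) \prod_(s in E) y s.

Lemma mu_pair_ins10 (R : realType) (k : nat) (d : 'I_k -> nat) (j : 'I_k)
    (B : tensor R 'I_(d j)) (x : slot d -> R) :
  mu_pair (ins10 B) x =
  \sum_(g : {ffun 'I_(d j) -> bool})
    (\prod_(r < d j) coord2 (1, x (sl r)) (g r)) * B g.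
Proof.
pose supp (f : {ffun slot d -> bool}) := [forall s, (tag s != j) ==> ~~ f s].
pose h (g : {ffun 'I_(d j) -> bool}) := [ffun s : slot d => untag false g s].
rewrite /mu_pair /tpair (bigID supp) /= [X in _ + X]big1 ?addr0; last first.
  move=> f /forallPn [s]; rewrite negb_imply negbK => /andP[sj fs].
  rewrite !ffunE; suff -> : \prod_(s0 : slot d | tag s0 != j) coord2 (1, 0) (f s0) = 0 :> R.
    by rewrite !mulr0.
  by rewrite (bigD1 s) //= fs /= mul0r.
have hE g r : h g (sl r) = g r.
  by rewrite ffunE (untagE false g (erefl : tag (sl r) = j)).
have hN g s : tag s != j -> h g s = false.
  by move=> sj; rewrite ffunE untag_dflt.
rewrite (reindex h) /=; last first.
  exists (fun f : {ffun slot d -> bool} => [ffun r => f (sl r)]) => [g _|f /forallP fs].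
    by apply/ffunP => r; rewrite ffunE hE.
  apply/ffunP => -[i r]; have [ij|ij] := eqVneq i j.
    by subst i; rewrite -/(sl r) hE ffunE.
  by rewrite hN //; have := fs (sl r); rewrite /= ij /= => /negbTE ->.
have hs g : supp (h g) by apply/forallP => s; apply/implyP => sj; rewrite hN.
rewrite (eq_bigl predT) => [|g]; last by rewrite hs.
apply: eq_bigr => g _; rewrite [ptensor _ _]ffunE [ins10 _ _]ffunE.
congr (_ * _); last first.
  rewrite [X in _ * X]big1 ?mulr1 => [|s sj]; last by rewrite hN.
  by congr (B _); apply/ffunP => r; rewrite ffunE hE.
rewrite (eq_bigr (fun s : slot d =>
  coord2 (1, x (sl (tagged s))) (h g (sl (tagged s))))); last by case.
rewrite -(sig_big_dep predT (fun _ => predT)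
  (fun i (r : 'I_(d i)) => coord2 (1, x (sl r)) (h g (sl r)))) /=.
rewrite (bigD1 j) //= [X in _ * X]big1 ?mulr1; last first.
  by move=> i ij; apply: big1 => r _; rewrite hN.
by apply: eq_bigr => r _; rewrite hE.
Qed.

Definition initseg (n l : nat) : {ffun 'I_n -> bool} := [ffun r : 'I_n => (r < l)%N].

Lemma symmetric_tensorE (R : realType) (n : nat) (B : tensor R 'I_n)
    (g : {ffun 'I_n -> bool}) :
  symmetric_tensor B -> B g = B (initseg n #|[set r | g r]%SET|).
Proof.
move=> symB; set l := #|_|.
have ln : (l <= n)%N by rewrite -[X in (_ <= X)%N]card_ord max_card.
have cnt : forall f : {ffun 'I_n -> bool},
    count id [tuple f i | i < n] = #|[set r | f r]%SET|.
  by move=> f; rewrite /= count_map -sum1_count /= big_enum_cond /= sum1dep_card.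
have li : #|[set r : 'I_n | initseg n l r]%SET| = l.
  rewrite -sum1dep_card (eq_bigl (fun r : 'I_n => (r < l)%N)); last by move=> r; rewrite ffunE.
  by rewrite -(big_ord_widen n (fun=> 1%N) ln) sum1_card card_ord.
have : perm_eq [tuple g i | i < n] [tuple initseg n l i | i < n].
  apply/allP => /= b _; apply/eqP.
  have tot (s : seq bool) : (count_mem true s + count_mem false s)%N = size s.
    by elim: s => //= -[] s <-; rewrite ?addnS ?addn0.
  have eqid : forall s : seq bool, count_mem true s = count id s.
    by move=> s; apply: eq_count; case.
  have ct : count_mem true [tuple g i | i < n] = count_mem true [tuple initseg n l i | i < n].
    by rewrite !eqid !cnt li.
  case: b => //; apply: (@addnI (count_mem true [tuple g i | i < n])).
  by rewrite {2}ct !tot !size_tuple.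
move=> /tuple_permP [p pE].
rewrite -(symB p (initseg n l)); congr (B _); apply/ffunP => r.
rewrite ffunE; have /(congr1 (fun s => nth false s r)) := pE.
by rewrite -!tnth_nth !tnth_mktuple.
Qed.

Lemma mu_pairE (R : realType) (k : nat) (d : 'I_k -> nat)
    (beta : tensor R (slot d)) (x : slot d -> R) :
  in_h beta ->
  mu_pair beta x =
  coef0 beta + \sum_(i < k) \sum_(r < d i)
    coef beta r * elem_sym r.+1 (fun s : 'I_(d i) => x (sl s)).
Proof.
case=> B [symB ->].
have -> : mu_pair (\sum_(j < k) ins10 (B j)) x = \sum_(j < k) mu_pair (ins10 (B j)) x.
  rewrite /mu_pair /tpair exchange_big /=; apply: eq_bigr => f _.
  by rewrite sum_ffunE mulr_sumr.
have -> : coef0 (\sum_(j < k) ins10 (B j)) = \sum_(j < k) B j (initseg (d j) 0).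
  rewrite /coef0 sum_ffunE; apply: eq_bigr => j _; rewrite ffunE.
  rewrite big1 ?mulr1; last by move=> s _; rewrite ffunE.
  by congr (B j _); apply/ffunP => r; rewrite !ffunE.
rewrite -big_split /=; apply: eq_bigr => i _.
have cE (r : 'I_(d i)) : coef (\sum_(j < k) ins10 (B j)) r = B i (initseg (d i) r.+1).
  rewrite /coef sum_ffunE (bigD1 i) //= [X in _ + X]big1 ?addr0.
    rewrite ffunE big1 ?mulr1; last by move=> s /negbTE si; rewrite ffunE si.
    congr (B i _); apply/ffunP => s; rewrite !ffunE /= eqxx /=.
    by rewrite ltnS.
  move=> j ji; rewrite ffunE (bigD1 (sl r)) /=; last by rewrite eq_sym.
  by rewrite ffunE /= eqxx leqnn /= mul0r mulr0.
rewrite mu_pair_ins10.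
pose F (l : nat) := B i (initseg (d i) l) * elem_sym l (fun s : 'I_(d i) => x (sl s)).
transitivity (\sum_(l < (d i).+1) F l); last first.
  rewrite big_ord_recl; congr (_ + _); last by apply: eq_bigr => r _; rewrite cE.
  rewrite /F /elem_sym (big_pred1 (finset.set0 : {set _})) ?big_set0 ?mulr1 //.
  by move=> E; rewrite cards_eq0.
have cE' (g : {ffun 'I_(d i) -> bool}) : (#|[set r | g r]%SET| < (d i).+1)%N.
  by rewrite ltnS -[X in (_ <= X)%N]card_ord max_card.
rewrite (partition_big (fun g => Ordinal (cE' g)) predT) //=.
apply: eq_bigr => l _; rewrite /F /elem_sym mulr_sumr.
rewrite (reindex (fun E : {set 'I_(d i)} => [ffun r => r \in E])) /=; last first.
  exists (fun g : {ffun 'I_(d i) -> bool} => [set r | g r]%SET) => [E _|g _].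
    by apply/setP => r; rewrite inE ffunE.
  by apply/ffunP => r; rewrite ffunE inE.
have sE (E : {set 'I_(d i)}) : [set r | [ffun r => r \in E] r]%SET = E.
  by apply/setP => r; rewrite inE ffunE.
apply: eq_big => [E|E]; first by rewrite -val_eqE /= sE.
rewrite -val_eqE /= sE => /eqP El; rewrite symmetric_tensorE // sE El mulrC.
congr (_ * _); rewrite [RHS]big_mkcond /=; apply: eq_bigr => r _.
by rewrite ffunE; case: ifP.
Qed.

Definition Delta (R : realType) (k : nat) (d : 'I_k -> nat) (i : 'I_k)
    (r : 'I_(d i)) (x : slot d -> R) : R :=
  \prod_(s < d i | s != r) (x (sl r) - x (sl s)).

Definition upd (R : realType) (J : finType) (x : J -> R) (s : J) (y : R) : J -> R :=
  fun s' => if s' == s then y else x s'.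

Definition partial (R : realType) (J : finType) (s : J) (F : (J -> R) -> R)
    (x : J -> R) : R :=
  derive1 (fun y : R => F (upd x s y)) (x s).

Definition box (R : realType) (J : finType) (I : J -> set R) : set (J -> R) :=
  [set x | forall s, I s (x s)].

Definition open_interval (R : realType) (I : set R) : Prop :=
  [/\ open I, is_interval I & I !=set0].

Definition smooth_on (R : realType) (I : set R) (f : R -> R) : Prop :=
  forall (n : nat) (x : R), I x -> derivable (derive1n n f) x 1.

(* G is a second antiderivative of F on the open interval I. *)
Definition antiderivative2 (R : realType) (I : set R) (F G : R -> R) : Prop :=
  forall x : R, I x ->
    [/\ derivable G x 1, derivable (derive1 G) x 1 & derive1n 2 G x = F x].

(* The metric g_beta at the point x, as a quadratic form on the tangent vectors
   with dx-components v and dt-component the class modulo beta of tau in h;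
   here <d_{x_ir} mu_beta, tau> = d_{x_ir} (<mu, tau> / <mu, beta>), which
   vanishes for tau = beta. *)
Definition g_beta (R : realType) (k : nat) (d : 'I_k -> nat)
    (beta : tensor R (slot d)) (A : slot d -> R -> R) (x v : slot d -> R)
    (tau : tensor R (slot d)) : R :=
  \sum_(i < k) \sum_(r < d i)
    (Delta r x / (A (sl r) (x (sl r)) * mu_pair beta x) * v (sl r) ^+ 2
     + A (sl r) (x (sl r)) * mu_pair beta x / Delta r x
       * partial (sl r) (fun y => mu_pair tau y / mu_pair beta y) x ^+ 2).

Definition g_positive_definite (R : realType) (k : nat) (d : 'I_k -> nat)
    (beta : tensor R (slot d)) (I : slot d -> set R) (A : slot d -> R -> R) : Prop :=
  forall x v tau, box I x -> in_h tau ->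
    (exists s, v s != 0) \/ ~ (exists c : R, tau = c *: beta) ->
    0 < g_beta beta A x v tau.

Record separable_geometry (R : realType) (k : nat) (d : 'I_k -> nat)
    (beta : tensor R (slot d)) (I : slot d -> set R) (A : slot d -> R -> R) : Prop :=
  SeparableGeometry {
    sg_beta : in_h beta;
    sg_beta_neq0 : beta != 0;
    sg_interval : forall s, open_interval (I s);
    sg_smooth : forall s, smooth_on (I s) (A s);
    sg_A_neq0 : forall s y, I s y -> A s y != 0;
    sg_Delta_neq0 : forall x, box I x -> forall i (r : 'I_(d i)), Delta r x != 0;
    sg_sigma_neq0 : forall x, box I x -> mu_pair beta x != 0;
    sg_posdef : g_positive_definite beta I A
  }.

(* The scalar curvature of g_beta is a Killing potential. For a separable
   geometry this condition takes the following form in the coordinates x. *)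
Definition extremal (R : realType) (k : nat) (d : 'I_k -> nat)
    (beta : tensor R (slot d)) (I : slot d -> set R) (A : slot d -> R -> R) : Prop :=
  exists alpha : tensor R (slot d), in_h alpha /\
    forall x, box I x ->
      \sum_(i < k) \sum_(r < d i)
        mu_pair beta x ^+ (mdim d + 3) / Delta r x
        * partial (sl r) (partial (sl r)
            (fun y => A (sl r) (y (sl r)) / mu_pair beta y ^+ (mdim d + 1))) x
      = mu_pair alpha x.

(* F and d_{x_s} F are linearly independent over the ring R[x_s]. Polynomials in
   the variables x are identified with the functions they define on all of R^m. *)
Definition indep_with_partial (R : realType) (J : finType) (s : J)
    (F : (J -> R) -> R) : Prop :=
  forall a b : {poly R},
    (forall x : J -> R, a.[x s] * F x + b.[x s] * partial s F x = 0) ->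
    a = 0 /\ b = 0.

(* The factorization structure is, up to relabelling the groups,
   S^d W_1^* (x) <(1,0)> + <(1,0)^{(x) d}> (x) W_2^*, the group i1 being in the
   role of the first one (so that d = d_{i1}) and i2 in that of the second. *)
Definition structure_d1 (k : nat) (d : 'I_k -> nat) (i1 i2 : 'I_k) : Prop :=
  [/\ k = 2%N, i1 != i2 & d i2 = 1%N].

Definition exactly_one3 (P Q T : Prop) : Prop :=
  [\/ [/\ P, ~ Q & ~ T], [/\ ~ P, Q & ~ T] | [/\ ~ P, ~ Q & T]].

(* Main.v *)
(* Put L = <mu, beta>, c = m + 1 and, for the variable x_s, L = M_s + N_s x_s. The
   left-hand side of the extremality equation is the sum over s of
   (A_s'' L^2 - 2 c A_s' L N_s + c (c+1) A_s N_s^2) / Delta_s. Its poles along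
   x_ir = x_iq must cancel, and it must be affine in every variable separately and
   symmetric in every group. As a function of one x_s alone, the equation is a linear
   ODE for A_s whose solutions are polynomials. Comparing coefficients of high
   powers of x_s then gives quadratic relations between M_s and N_s, with constant
   coefficients; such a relation is trivial unless M_s and N_s are proportional.
   Thus either L is constant (1), or L splits as a product over one group (2), or the
   degree of A_s is at most d_i + 1, and the vanishing residues force A_ir to be
   independent of r. What remains are linear relations between the leading
   coefficients, one for every group of S, and one more for every two groups of S,
   because an element of h has no monomials mixing two groups. *)
Require Import Defs.
From HB Require Import structures.
From mathcomp Require Import all_boot all_order all_algebra all_fingroup.
From mathcomp Require Import all_classical all_reals all_analysis.
From mathcomp Require Import ring lra zify.
Import Order.TTheory GRing.Theory Num.Theory.
Import numFieldNormedType.Exports.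
Local Open Scope classical_set_scope.
Local Open Scope ring_scope.
Set Implicit Arguments.
Unset Strict Implicit.
Unset Printing Implicit Defensive.

(** * Polynomial functions and tensors *)

(** Along a line with L = M + N z the operator sending A to L^(c+2) (A / L^c)'' has kernel spanned
    by L^c and z L^c, so its diagonal on monomials of degree j is N^2 (j - c) (j - c - 1).
    Polynomial solvability, the degree bounds and the factor (m - d_p) (m + 1 - d_p) come from this
    product; only the degrees c and c + 1 resist a comparison of leading terms, and there the
    quadratic relations are needed. The delicate structure is m = d_p + 1: the coefficient used
    against these degrees also contains the contribution of the other group, a function of its
    single variable, which may have to be frozen without making M and N proportional. Residues do
    not compare A_ir and A_iq directly: they give a differential equation for the difference on the
    diagonal, and that it has only the zero solution takes three arguments, depending on the mixed
    slopes of L. The equation is known only on a box that permutations of a group need not preserve,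
    so symmetry of a tensor is read off after its values are spread to all points off the diagonals.
    For the converse, a group with a common numerator contributes, modulo h, an explicit quadratic
    form in L and its own part of L. *)

Lemma updE (R : realType) (J : finType) (x : J -> R) s z : upd x s z s = z.
Proof. by rewrite /upd eqxx. Qed.

Lemma updN (R : realType) (J : finType) (x : J -> R) s z t : t != s -> upd x s z t = x t.
Proof. by rewrite /upd => /negbTE ->. Qed.

Lemma upd_upd (R : realType) (J : finType) (x : J -> R) s y z :
  upd (upd x s y) s z = upd x s z.
Proof. by apply/funext => t; rewrite /upd; case: (t == s). Qed.

Lemma updC (R : realType) (J : finType) (x : J -> R) s t y z : s != t ->
  upd (upd x s y) t z = upd (upd x t z) s y.
Proof.
move=> st; apply/funext => u; rewrite /upd; have [ut|ut] := eqVneq u t; last by case: (u == s).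
by rewrite ut eq_sym (negbTE st).
Qed.

Lemma upd_id (R : realType) (J : finType) (x : J -> R) s : upd x s (x s) = x.
Proof. by apply/funext => t; rewrite /upd; case: eqP => // ->. Qed.

Lemma box_upd (R : realType) (J : finType) (I : J -> set R) x s z :
  box I x -> I s z -> box I (upd x s z).
Proof. by move=> Ix Iz t; rewrite /upd; case: eqP => // ->. Qed.

Lemma box_nonempty (R : realType) (J : finType) (I : J -> set R) :
  (forall s, open_interval (I s)) -> exists x, box I x.
Proof.
move=> oI; have /choice[x hx] : forall s, exists y, I s y by move=> s; case: (oI s).
by exists x.
Qed.

Lemma open_ball_sub (R : realType) (I : set R) x : open I -> I x ->
  exists2 e : R, 0 < e & forall y, `|y - x| < e -> I y.
Proof.
move=> oI Ix; have /nbhs_ballP[e /= e0 H] : nbhs x I by exact: open_nbhs_nbhs.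
by exists e => // y yx; apply: H; rewrite /ball /= distrC.
Qed.

Lemma poly_ball0 (R : realType) (p : {poly R}) (x e : R) : 0 < e ->
  (forall y, `|y - x| < e -> p.[y] = 0) -> p = 0.
Proof.
move=> e0 H; apply/eqP; apply/negP => /negP p0.
pose rs := [seq x + e / (i.+2)%:R | i <- iota 0 (size p)].
have := @max_poly_roots _ p rs p0; rewrite size_map size_iota ltnn => h.
suff : false by []; apply: h.
  apply/allP => _ /mapP[i _ ->]; apply/rootP/H.
  rewrite addrAC subrr add0r normrM gtr0_norm // ger0_norm ?invr_ge0 //.
  by rewrite gtr_pMr // invf_lt1 ?ltr0n // ltr1n.
rewrite map_inj_uniq ?iota_uniq // => i j /addrI /(mulfI (lt0r_neq0 e0)) /invr_inj.
by move=> /eqP; rewrite eqr_nat => /eqP [].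
Qed.

Lemma poly_interval0 (R : realType) (p : {poly R}) (I : set R) : open_interval I ->
  (forall y, I y -> p.[y] = 0) -> p = 0.
Proof.
case=> oI _ [x Ix] H; have [e e0 he] := open_ball_sub oI Ix.
by apply: (@poly_ball0 _ p x e) => // y /he /H.
Qed.

Lemma poly_interval_eq (R : realType) (p q : {poly R}) (I : set R) : open_interval I ->
  (forall y, I y -> p.[y] = q.[y]) -> p = q.
Proof.
move=> oI H; apply/eqP; rewrite -subr_eq0; apply/eqP.
by apply: (poly_interval0 oI) => y Iy; rewrite !hornerE H // subrr.
Qed.

Lemma poly_all_eq (R : realType) (p q : {poly R}) :
  (forall y, p.[y] = q.[y]) -> p = q.
Proof.
move=> H; apply/eqP; rewrite -subr_eq0; apply/eqP.
by apply: (@poly_ball0 _ _ 0 1) => // y _; rewrite !hornerE H subrr.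
Qed.

(* Polynomial functions, described without multivariate polynomials as the
   functions that are polynomial along every polynomial curve. *)
Definition polyfun (R : realType) (J : finType) (f : (J -> R) -> R) :=
  forall c : J -> {poly R}, exists p : {poly R},
    forall t, f (fun s => (c s).[t]) = p.[t].

Section PolyFun.
Variables (R : realType) (J : finType).
Implicit Types f g : (J -> R) -> R.

Lemma polyfun_cst (a : R) : polyfun (fun _ : J -> R => a).
Proof. by move=> c; exists a%:P => t; rewrite hornerC. Qed.

Lemma polyfun_coord s (p : {poly R}) : polyfun (fun x : J -> R => p.[x s]).
Proof. by move=> c; exists (p \Po c s) => t; rewrite horner_comp. Qed.

Lemma polyfun_add f g : polyfun f -> polyfun g -> polyfun (fun x => f x + g x).
Proof.
by move=> hf hg c; have [p hp] := hf c; have [q hq] := hg c; exists (p + q) => t;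
  rewrite hp hq hornerD.
Qed.

Lemma polyfun_mul f g : polyfun f -> polyfun g -> polyfun (fun x => f x * g x).
Proof.
by move=> hf hg c; have [p hp] := hf c; have [q hq] := hg c; exists (p * q) => t;
  rewrite hp hq hornerM.
Qed.

Lemma polyfun_scale a f : polyfun f -> polyfun (fun x => a * f x).
Proof. exact/polyfun_mul/polyfun_cst. Qed.

Lemma polyfun_sub f g : polyfun f -> polyfun g -> polyfun (fun x => f x - g x).
Proof.
by move=> hf hg c; have [p hp] := hf c; have [q hq] := hg c; exists (p - q) => t;
  rewrite hp hq hornerD hornerN.
Qed.

Lemma polyfun_sum (K : Type) (r : seq K) (P : pred K) (F : K -> (J -> R) -> R) :
  (forall k, polyfun (F k)) -> polyfun (fun x => \sum_(k <- r | P k) F k x).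
Proof.
move=> hF c; have /choice[p hp] := fun k => hF k c.
by exists (\sum_(k <- r | P k) p k) => t; rewrite horner_sum; apply: eq_bigr.
Qed.

Lemma polyfun_prod (K : Type) (r : seq K) (P : pred K) (F : K -> (J -> R) -> R) :
  (forall k, polyfun (F k)) -> polyfun (fun x => \prod_(k <- r | P k) F k x).
Proof.
move=> hF c; have /choice[p hp] := fun k => hF k c.
by exists (\prod_(k <- r | P k) p k) => t; rewrite horner_prod; apply: eq_bigr.
Qed.

Lemma polyfun_comp (K : finType) (h : J -> K) f : polyfun f ->
  polyfun (fun x : K -> R => f (fun s => x (h s))).
Proof. by move=> hf c; have [p hp] := hf (fun s => c (h s)); exists p. Qed.

(** A constant [q] freezes the coordinate [s]; [q = 'X] restricts [f] to the diagonal where the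
    coordinates [s] and [t] agree, which is where residues are taken. *)
Lemma polyfun_upd s f (q : {poly R}) t : polyfun f ->
  polyfun (fun x : J -> R => f (upd x s (q.[x t]))).
Proof.
move=> hf c; have [p hp] := hf (fun u => if u == s then q \Po c t else c u).
exists p => z; rewrite -hp; congr f; apply/funext => u; rewrite /upd.
by case: ifP => // _; rewrite horner_comp.
Qed.

Lemma polyfun_updc s f a : polyfun f -> polyfun (fun x : J -> R => f (upd x s a)).
Proof.
move=> hf c; have [p hp] := @polyfun_upd s f a%:P s hf c.
by exists p => t; rewrite -hp hornerC.
Qed.

Lemma polyfun_line f x0 x : polyfun f -> exists p : {poly R},
  forall t, f (fun s => x0 s + t * (x s - x0 s)) = p.[t].
Proof.
move=> hf; have [p hp] := hf (fun s => (x0 s)%:P + 'X * (x s - x0 s)%:P).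
by exists p => t; rewrite -hp; congr f; apply/funext => s; rewrite !hornerE.
Qed.

Lemma line1 (x0 x : J -> R) : (fun s => x0 s + 1 * (x s - x0 s)) = x.
Proof. by apply/funext => s; ring. Qed.

Lemma line0 (x0 x : J -> R) : (fun s => x0 s + 0 * (x s - x0 s)) = x0.
Proof. by apply/funext => s; ring. Qed.

(** On the line from a point where [f] is nonzero (parameter 0) to an arbitrary [x] (parameter 1)
    both factors are univariate polynomials, and the first is not the zero polynomial. *)
Lemma polyfun_mulf0 f g : polyfun f -> polyfun g -> (forall x, f x * g x = 0) ->
  (forall x, f x = 0) \/ (forall x, g x = 0).
Proof.
move=> hf hg fg; have [[x0 fx0]|] := pselect (exists x0, f x0 != 0); last first.
  by move=> /forallNP h; left => x; have /negP := h x; rewrite negbK => /eqP.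
right => x; have [p hp] := polyfun_line x0 x hf; have [q hq] := polyfun_line x0 x hg.
have pq : p * q = 0.
  by apply: (@poly_ball0 _ _ 0 1) => // t _; rewrite hornerM -hp -hq fg.
have /eqP := pq; rewrite mulf_eq0 => /orP[] /eqP E.
  by have := hp 0; rewrite line0 E horner0 => /eqP; rewrite (negbTE fx0).
by have := hq 1; rewrite line1 E horner0.
Qed.

(** Identity principle: the segment from a point of the box towards any [x] stays in the box for
    small parameters, so the univariate restriction of [f] is zero and vanishes at parameter 1
    too. *)
Lemma polyfun_box0 (I : J -> set R) f : (forall s, open_interval (I s)) ->
  polyfun f -> (forall x, box I x -> f x = 0) -> forall x, f x = 0.
Proof.
move=> oI hf H x; have [x0 Ix0] := box_nonempty oI.
have [p hp] := polyfun_line x0 x hf.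
have /choice[e he] : forall s, exists e : R, 0 < e /\ forall y, `|y - x0 s| < e -> I s y.
  move=> s; have [oIs _ _] := oI s; have [e e0 h] := open_ball_sub oIs (Ix0 s).
  by exists e.
have [eps eps0 heps] : exists2 eps : R, 0 < eps &
    forall s, s \in enum J -> eps * `|x s - x0 s| < e s.
  elim: (enum J) => [|s l [eps eps0 IH]]; first by exists 1.
  have [e0 _] := he s; exists (Num.min eps (e s / (1 + `|x s - x0 s|))).
    by rewrite lt_min eps0 divr_gt0 // ltr_pwDl.
  move=> t; rewrite inE => /predU1P[->|tl]; last first.
    by apply: le_lt_trans (IH t tl); rewrite ler_wpM2r // ge_min lexx.
  apply: (@le_lt_trans _ _ (e s / (1 + `|x s - x0 s|) * `|x s - x0 s|)).
    by rewrite ler_wpM2r // ge_min lexx orbT.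
  rewrite -mulrA gtr_pMr // mulrC ltr_pdivrMr ?ltr_pwDl // mul1r.
  by rewrite ltrDr.
have p0 : p = 0.
  apply: (@poly_ball0 _ _ 0 eps) => // t; rewrite subr0 => te; rewrite -hp; apply: H => s.
  apply: (he s).2; rewrite addrAC subrr add0r normrM.
  apply: le_lt_trans (heps s (mem_enum _ _)); rewrite ler_wpM2r //; exact: ltW.
by have := hp 1; rewrite line1 p0 horner0.
Qed.

Lemma polyfun_box_neq0 (I : J -> set R) f : (forall s, open_interval (I s)) ->
  polyfun f -> (exists x, f x != 0) -> exists2 x, box I x & f x != 0.
Proof.
move=> oI hf [x0 fx0]; have [//|h] := pselect (exists2 x, box I x & f x != 0).
have := @polyfun_box0 I f oI hf; move/(_ _ x0) => E; rewrite E ?eqxx // in fx0.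
move=> x Ix; apply/eqP/negP => /negP fx; apply: h; by exists x.
Qed.

Lemma polyfun_mul_neq0 f g : polyfun f -> polyfun g ->
  (exists x, f x != 0) -> (exists x, g x != 0) -> exists x, f x * g x != 0.
Proof.
move=> hf hg [x fx] [y gy]; have [//|/forallNP h] := pselect (exists x, f x * g x != 0).
have [z|f0|g0] := polyfun_mulf0 hf hg.
- by have /negP := h z; rewrite negbK => /eqP.
- by rewrite f0 eqxx in fx.
- by rewrite g0 eqxx in gy.
Qed.

End PolyFun.

(** For multi-affine functions this is the partial derivative, obtained without analysis; it never
    depends on the coordinate [s]. *)
Definition slope (R : realType) (J : finType) (s : J) (f : (J -> R) -> R) (x : J -> R) : R :=
  f (upd x s 1) - f (upd x s 0).

Definition multiaffine (R : realType) (J : finType) (f : (J -> R) -> R) :=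
  forall x s z, f (upd x s z) = f (upd x s 0) + z * slope s f x.

Definition tev (R : realType) (J : finType) (T : tensor R J) (x : J -> R) : R :=
  tpair (ptensor (fun s => (1, x s))) T.

Section Tev.
Variables (R : realType) (J : finType).
Implicit Types (T : tensor R J) (x : J -> R).

Lemma tevE T x : tev T x =
  \sum_(f : {ffun J -> bool}) (\prod_(s : J) coord2 (1, x s) (f s)) * T f.
Proof. by apply: eq_bigr => f _; rewrite ffunE. Qed.

Lemma polyfun_tev T : polyfun (tev T).
Proof.
have -> : tev T = fun x => \sum_(f : {ffun J -> bool})
    (\prod_(s : J) coord2 (1, x s) (f s)) * T f.
  by apply/funext => x; rewrite tevE.
apply: polyfun_sum => f; apply: polyfun_mul; last exact: polyfun_cst.
apply: polyfun_prod => s; case: (f s); rewrite /coord2 /=; last exact: polyfun_cst.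
by move=> c; exists (c s).
Qed.

Lemma prod_upd x s z (f : {ffun J -> bool}) :
  \prod_t coord2 (1, upd x s z t) (f t) =
  coord2 (1, z) (f s) * \prod_(t | t != s) coord2 (1, x t) (f t).
Proof.
by rewrite (bigD1 s) //= updE; congr (_ * _); apply: eq_bigr => t ts; rewrite updN.
Qed.

Lemma multiaffine_tev T : multiaffine (tev T).
Proof.
move=> x s z; rewrite /slope !tevE -sumrB mulr_sumr -big_split /=.
apply: eq_bigr => f _; rewrite !prod_upd.
by case: (f s); rewrite /coord2 /=; ring.
Qed.

Lemma tevD T U x : tev (T + U) x = tev T x + tev U x.
Proof. by rewrite /tev /tpair -big_split; apply: eq_bigr => f _; rewrite [X in _ * X]ffunE mulrDr. Qed.

Lemma tevZ a T x : tev (a *: T) x = a * tev T x.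
Proof.
by rewrite /tev /tpair mulr_sumr; apply: eq_bigr => f _; rewrite [X in _ * X]ffunE mulrCA.
Qed.

Lemma tev_sum (K : Type) (r : seq K) (P : pred K) (F : K -> tensor R J) x :
  tev (\sum_(k <- r | P k) F k) x = \sum_(k <- r | P k) tev (F k) x.
Proof.
elim/big_rec2 : _ => [|k y T _ <-]; last by rewrite tevD.
by rewrite /tev /tpair big1 // => f _; rewrite [X in _ * X]ffunE mulr0.
Qed.

Lemma tev_ptensor (v : J -> R * R) x :
  tev (ptensor v) x = \prod_s ((v s).1 + x s * (v s).2).
Proof.
rewrite tevE; transitivity (\sum_(f : {ffun J -> bool})
  \prod_s (coord2 (1, x s) (f s) * coord2 (v s) (f s))).
  by apply: eq_bigr => f _; rewrite big_split; congr (_ * _); rewrite ffunE.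
rewrite -(bigA_distr_bigA (fun s b => coord2 (1, x s) b * coord2 (v s) b)).
by apply: eq_bigr => s _; rewrite big_bool /coord2 /= mul1r addrC.
Qed.

(** Evaluation at the 0/1 point supported where [f] is true keeps only the coefficients at [g <= f],
    so coefficients are recovered by induction on the number of true entries. *)
Lemma tev_inj T U : (forall x, tev T x = tev U x) -> T = U.
Proof.
move=> H; suff h n (f : {ffun J -> bool}) : (#|[pred s | f s]| < n)%N -> T f = U f.
  by apply/ffunP => f; apply: (h _ f (ltnSn _)).
elim: n f => // n IH f; rewrite ltnS => fn.
have := H (fun s => if f s then 1 else 0); rewrite !tevE (bigD1 f) //= [in RHS](bigD1 f) //=.
have -> : \prod_s coord2 (1, if f s then 1 else 0) (f s) = 1 :> R.
  by apply: big1 => s _; case: (f s).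
rewrite !mul1r; set a := \sum_(_ | _) _; set b := \sum_(_ | _) _.
suff -> : a = b by move/addIr.
apply: eq_bigr => g gf; have [/forallP gle|] := boolP [forall s, g s ==> f s].
  congr (_ * _); apply: IH; apply: leq_trans fn; apply: proper_card; apply/properP; split.
    by apply/fintype.subsetP => s; rewrite !inE => gs; have := gle s; rewrite gs.
  have [[s sf]|/forallNP h] := pselect (exists s, f s != g s); last first.
    by case/eqP: gf; apply/ffunP => s; have /negP := h s; rewrite negbK => /eqP.
  by exists s; have := gle s; move: sf; rewrite !inE; case: (f s); case: (g s).
rewrite negb_forall => /existsP[s]; rewrite negb_imply => /andP[gs fs].
by rewrite (bigD1 s) //= gs (negbTE fs) /= !mul0r.
Qed.

(** The part [U] of [T] with multi-indices true at [s] is, as a function, [x s] times the slope. *)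
Lemma tev_indep T s : (forall x, slope s (tev T) x = 0) ->
  forall f : {ffun J -> bool}, f s -> T f = 0.
Proof.
move=> H f fs; pose U : tensor R J := [ffun g : {ffun J -> bool} => if g s then T g else 0].
suff /ffunP /(_ f) : U = 0 by rewrite !ffunE fs.
apply: tev_inj => x; transitivity (x s * slope s (tev T) x); last first.
  rewrite H mulr0; apply/esym; by rewrite /tev /tpair big1 // => g _; rewrite [X in _ * X]ffunE mulr0.
rewrite /slope !tevE -sumrB mulr_sumr; apply: eq_bigr => g _.
rewrite -{1}(upd_id x s) !prod_upd ffunE.
by case: (g s); rewrite /coord2 /=; ring.
Qed.

End Tev.

Section MultiAffine.
Variables (R : realType) (J : finType).
Implicit Types (f : (J -> R) -> R) (x : J -> R).

Lemma slope_upd f s x z : slope s f (upd x s z) = slope s f x.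
Proof. by rewrite /slope !upd_upd. Qed.

Lemma polyfun_slope f s : polyfun f -> polyfun (slope s f).
Proof. by move=> hf; apply: polyfun_sub; apply: polyfun_updc. Qed.

Lemma multiaffine_slope f s : multiaffine f -> multiaffine (slope s f).
Proof.
move=> hf x t z; have [->|ts] := eqVneq t s.
  by rewrite {3}/slope !slope_upd subrr mulr0 addr0.
have E a : f (upd (upd x t z) s a) = f (upd (upd x t 0) s a) +
    z * (f (upd (upd x t 1) s a) - f (upd (upd x t 0) s a)).
  by rewrite !(updC _ _ _ ts) hf /slope.
rewrite /slope !E; ring.
Qed.

Lemma multiaffine_line f x s z : multiaffine f ->
  f (upd x s z) = f x + (z - x s) * slope s f x.
Proof.
move=> hf; have := hf x s (x s); rewrite upd_id (hf x s z) => ->; ring.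
Qed.

Lemma slopeC f s t x : slope s (slope t f) x = slope t (slope s f) x.
Proof.
have [->//|st] := eqVneq s t; rewrite /slope !(updC _ _ _ st); ring.
Qed.

(** Coordinates are moved into the sets [Z s] one at a time: a property known on the grid of the
    [Z s] spreads to the box if it passes from the nodes of a direction to the whole line. One node
    per direction gives constancy, two give multi-affine interpolation. *)
Lemma box_ind (I Z : J -> set R) (P : (J -> R) -> Prop) :
  (forall s, Z s `<=` I s) -> (forall x, box Z x -> P x) ->
  (forall x s, box I x -> (forall z, Z s z -> P (upd x s z)) -> P x) ->
  forall x, box I x -> P x.
Proof.
move=> ZI base step x; suff h (l : seq J) : forall x, box I x ->
    (forall s, s \notin l -> Z s (x s)) -> P x.
  by move=> Ix; apply: (h (enum J)) => // s; rewrite mem_enum.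
elim: l => [|s l IH] {}x Ix Zx; first by apply: base => s; apply: Zx.
apply: (step x s) => // z Zz; apply: IH => [|t tl]; first exact: box_upd Ix (ZI _ _ Zz).
rewrite /upd; have [->|ts] := eqVneq t s; first by [].
by apply: Zx; rewrite inE negb_or ts.
Qed.

Lemma box_cst (I : J -> set R) f :
  (forall x s z, box I x -> I s z -> f (upd x s z) = f x) ->
  forall x y, box I x -> box I y -> f x = f y.
Proof.
move=> H x y Ix Iy; apply: (@box_ind I (fun s => [set y s]) (fun x => f x = f y)) Ix => //.
- by move=> s _ ->; apply: Iy.
- by move=> z zy; congr (f _); apply/funext.
- by move=> z s Iz /(_ _ erefl); rewrite H.
Qed.

(* Interpolation at the points of a grid with two nodes in every direction. *)
Lemma box_multiaffine (I : J -> set R) f : (forall s, open_interval (I s)) ->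
  (forall x s, box I x -> exists a b, forall z, I s z -> f (upd x s z) = a + b * z) ->
  exists T : tensor R J, forall x, box I x -> f x = tev T x.
Proof.
move=> oI aff; have /choice[u hu] : forall s, exists u : R * R,
    [/\ I s u.1, I s u.2 & u.1 != u.2].
  move=> s; case: (oI s) => oIs _ [y Iy]; have [e e0 he] := open_ball_sub oIs Iy.
  exists (y, y + e / 2); split => //=; first by apply: he; rewrite addrAC subrr add0r
    ger0_norm ?divr_ge0 ?ltW // gtr_pMr // invf_lt1 ?ltr0n // ltr1n.
  by rewrite eq_sym -subr_eq0 addrAC subrr add0r mulf_neq0 ?invr_neq0 ?lt0r_neq0.
pose node (e : {ffun J -> bool}) s := if e s then (u s).2 else (u s).1.
(* [lag e s] is the affine Lagrange polynomial that is 1 at the node chosen by [e s] and 0 at the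
   other, stored as (constant term, coefficient) to fit [ptensor]. *)
pose lag (e : {ffun J -> bool}) s : R * R :=
  if e s then (- (u s).1 / ((u s).2 - (u s).1), ((u s).2 - (u s).1)^-1)
  else ((u s).2 / ((u s).2 - (u s).1), - ((u s).2 - (u s).1)^-1).
have uE s : (u s).2 - (u s).1 != 0 by case: (hu s) => _ _; rewrite subr_eq0 eq_sym.
exists (\sum_e f (node e) *: ptensor (lag e)).
pose Z s : set R := [set z | z = (u s).1 \/ z = (u s).2].
apply: (@box_ind I Z) => [s z [->|->]|x Zx|x s Ix hZ].
- by case: (hu s).
- by case: (hu s).
- pose e := [ffun s => x s == (u s).2].
  have xe : x = node e.
    apply/funext => s; rewrite /node ffunE; case: eqP => [//|]; by case: (Zx s).
  rewrite tev_sum (bigD1 e) //= big1 ?addr0; last first.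
    move=> g ge; rewrite tevZ tev_ptensor; have [[s sg]|/forallNP h] := pselect (exists s, g s != e s).
      have E0 : (lag g s).1 + x s * (lag g s).2 = 0.
        rewrite xe /lag /node; move: sg; have := uE s.
        by case: (g s); case: (e s) => //= ? _; field.
      by rewrite (bigD1 s) //= E0 mul0r mulr0.
    by case/eqP: ge; apply/ffunP => s; have /negP := h s; rewrite negbK => /eqP.
  rewrite tevZ tev_ptensor big1 ?mulr1 -?xe // => s _.
  by rewrite xe /lag /node; have := uE s; case: (e s) => //= ?; field.
- have [a [b hab]] := aff x s Ix; set T := \sum_e _ in hZ *.
  have [Iu Iv uv] := hu s.
  have := hZ (u s).1 (or_introl erefl); have := hZ (u s).2 (or_intror erefl).
  rewrite !hab // !(multiaffine_line x s _ (@multiaffine_tev _ _ T)) => e2 e1.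
  rewrite -{1}(upd_id x s) hab; last exact: Ix.
  have /(mulfI (uE s)) Eb : ((u s).2 - (u s).1) * b = ((u s).2 - (u s).1) * slope s (tev T) x.
    have -> : ((u s).2 - (u s).1) * b = a + b * (u s).2 - (a + b * (u s).1) by ring.
    rewrite e1 e2; ring.
  have -> : a + b * x s = a + b * (u s).1 + (x s - (u s).1) * b by ring.
  rewrite e1 Eb; ring.
Qed.

End MultiAffine.

Lemma slope0_upd (R : realType) (J : finType) (f : (J -> R) -> R) x u w :
  multiaffine f -> slope u f x = 0 -> f (upd x u w) = f x.
Proof. by move=> mf f0; rewrite multiaffine_line // f0 mulr0 addr0. Qed.

(** * Symmetric tensors, and symmetric functions defined off the diagonals *)

Section Symmetric.
Variables (R : realType) (n : nat).
Implicit Types (y : 'I_n -> R) (B : tensor R 'I_n).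

Definition perm_tensor (p : {perm 'I_n}) B : tensor R 'I_n :=
  [ffun g : {ffun 'I_n -> bool} => B [ffun r => g (p r)]].

Lemma tev_perm (p : {perm 'I_n}) B y :
  tev (perm_tensor p B) y = tev B (y \o p).
Proof.
rewrite !tevE (reindex (fun g : {ffun 'I_n -> bool} => [ffun r => g ((p^-1)%g r)])) /=; last first.
  exists (fun g : {ffun 'I_n -> bool} => [ffun r => g (p r)]) => g _; apply/ffunP => r;
    by rewrite !ffunE ?permK ?permKV.
apply: eq_bigr => g _; rewrite ffunE; congr (_ * B _).
  by rewrite (reindex_inj (@perm_inj _ p)); apply: eq_bigr => r _; rewrite ffunE permK.
by apply/ffunP => r; rewrite !ffunE permK.
Qed.

Lemma symmetric_tensorP B :
  symmetric_tensor B <-> forall (p : {perm 'I_n}) y, tev B (y \o p) = tev B y.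
Proof.
split=> [sB p y|H p f].
  by rewrite -tev_perm; congr tev; apply/ffunP => g; rewrite ffunE sB.
have /ffunP /(_ f) : perm_tensor p B = B.
  by apply: tev_inj => y; rewrite tev_perm H.
by rewrite ffunE.
Qed.

Lemma upd_inj y r z : injective y -> (forall t, t != r -> z != y t) ->
  injective (upd y r z).
Proof.
move=> iy zy s t; rewrite /upd; case: eqP => [->|/eqP sr]; case: eqP => [->//|/eqP tr].
- by move=> E; have := zy _ tr; rewrite E eqxx.
- by move=> E; have := zy _ sr; rewrite E eqxx.
- exact: iy.
Qed.

(** The intervals of a group differ, so the box is not stable under permutations. Interpolation on
    the box gives a tensor [B]; affinity in each variable carries [f = tev B] one coordinate at a
    time to every injective point, in particular to permuted points of the box, and [B] inherits the
    symmetry of [f]. *)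
Lemma symmetric_multiaffine (I : 'I_n -> set R) (f : ('I_n -> R) -> R) :
  (forall s, open_interval (I s)) -> (forall y, box I y -> injective y) ->
  (forall (p : {perm 'I_n}) y, injective y -> f (y \o p) = f y) ->
  (forall y r, injective y -> exists a b, forall z, injective (upd y r z) ->
     f (upd y r z) = a + b * z) ->
  exists2 B : tensor R 'I_n, symmetric_tensor B & forall y, box I y -> f y = tev B y.
Proof.
move=> oI injI symf aff.
have [x s Ix|B hB] := box_multiaffine oI (f := f).
  have [a [b hab]] := aff x s (injI _ Ix); exists a, b => z Iz.
  by apply/hab/injI; exact: box_upd.
have fB (l : seq 'I_n) : forall y, injective y -> (forall s, s \notin l -> I s (y s)) ->
    f y = tev B y.
  elim: l => [|s l IH] y iy Iy; first by apply: hB => s; apply: Iy.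
  have [a [b hab]] := aff y s iy.
  pose q := a%:P + b%:P * 'X - (tev B (upd y s 0))%:P - (slope s (tev B) y)%:P * 'X.
  have qE z : q.[z] = a + b * z - tev B (upd y s z).
    rewrite !hornerE (@multiaffine_tev _ _ B y s z); ring.
  (* The product kills the finitely many [z] at which [upd y s z] is not injective and nothing is
     known about [f]. *)
  have : q * \prod_(t | t != s) ('X - (y t)%:P) = 0.
    apply: (poly_interval0 (oI s)) => z Iz; rewrite hornerM horner_prod qE.
    have [/existsP[t /andP[ts /eqP zt]]|/existsPn zy] := boolP [exists t, (t != s) && (z == y t)].
      by rewrite (bigD1 t) //= hornerXsubC zt (subrr (y t)) mul0r mulr0.
    have iz : injective (upd y s z).
      by apply: upd_inj => // t ts; have := zy t; rewrite ts.
    rewrite -hab // IH ?subrr ?mul0r // => t tl; rewrite /upd.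
    by case: eqP => [->//|/eqP ts]; apply: Iy; rewrite inE negb_or ts.
  move=> /eqP; rewrite mulf_eq0 => /orP[/eqP q0|/eqP p0]; last first.
    have /monic_neq0 : \prod_(t | t != s) ('X - (y t)%:P) \is monic by apply: monic_prod_XsubC.
    by rewrite p0 eqxx.
  have := qE (y s); rewrite q0 horner0 upd_id => /esym/eqP; rewrite subr_eq0 => /eqP <-.
  by rewrite -[in LHS](upd_id y s) hab // upd_id.
exists B => //; apply/symmetric_tensorP => p y; apply/eqP; rewrite -subr_eq0; apply/eqP.
have := @polyfun_box0 _ _ I (fun y => tev B (y \o p) - tev B y) oI; apply.
  by apply: polyfun_sub; [exact: (polyfun_comp p (@polyfun_tev _ _ B))|exact: polyfun_tev].
move=> {}y Iy; have iy := injI _ Iy.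
have fT x : injective x -> f x = tev B x.
  by move=> ix; apply: (fB (enum 'I_n)) => // s; rewrite mem_enum.
by rewrite -!fT ?symf ?subrr //; apply: inj_comp => //; apply: perm_inj.
Qed.

End Symmetric.

(** * Sums over a group of variables *)

Lemma coefM_top (R : realType) (p q : {poly R}) a b :
  (size p <= a.+1)%N -> (size q <= b.+1)%N -> (p * q)`_(a + b) = p`_a * q`_b.
Proof.
move=> pa qb; have ab : (a < (a + b).+1)%N by rewrite ltnS leq_addr.
rewrite coefM (bigD1 (Ordinal ab)) //= addKn big1 ?addr0 // => i.
rewrite -val_eqE /= => ia; have [ai|] := ltnP a i.
  by rewrite nth_default ?mul0r // (leq_trans pa).
rewrite leq_eqVlt (negbTE ia) /= => ia'; rewrite [q`__]nth_default ?mulr0 //.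
by apply: (leq_trans qb); lia.
Qed.

Lemma size_mul_leqS (R : realType) (p q : {poly R}) a b :
  (size p <= a.+1)%N -> (size q <= b.+1)%N -> (size (p * q)%R <= (a + b).+1)%N.
Proof. by move=> pa qb; have := size_polyMleq p q; lia. Qed.

Lemma size_mul_leq_add (R : realType) (p q : {poly R}) a b :
  (size p <= a.+1)%N -> (size q <= b)%N -> (size (p * q)%R <= a + b)%N.
Proof. by move=> pa qb; have := size_polyMleq p q; lia. Qed.

Section Lagrange.
Variables (R : realType) (n : nat).
Implicit Types (y : 'I_n -> R) (q r s : 'I_n).

Definition gdelta r y : R := \prod_(s | s != r) (y r - y s).

Definition wpoly r y : {poly R} := \prod_(s | s != r) ('X - (y s)%:P).

Definition wpoly2 r q y : {poly R} := \prod_(s | (s != r) && (s != q)) ('X - (y s)%:P).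

Lemma size_prod_XsubC_cond (P : pred 'I_n) y :
  size (\prod_(s | P s) ('X - (y s)%:P)) = #|P|.+1.
Proof. by rewrite -big_filter size_prod_XsubC cardE. Qed.

Lemma size_wpoly r y : size (wpoly r y) = n.
Proof.
rewrite size_prod_XsubC_cond; have := cardC1 r; rewrite card_ord.
rewrite (eq_card (B := fun s => s != r)) // => ->; have := ltn_ord r; lia.
Qed.

Lemma coef_wpoly r y : (wpoly r y)`_n.-1 = 1.
Proof.
have /monicP : wpoly r y \is monic by apply: monic_prod_XsubC.
by rewrite /lead_coef size_wpoly.
Qed.

Lemma wpolyE r q y : q != r -> wpoly r y = ('X - (y q)%:P) * wpoly2 r q y.
Proof. by move=> qr; rewrite /wpoly (bigD1 q). Qed.

Lemma size_wpoly2 r q y : q != r -> (size (wpoly2 r q y)).+1 = n.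
Proof.
move=> qr; rewrite -(size_wpoly r y) (wpolyE _ qr) size_Mmonic ?size_XsubC //.
  by rewrite polyXsubC_eq0.
exact: monic_prod_XsubC.
Qed.

Lemma gdelta_upd r y z : gdelta r (upd y r z) = (wpoly r y).[z].
Proof.
rewrite horner_prod; apply: eq_bigr => s sr; by rewrite updE updN // hornerXsubC.
Qed.

Lemma gdelta_updN r q y z : q != r ->
  gdelta q (upd y r z) = (y q - z) * (wpoly2 r q y).[y q].
Proof.
move=> qr; rewrite /gdelta (bigD1 r) 1?eq_sym //= updE updN // horner_prod.
congr (_ * _); apply: eq_big => [s|s /andP[_ sr]]; first by rewrite andbC.
by rewrite updN // hornerXsubC.
Qed.

Lemma wpoly2_neq0 r q y : injective y -> q != r -> (wpoly2 r q y).[y q] != 0.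
Proof.
move=> iy qr; rewrite horner_prod; apply/prodf_neq0 => s /andP[sr sq].
by rewrite hornerXsubC subr_eq0; apply: contra sq => /eqP /iy ->.
Qed.

Lemma wpoly2_root r q s y : q != r -> s != q -> (wpoly2 r s y).[y q] = 0.
Proof.
move=> qr sq; rewrite horner_prod (bigD1 q) ?qr 1?eq_sym //=.
by rewrite hornerXsubC subrr mul0r.
Qed.

(* The rational function [\sum_q p_q(z) / Delta_q(z)] of the coordinate
   [z = y_r] has poles only where [z = y_q]; clearing the denominator
   [Delta_r(z)] gives the polynomial identity behind the next two lemmas. *)
Lemma lagrange_sum r y (p : 'I_n -> {poly R}) z : injective y ->
  (forall s, s != r -> z != y s) ->
  (wpoly r y).[z] * \sum_(q | q != r) (p q).[z] / gdelta q (upd y r z) =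
  - (\sum_(q | q != r) (((wpoly2 r q y).[y q])^-1)%:P * (p q * wpoly2 r q y)).[z].
Proof.
move=> iy zy; rewrite mulr_sumr horner_sum -sumrN; apply: eq_bigr => q qr.
rewrite gdelta_updN // (wpolyE y qr) !hornerM hornerXsubC hornerC.
have := wpoly2_neq0 iy qr; have := zy q qr; rewrite -subr_eq0 => zq D0.
by field; rewrite D0 /= -opprB oppr_eq0.
Qed.

(** Cleared of denominators, the equation reads [rho = wpoly r y * h + g] with [g] of degree below
    [n.-1 + e]; the top coefficient comes from [h] since [wpoly] is monic. At [z = y q] only the
    term [q] of [g] survives: the last clause is the vanishing of the residue there. *)
Lemma lagrange_nec e r y (f : R -> R) (p : 'I_n -> {poly R}) (h : {poly R}) (I : set R) :
  injective y -> (forall z, I z -> forall s, s != r -> z != y s) ->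
  (forall z, I z -> f z / gdelta r (upd y r z) +
     \sum_(q | q != r) (p q).[z] / gdelta q (upd y r z) = h.[z]) ->
  (forall q, q != r -> (size (p q) <= e.+1)%N) -> (size h <= e.+1)%N ->
  exists rho : {poly R}, [/\ forall z, I z -> f z = rho.[z],
    (size rho <= (n.-1 + e).+1)%N, rho`_(n.-1 + e) = h`_e &
    forall q, q != r -> rho.[y q] = (p q).[y q]].
Proof.
move=> iy zy E sp sh; have n0 := ltn_ord r.
pose g := \sum_(q | q != r) (((wpoly2 r q y).[y q])^-1)%:P * (p q * wpoly2 r q y).
have sg : (size g <= n.-1 + e)%N.
  apply: (leq_trans (size_sum _ _ _)); apply/bigmax_leqP => q qr.
  rewrite mul_polyC; apply: (leq_trans (size_scale_leq _ _)).
  by rewrite addnC size_mul_leq_add ?sp // -(size_wpoly2 y qr).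
have sw : (size (wpoly r y) <= n.-1.+1)%N by rewrite size_wpoly; lia.
exists (wpoly r y * h + g); split.
- move=> z Iz; have w0 : (wpoly r y).[z] != 0.
    rewrite horner_prod; apply/prodf_neq0 => s sr.
    by rewrite hornerXsubC subr_eq0 (zy z).
  rewrite hornerD hornerM -E // mulrDr lagrange_sum //; last exact: zy.
  rewrite -/g gdelta_upd -addrA addNr addr0; by rewrite mulrC divfK.
- apply: (leq_trans (size_polyD _ _)); rewrite geq_max size_mul_leqS //=; exact: leqW.
- by rewrite coefD coefM_top // coef_wpoly mul1r [g`__]nth_default ?addr0.
- move=> q qr; rewrite hornerD hornerM (wpolyE y qr) hornerM hornerXsubC subrr !mul0r add0r.
  rewrite horner_sum (bigD1 q) //= big1 ?addr0; last first.
    by move=> s /andP[sr sq]; rewrite !hornerM (wpoly2_root y qr sq) !mulr0.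
  by rewrite !hornerM hornerC; have := wpoly2_neq0 iy qr => ?; field.
Qed.

(** Matching values at the points [y q] make [p r - g] divisible by [wpoly r y], and the quotient is
    [h]. *)
Lemma lagrange_suf e r y (p : 'I_n -> {poly R}) : injective y ->
  (size (p r) <= (n.-1 + e).+1)%N -> (forall q, q != r -> (size (p q) <= e.+1)%N) ->
  (forall q, q != r -> (p r).[y q] = (p q).[y q]) ->
  exists h : {poly R}, [/\ (size h <= e.+1)%N, h`_e = (p r)`_(n.-1 + e) &
    forall z, (forall s, s != r -> z != y s) ->
      \sum_q (p q).[z] / gdelta q (upd y r z) = h.[z]].
Proof.
move=> iy spr sp pE; have n0 := ltn_ord r.
pose g := \sum_(q | q != r) (((wpoly2 r q y).[y q])^-1)%:P * (p q * wpoly2 r q y).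
have sg : (size g <= n.-1 + e)%N.
  apply: (leq_trans (size_sum _ _ _)); apply/bigmax_leqP => q qr.
  rewrite mul_polyC; apply: (leq_trans (size_scale_leq _ _)).
  by rewrite addnC size_mul_leq_add ?sp // -(size_wpoly2 y qr).
have [h hE] : exists h, p r - g = h * wpoly r y.
  have wE : wpoly r y = \prod_(z <- [seq y s | s <- enum 'I_n & s != r]) ('X - z%:P).
    by rewrite big_map big_filter big_enum_cond.
  rewrite wE; apply: uniq_roots_prod_XsubC; last first.
    by rewrite uniq_rootsE map_inj_uniq // filter_uniq // enum_uniq.
  apply/allP => z /mapP[q]; rewrite mem_filter => /andP[qr _] ->.
  rewrite /root hornerD hornerN pE // horner_sum (bigD1 q) //= big1 ?addr0; last first.
    by move=> s /andP[sr sq]; rewrite !hornerM (wpoly2_root y qr sq) !mulr0.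
  rewrite !hornerM hornerC; have := wpoly2_neq0 iy qr => D0.
  by rewrite mulrCA mulVf // mulr1 subrr.
have mw : wpoly r y \is monic by apply: monic_prod_XsubC.
have sh : (size h <= e.+1)%N.
  have [->|h0] := eqVneq h 0; first by rewrite size_poly0.
  have := size_Mmonic h0 mw; rewrite -hE size_wpoly => sE.
  have : (size (p r - g)%R <= (n.-1 + e).+1)%N.
    by apply: (leq_trans (size_polyD _ _)); rewrite size_polyN geq_max spr leqW.
  by rewrite sE; lia.
exists h; split => //.
- have := congr1 (fun q : {poly R} => q`_(n.-1 + e)) hE.
  rewrite mulrC coefM_top ?size_wpoly ?coef_wpoly ?mul1r //; last by lia.
  by rewrite coefB [g`__]nth_default ?subr0.
- move=> z zy; have w0 : (wpoly r y).[z] != 0.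
    rewrite horner_prod; apply/prodf_neq0 => s sr.
    by rewrite hornerXsubC subr_eq0 zy.
  apply: (mulfI w0); rewrite (bigD1 r) //= mulrDr lagrange_sum // -/g gdelta_upd.
  rewrite [X in X - _]mulrC divfK // -hornerN -hornerD hE hornerM; exact: mulrC.
Qed.

End Lagrange.

(** * The differential equation in one variable *)

Lemma is_derive_ext (R : realType) (f g : R -> R) (x a b : R) :
  is_derive x 1 f a -> f =1 g -> a = b -> is_derive x 1 g b.
Proof. by move=> df /funext <- <-. Qed.

Lemma open_interval_near (R : realType) (I : set R) x : open_interval I -> I x ->
  \forall y \near x, I y.
Proof. by case=> oI _ _ Ix; apply: open_nbhs_nbhs. Qed.

Lemma is_derive_eq_on (R : realType) (I : set R) (f g : R -> R) x v :
  open_interval I -> I x -> (forall y, I y -> f y = g y) ->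
  is_derive x 1 f v -> is_derive x 1 g v.
Proof.
move=> oI Ix fg; apply: near_eq_is_derive.
by near=> y; apply: fg; near: y; apply: open_interval_near.
Unshelve. all: by end_near. Qed.

Lemma is_derive_div (R : realType) (f g : R -> R) (x f' g' : R) : g x != 0 ->
  is_derive x 1 f f' -> is_derive x 1 g g' ->
  is_derive x 1 (fun y => f y / g y) ((f' * g x - f x * g') / g x ^+ 2).
Proof.
move=> g0 df dg; have dV : is_derive x 1 (fun y => (g y)^-1) (- (g x) ^- 2 *: g').
  by case: dg => dg <-; apply: DeriveDef; [exact: derivableV|exact: deriveV].
have := @is_deriveM _ _ f (fun y => (g y)^-1) x 1 _ _ df dV.
move/is_derive_ext; apply => //; rewrite /GRing.scale /=; by field.
Qed.

Lemma derive0_cst (R : realType) (I : set R) (f : R -> R) : open_interval I ->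
  (forall x, I x -> is_derive x 1 f 0) -> forall x y, I x -> I y -> f x = f y.
Proof.
case=> oI iI _ df; suff H x y : I x -> I y -> x <= y -> f x = f y.
  by move=> x y Ix Iy; have [/H->//|/ltW /H->] := leP x y.
move=> Ix Iy xy; have sub z : z \in `[x, y]%R -> I z.
  by rewrite in_itv /= => zxy; apply: (iI x y).
have [z|z|c cxy] := @MVT_segment _ f (fun=> 0) x y xy.
- by rewrite in_itv /= => /andP[/ltW xz /ltW zy]; apply/df/sub; rewrite in_itv /= xz zy.
- apply: derivable_within_continuous => u /sub Iu.
  by have [] := df u Iu.
- by rewrite mul0r => /eqP; rewrite subr_eq0 => /eqP.
Qed.

Lemma derive2_0_affine (R : realType) (I : set R) (f f1 : R -> R) : open_interval I ->
  (forall x, I x -> is_derive x 1 f (f1 x)) -> (forall x, I x -> is_derive x 1 f1 0) ->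
  exists a b, forall x, I x -> f x = a + b * x.
Proof.
move=> oI df df1; have [_ _ [x0 Ix0]] := oI.
have f1E x : I x -> f1 x = f1 x0 by move=> Ix; apply: (derive0_cst oI).
exists (f x0 - f1 x0 * x0), (f1 x0) => x Ix.
pose g y := f y - (f1 x0 *: 'X : {poly R}).[y].
have dg y : I y -> is_derive y 1 g 0.
  move=> Iy; have := @is_deriveB _ _ _ f (horner (f1 x0 *: 'X)) y 1 _ _ (df y Iy) (is_derive_poly _ _).
  by move/is_derive_ext; apply => //; rewrite derivZ derivX !hornerE f1E // subrr.
have := derive0_cst oI dg Ix Ix0; rewrite /g !hornerE => E.
by apply: (addIr (- (f1 x0 * x))); rewrite E; ring.
Qed.

Definition derivs2_on (R : realType) (I : set R) (A A1 A2 : R -> R) :=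
  forall y, I y -> is_derive y 1 A (A1 y) /\ is_derive y 1 A1 (A2 y).

Lemma derivs2_on_poly (R : realType) (I : set R) (a : {poly R}) :
  derivs2_on I (horner a) (horner (deriv a)) (horner (deriv (deriv a))).
Proof. by move=> y _; split; apply: is_derive_poly. Qed.

Lemma derivs2_on_sub (R : realType) (I : set R) (A A1 A2 B B1 B2 : R -> R) :
  derivs2_on I A A1 A2 -> derivs2_on I B B1 B2 ->
  derivs2_on I (fun y => A y - B y) (fun y => A1 y - B1 y) (fun y => A2 y - B2 y).
Proof.
move=> dA dB y Iy; have [a1 a2] := dA y Iy; have [b1 b2] := dB y Iy.
by split; apply: is_deriveB.
Qed.

Lemma smooth_derivs2 (R : realType) (I : set R) (f : R -> R) : smooth_on I f ->
  derivs2_on I f (derive1 f) (derive1n 2 f).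
Proof.
move=> sf y Iy; split; apply: DeriveDef.
- exact: (sf 0%N).
- by rewrite derive1E.
- exact: (sf 1%N).
- by rewrite -derive1E.
Qed.

Lemma antiderivative2_derivs2 (R : realType) (I : set R) (F G : R -> R) :
  antiderivative2 I F G <-> derivs2_on I G (derive1 G) F.
Proof.
split=> H y Iy; last first.
  have [d1 d2] := H y Iy; split; [by case: d1|by case: d2|].
  by rewrite /derive1n /= derive1E; case: d2.
have [d1 d2 d3] := H y Iy; split; apply: DeriveDef.
- exact: d1.
- by rewrite derive1E.
- exact: d2.
- by rewrite -derive1E; exact: d3.
Qed.

Lemma derivs2_on_eq (R : realType) (I : set R) (A A1 A2 B : R -> R) : open_interval I ->
  (forall y, I y -> A y = B y) -> derivs2_on I A A1 A2 -> derivs2_on I B (derive1 B) A2.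
Proof.
move=> oI AB dA.
have dB y : I y -> is_derive y 1 B (A1 y).
  by move=> Iy; apply: (is_derive_eq_on oI Iy AB); case: (dA y Iy).
have BE y : I y -> A1 y = derive1 B y by move=> /dB[_ <-]; rewrite derive1E.
move=> y Iy; split; first by rewrite -BE //; apply: dB.
by apply: (is_derive_eq_on oI Iy BE); case: (dA y Iy).
Qed.

Lemma partial_partial (R : realType) (J : finType) (I : set R) (F : (J -> R) -> R) s x
    (f f1 f2 : R -> R) : open_interval I -> I (x s) ->
  (forall y, I y -> F (upd x s y) = f y) -> derivs2_on I f f1 f2 ->
  partial s (partial s F) x = f2 (x s).
Proof.
move=> oI Ix Ff df.
have E y : I y -> f1 y = partial s F (upd x s y).
  move=> Iy; rewrite /partial derive1E updE.
  have [d1 _] := df y Iy; have := is_derive_eq_on oI Iy (g := fun z => F (upd (upd x s y) s z)) _ d1.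
  by case=> [z Iz|_ ->//]; rewrite upd_upd Ff.
rewrite {1}/partial derive1E; have [_ d2] := df _ Ix.
by have [_ ->] := is_derive_eq_on oI Ix E d2.
Qed.

(* [L^{c+2} d^2 (A / L^c)] for [L] affine with derivative [N], in terms of the
   values [a0], [a1], [a2] of [A], [A'], [A'']. *)
Definition bop (R : realType) (c : nat) (a0 a1 a2 L N : R) : R :=
  a2 * L ^+ 2 - 2 * c%:R * a1 * L * N + c%:R * (c%:R + 1) * a0 * N ^+ 2.

Lemma derivs2_on_div (R : realType) (I : set R) (c : nat) (A A1 A2 : R -> R) (M N : R) :
  (forall y, I y -> M + N * y != 0) -> derivs2_on I A A1 A2 ->
  derivs2_on I (fun y => A y / (M + N * y) ^+ c)
    (fun y => (A1 y * (M + N * y) - c%:R * N * A y) / (M + N * y) ^+ c.+1)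
    (fun y => bop c (A y) (A1 y) (A2 y) (M + N * y) N / (M + N * y) ^+ c.+2).
Proof.
move=> L0 dA y Iy; have [d1 d2] := dA y Iy.
have dL k : is_derive y 1 (fun y => (M + N * y) ^+ k) (k%:R * (M + N * y) ^+ k.-1 * N).
  have -> : (fun y => (M + N * y) ^+ k) = horner ((M%:P + N *: 'X) ^+ k).
    by apply/funext => z; rewrite !hornerE.
  apply: is_derive_ext (is_derive_poly _ y) _ _ => //.
  rewrite deriv_exp derivD derivC derivZ derivX add0r hornerMn hornerM -mulr_natl /=.
  by rewrite horner_exp !hornerE /=; ring.
have l0 := L0 y Iy.
have lX k : (M + N * y) ^+ k != 0 by rewrite expf_neq0.
split.
  have /is_derive_ext := @is_derive_div _ _ (fun y => (M + N * y) ^+ c) y _ _ (lX c) d1 (dL c).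
  apply => //.
  by case: c lX => [|c] lX; rewrite /= ?exprS; field; rewrite ?lX ?l0.
have d3 : is_derive y 1 (fun y => A1 y * (M + N * y) - c%:R * N * A y)
   (A2 y * (M + N * y) + A1 y * N - c%:R * N * A1 y).
  have e1 := is_deriveM d2 (dL 1%N); have e2 := is_deriveZ (c%:R * N) d1.
  apply: is_derive_ext (is_deriveB e1 e2) _ _ => //.
  by rewrite /GRing.scale /= /GRing.scale /=; ring.
have /is_derive_ext :=
  @is_derive_div _ _ (fun y => (M + N * y) ^+ c.+1) y _ _ (lX c.+1) d3 (dL c.+1).
apply => //.
rewrite /bop !exprS -natr1; field; by rewrite ?lX ?l0.
Qed.

Definition bpoly (R : realType) (c : nat) (a : {poly R}) (M N : R) : {poly R} :=
  deriv (deriv a) * (M%:P + N *: 'X) ^+ 2 -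
  (2 * c%:R * N) *: (deriv a * (M%:P + N *: 'X)) + (c%:R * (c%:R + 1) * N ^+ 2) *: a.

Lemma horner_bpoly (R : realType) (c : nat) (a : {poly R}) (M N y : R) :
  (bpoly c a M N).[y] =
  bop c a.[y] (deriv a).[y] (deriv (deriv a)).[y] (M + N * y) N.
Proof. by rewrite /bpoly /bop !(hornerE, horner_exp) /=; ring. Qed.

Lemma coef_deriv1 (R : realType) (a : {poly R}) i : (deriv a)`_i = (i%:R + 1) * a`_i.+1.
Proof. by rewrite coef_deriv natr1 mulr_natl. Qed.

Lemma coef_deriv2 (R : realType) (a : {poly R}) i :
  (deriv (deriv a))`_i = (i%:R + 1) * (i%:R + 2) * a`_i.+2.
Proof. by rewrite !coef_deriv1 -!natr1; ring. Qed.

Lemma coef_deriv2X (R : realType) (a : {poly R}) j :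
  (deriv (deriv a) * 'X)`_j = j%:R * (j%:R + 1) * a`_j.+1.
Proof.
rewrite coefMX; case: j => [|j]; first by rewrite !mul0r.
by rewrite coef_deriv2 -natr1; ring.
Qed.

Lemma coef_derivX (R : realType) (a : {poly R}) j : (deriv a * 'X)`_j = j%:R * a`_j.
Proof. by rewrite coefMX; case: j => [|j]; [rewrite mul0r|rewrite coef_deriv1 natr1]. Qed.

Lemma coef_deriv2X2 (R : realType) (a : {poly R}) j :
  (deriv (deriv a) * 'X^2)`_j = j%:R * (j%:R - 1) * a`_j.
Proof.
rewrite coefMXn; case: j => [|[|j]].
- by rewrite !mul0r.
- by rewrite subrr mulr0 mul0r.
by rewrite subn2 [LHS]coef_deriv2 -!natr1; ring.
Qed.

(** On monomials the operator is triangular with three diagonals. The entry on the main diagonal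
    vanishes at [j = c] and [j = c + 1] because the kernel is spanned by [(M + N z)^c] and
    [z (M + N z)^c]. *)
Lemma coef_bpoly (R : realType) (c : nat) (a : {poly R}) (M N : R) j :
  (bpoly c a M N)`_j = N ^+ 2 * (j%:R - c%:R) * (j%:R - c%:R - 1) * a`_j
    + 2 * N * M * (j%:R + 1) * (j%:R - c%:R) * a`_j.+1
    + (j%:R + 2) * (j%:R + 1) * M ^+ 2 * a`_j.+2.
Proof.
have -> : bpoly c a M N = N ^+ 2 *: (deriv (deriv a) * 'X^2) +
    (2 * M * N) *: (deriv (deriv a) * 'X) + M ^+ 2 *: deriv (deriv a)
    - (2 * c%:R * N * N) *: (deriv a * 'X) - (2 * c%:R * N * M) *: deriv a
    + (c%:R * (c%:R + 1) * N ^+ 2) *: a.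
  by apply: poly_all_eq => y; rewrite /bpoly !(hornerE, horner_exp) /=; ring.
rewrite !(coefD, coefB, coefN, coefZ) coef_deriv2X coef_deriv2X2 coef_derivX.
rewrite coef_deriv2 coef_deriv1; ring.
Qed.

Lemma poly_primitive (R : realType) (p : {poly R}) : exists q, deriv q = p.
Proof.
exists (\poly_(i < (size p).+1) (p`_i.-1 / i%:R)); apply/polyP => i.
rewrite coef_deriv coef_poly /= ltnS; case: ltnP => [_|pi].
  by rewrite -[LHS]mulr_natr divfK // pnatr_eq0.
by rewrite mul0rn nth_default.
Qed.

(** Below degree [c] the main diagonal has no zero, so the top coefficient of [p] can be removed and
    the degree lowered. *)
Lemma bpoly_surj (R : realType) (c : nat) (p : {poly R}) (M N : R) n :
  N != 0 -> (size p <= n)%N -> (n <= c)%N -> exists a, bpoly c a M N = p.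
Proof.
move=> N0; elim: n p => [|n IH] p.
  rewrite leqn0 size_poly_eq0 => /eqP -> _; exists 0.
  by apply: poly_all_eq => y; rewrite horner_bpoly /bop !deriv0 !horner0; ring.
move=> sp nc; have c0 : N ^+ 2 * (n%:R - c%:R) * (n%:R - c%:R - 1) != 0.
  rewrite !mulf_neq0 ?expf_neq0 //; last first.
    by rewrite subr_eq0 subr_eq addrC natr1 eqr_nat; lia.
  by rewrite subr_eq0 eqr_nat; lia.
set k := p`_n / (N ^+ 2 * (n%:R - c%:R) * (n%:R - c%:R - 1)).
have [||a aE] := IH (p - bpoly c (k *: 'X^n) M N); last first.
- exists (a + k *: 'X^n); apply: poly_all_eq => y.
  have -> : p.[y] = (p - bpoly c (k *: 'X^n) M N).[y] + (bpoly c (k *: 'X^n) M N).[y].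
    by rewrite hornerD hornerN subrK.
  by rewrite -aE !horner_bpoly !derivD !hornerD /bop; ring.
- exact: ltnW.
apply/leq_sizeP => j nj; rewrite coefB coef_bpoly !coefZ !coefXn.
have -> : (j.+1 == n) = false by lia.
have -> : (j.+2 == n) = false by lia.
have [->|jn] := eqVneq j n; first by rewrite !mulr0 !addr0 mulr1 [X in _ - X]mulrC /k divfK ?subrr.
rewrite !mulr0 !addr0 subr0 nth_default //; apply: (leq_trans sp); lia.
Qed.

(* The solution of the homogeneous equation is [(a + b y) (M + N y)^c]. *)
Lemma euler_ode_poly (R : realType) (c : nat) (I : set R) (A A1 A2 : R -> R) (M N : R)
    (rho : {poly R}) : open_interval I -> derivs2_on I A A1 A2 ->
  (forall y, I y -> M + N * y != 0) ->
  (N != 0 -> (size rho <= c)%N) ->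
  (forall y, I y -> bop c (A y) (A1 y) (A2 y) (M + N * y) N = rho.[y]) ->
  exists a : {poly R}, forall y, I y -> A y = a.[y].
Proof.
move=> oI dA L0 sr H; have [T TE] : exists T, bpoly c T M N = rho.
  (* For [N = 0] the operator is [M^2 A''] and two primitives suffice. Otherwise the bound on [rho]
     keeps its degree below the zeros [c], [c + 1] of the diagonal, where logarithms could
     appear. *)
  have [N0|N0] := eqVneq N 0; last exact: bpoly_surj N0 (sr N0) (leqnn c).
  have [q qE] := poly_primitive (M ^- 2 *: rho); have [T TE] := poly_primitive q.
  have M0 : M != 0 by have [_ _ [y Iy]] := oI; have := L0 y Iy; rewrite N0 mul0r addr0.
  exists T; apply: poly_all_eq => y.
  by rewrite horner_bpoly TE qE N0 /bop hornerZ; field.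
have dV := derivs2_on_div c L0 (derivs2_on_sub dA (@derivs2_on_poly R I T)).
have [|a [b ab]] := derive2_0_affine oI (fun y Iy => (dV y Iy).1).
  move=> y Iy; have [_] := dV y Iy; move/is_derive_ext; apply => //.
  set l := M + N * y; have -> : forall a0 a1 a2 b0 b1 b2, bop c (a0 - b0) (a1 - b1) (a2 - b2) l N =
      bop c a0 a1 a2 l N - bop c b0 b1 b2 l N by move=> *; rewrite /bop; ring.
  by rewrite H // -horner_bpoly TE subrr mul0r.
exists (T + (a%:P + b *: 'X) * (M%:P + N *: 'X) ^+ c) => y Iy.
have l0 : (M + N * y) ^+ c != 0 by rewrite expf_neq0 ?L0.
have := ab y Iy; rewrite hornerD hornerM horner_exp !hornerE => <-.
by rewrite divfK // addrC subrK.
Qed.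

(** * Symmetric polynomials and the slots of a group *)

Lemma size_linear (R : realType) (M N : R) : (size (M%:P + N *: 'X)%R <= 2)%N.
Proof.
by apply/leq_sizeP => -[|[|j]] // _; rewrite coefD coefC coefZ coefX /= mulr0 addr0.
Qed.

Lemma size_leq2E (R : realType) (p : {poly R}) : (size p <= 2)%N -> p = (p`_0)%:P + p`_1 *: 'X.
Proof.
move=> sp; apply/polyP => -[|[|j]]; rewrite coefD coefC coefZ coefX /= ?mulr0 ?mulr1 ?addr0 ?add0r //.
by rewrite nth_default // (leq_trans sp).
Qed.

Lemma coef_geq (R : realType) (p : {poly R}) k i :
  (size p <= k)%N -> (k <= i)%N -> p`_i = 0.
Proof. by move=> sp ki; rewrite nth_default // (leq_trans sp). Qed.

Lemma sizeZ_leq (R : realType) (p : {poly R}) c k :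
  (size p <= k)%N -> (size (c *: p)%R <= k)%N.
Proof. exact/leq_trans/size_scale_leq. Qed.

Lemma sizeD_leq (R : realType) (p q : {poly R}) k :
  (size p <= k)%N -> (size q <= k)%N -> (size (p + q)%R <= k)%N.
Proof. by move=> pk qk; rewrite (leq_trans (size_polyD _ _)) // geq_max pk. Qed.

Lemma sizeB_leq (R : realType) (p q : {poly R}) k :
  (size p <= k)%N -> (size q <= k)%N -> (size (p - q)%R <= k)%N.
Proof. by move=> pk qk; apply: sizeD_leq; rewrite ?size_polyN. Qed.

Section GroupSum.
Variables (R : realType) (n : nat).
Implicit Types (y : 'I_n -> R) (q r : 'I_n) (p : {perm 'I_n}) (B : tensor R 'I_n)
  (b : 'I_n -> ('I_n -> R) -> R).

Definition gsum b y : R := \sum_q b q y / gdelta q y.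

Definition equivariant b := forall p q y, b q (y \o p) = b (p q) y.

Lemma upd_perm p q y z : upd (y \o p) q z = upd y (p q) z \o p.
Proof.
by apply/funext => s; rewrite /upd /= (inj_eq (@perm_inj _ p)); case: (s == q).
Qed.

Lemma slope_perm B p q y : symmetric_tensor B ->
  slope q (tev B) (y \o p) = slope (p q) (tev B) y.
Proof. by move=> /symmetric_tensorP sB; rewrite /slope !upd_perm !sB. Qed.

Lemma tperm_eq_id q r y : y q = y r -> y \o tperm q r = y.
Proof. by move=> yqr; apply/funext => s /=; case: tpermP => // ->. Qed.

(** The transposition of [q] and [r] fixes the points with [y q = y r]. Equivariant numerators thus
    agree where their poles meet, which makes the residues of [gsum] cancel. *)
Lemma equivariant_eq b q r y : equivariant b -> y q = y r -> b q y = b r y.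
Proof. by move=> eb yqr; rewrite -[in LHS](tperm_eq_id yqr) eb tpermL. Qed.

Lemma gdelta_perm p q y : gdelta q (y \o p) = gdelta (p q) y.
Proof.
rewrite /gdelta [RHS](reindex_inj (@perm_inj _ p)) /=.
by apply: eq_bigl => s; rewrite (inj_eq (@perm_inj _ p)).
Qed.

Lemma gsum_perm b p y : equivariant b -> gsum b (y \o p) = gsum b y.
Proof.
move=> eb; rewrite /gsum [RHS](reindex_inj (@perm_inj _ p)) /=.
by apply: eq_bigr => q _; rewrite eb gdelta_perm.
Qed.

(* The numerators [b] for which the sum is a polynomial of degree at most [e]
   in every variable [y_r], with leading coefficient [lead r y]. *)
Definition numerators (e : nat) b (lead : 'I_n -> ('I_n -> R) -> R) :=
  equivariant b /\ forall y r, exists p : 'I_n -> {poly R},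
    [/\ forall q z, b q (upd y r z) = (p q).[z],
        (size (p r) <= (n.-1 + e).+1)%N,
        (forall q, q != r -> (size (p q) <= e.+1)%N) &
        (p r)`_(n.-1 + e) = lead r y].

Lemma upd_injP y r z : injective y -> injective (upd y r z) <->
  (forall s, s != r -> z != y s).
Proof.
move=> iy; split=> [iz s sr|]; last exact: upd_inj.
apply/eqP => zs; have : upd y r z r = upd y r z s by rewrite updE updN.
by move/iz => rs; rewrite rs eqxx in sr.
Qed.

Lemma gsum_line e b lead y r : numerators e b lead -> injective y ->
  exists h : {poly R}, [/\ (size h <= e.+1)%N, h`_e = lead r y &
    forall z, injective (upd y r z) -> gsum b (upd y r z) = h.[z]].
Proof.
move=> [eb Hb] iy; have [p [pE spr sp pl]] := Hb y r.
have [|h [sh hl hE]] := lagrange_suf iy spr sp.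
  move=> q qr; rewrite -!pE; apply: equivariant_eq => //.
  by rewrite updE updN.
exists h; split => //; first by rewrite hl.
move=> z /(upd_injP _ _ iy) iz; rewrite -hE //.
by apply: eq_bigr => q _; rewrite pE.
Qed.

Lemma numerators_horner e (f : {poly R}) : (size f <= (n.-1 + e).+1)%N ->
  numerators e (fun q y => f.[y q]) (fun _ _ => f`_(n.-1 + e)).
Proof.
move=> sf; split=> // y r.
exists (fun q => if q == r then f else (f.[y q])%:P); split; rewrite ?eqxx //.
- move=> q z; have [->|qr] := eqVneq q r; first by rewrite updE.
  by rewrite updN // hornerC.
- by move=> q /negbTE ->; rewrite (leq_trans (size_polyC_leq1 _)).
Qed.

(** The sum is the divided difference of order [n - 1] of [f], hence the coefficient at [n - 1] when
    the degree is at most [n - 1]. *)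
Lemma gsum_horner_top (f : {poly R}) y : (0 < n)%N -> (size f <= n)%N -> injective y ->
  gsum (fun q y => f.[y q]) y = f`_n.-1.
Proof.
move=> n0 sf iy; have r : 'I_n := Ordinal n0.
have sf' : (size f <= (n.-1 + 0).+1)%N by lia.
have [h [sh hl hE]] := gsum_line r (numerators_horner sf') iy.
rewrite addn0 in hl; rewrite -(upd_id y r) hE ?upd_id //.
by rewrite (size1_polyC sh) hornerC.
Qed.

Lemma size_bpoly c (a : {poly R}) M N k : (size a <= k)%N -> (size (bpoly c a M N) <= k)%N.
Proof.
move=> sa; apply/leq_sizeP => j kj; rewrite coef_bpoly.
by rewrite !(coef_geq sa) ?mulr0 ?addr0 //; lia.
Qed.

Definition bop_num c B (a : {poly R}) q y : R :=
  bop c a.[y q] (deriv a).[y q] (deriv (deriv a)).[y q] (tev B y) (slope q (tev B) y).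

(** With [a0], [a1], [a2] frozen, [bop] is a quadratic form in [L] and its slope, both affine in
    [z]; so the coefficient at [z^2] is the same form at their coefficients. *)
Lemma bop_quadratic c (a0 a1 a2 M N M' N' : R) : exists p : {poly R},
  [/\ (size p <= 3)%N, p`_2 = bop c a0 a1 a2 N N' &
      forall z, bop c a0 a1 a2 (M + z * N) (M' + z * N') = p.[z]].
Proof.
set l := M%:P + N *: 'X; set l' := M'%:P + N' *: 'X.
exists (a2 *: (l * l) - (2 * c%:R * a1) *: (l * l') + (c%:R * (c%:R + 1) * a0) *: (l' * l')).
have s3 (u v u' v' : R) : (size ((u%:P + v *: 'X) * (u'%:P + v' *: 'X))%R <= 3)%N.
  by apply: (@size_mul_leqS _ _ _ 1 1); exact: size_linear.
split.
- by rewrite sizeD_leq ?sizeB_leq ?sizeZ_leq //; exact: s3.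
- have c1 (u v : R) : (u%:P + v *: 'X)`_1 = v by rewrite coefD coefC coefZ coefX /= add0r mulr1.
  by rewrite coefD coefB !coefZ !(@coefM_top _ _ _ 1 1) ?size_linear // !c1 /bop; ring.
- by move=> z; rewrite /bop /l /l' !hornerE /=; ring.
Qed.

(** In its own variable a numerator is a [bpoly], in any other variable it is quadratic. The factor
    in the leading coefficient is the main diagonal of [coef_bpoly] at [j = n + 1]. *)
Lemma numerators_bop c B (a : {poly R}) : symmetric_tensor B -> (size a <= n.+2)%N ->
  numerators 2 (bop_num c B a)
    (fun r y => (n%:R + 1 - c%:R) * (n%:R - c%:R) * a`_n.+1 * slope r (tev B) y ^+ 2).
Proof.
move=> sB sa; split=> [p q y|y r].
  by rewrite /bop_num slope_perm // ((symmetric_tensorP _).1 sB).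
have /choice[p hp] : forall q, exists p : {poly R}, (q != r -> (size p <= 3)%N) /\
    (q = r -> p = bpoly c a (tev B (upd y r 0)) (slope r (tev B) y)) /\
    forall z, bop_num c B a q (upd y r z) = p.[z].
  move=> q; have [->|qr] := eqVneq q r.
    exists (bpoly c a (tev B (upd y r 0)) (slope r (tev B) y)); split => //; split => // z.
    by rewrite /bop_num horner_bpoly updE slope_upd (@multiaffine_tev _ _ B) mulrC [in X in _ + X]mulrC.
  have [p [sp _ pE]] := bop_quadratic c a.[y q] (deriv a).[y q] (deriv (deriv a)).[y q]
    (tev B (upd y r 0)) (slope r (tev B) y)
    (slope q (tev B) (upd y r 0)) (slope r (slope q (tev B)) y).
  exists p; split => //; split => [qr'|z]; first by rewrite qr' eqxx in qr.
  rewrite -pE /bop_num updN // (@multiaffine_tev _ _ B).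
  by rewrite (multiaffine_slope q (@multiaffine_tev _ _ B)).
have n1 : (n.-1 + 2 = n.+1)%N by have := ltn_ord r; lia.
exists p; split=> [q z|||]; first by have [_ [_ ->]] := hp q.
- have [_ [-> // _]] := hp r; rewrite n1; exact: size_bpoly.
- by move=> q qr; have [sp _] := hp q; apply: sp.
have [_ [-> // _]] := hp r; rewrite n1 coef_bpoly.
by rewrite [a`__.+2](coef_geq sa) // [a`__.+3](coef_geq sa) // -natr1; ring.
Qed.

(** Half of the coefficient of [Q] when [tev B y] is replaced by [tev B y + Q] in [bop_num]; [Q]
    will be the part of <mu, beta> that belongs to the other groups. *)
Definition cross_num c B (a : {poly R}) q y : R :=
  (deriv (deriv a)).[y q] * tev B y - c%:R * (deriv a).[y q] * slope q (tev B) y.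

Lemma numerators_cross c B (a : {poly R}) : symmetric_tensor B -> (size a <= n.+2)%N ->
  numerators 1 (cross_num c B a)
    (fun r y => (n%:R + 1) * (n%:R - c%:R) * a`_n.+1 * slope r (tev B) y).
Proof.
move=> sB sa; split=> [p q y|y r].
  by rewrite /cross_num slope_perm // ((symmetric_tensorP _).1 sB).
have n0 := ltn_ord r; have n1 : (n.-1 + 1 = n)%N by lia.
pose pr := deriv (deriv a) * ((tev B (upd y r 0))%:P + (slope r (tev B) y) *: 'X)
  - (c%:R * slope r (tev B) y) *: deriv a.
pose pq q := (deriv (deriv a)).[y q] *: ((tev B (upd y r 0))%:P + (slope r (tev B) y) *: 'X)
  - (c%:R * (deriv a).[y q]) *: ((slope q (tev B) (upd y r 0))%:P + (slope r (slope q (tev B)) y) *: 'X).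
have prE j : pr`_j = (j%:R + 2) * (j%:R + 1) * a`_j.+2 * tev B (upd y r 0)
    + (j%:R + 1) * (j%:R - c%:R) * a`_j.+1 * slope r (tev B) y.
  rewrite /pr mulrDr coefB coefD coefMC -scalerAr !coefZ coef_deriv2X coef_deriv2 coef_deriv1.
  by ring.
exists (fun q => if q == r then pr else pq q); split; rewrite ?eqxx ?n1.
- move=> q z; rewrite /cross_num; have [->|qr] := eqVneq q r.
    by rewrite updE slope_upd (@multiaffine_tev _ _ B) !hornerE; ring.
  rewrite updN // (@multiaffine_tev _ _ B) (multiaffine_slope q (@multiaffine_tev _ _ B)) !hornerE; ring.
- apply/leq_sizeP => j nj; rewrite prE !(coef_geq sa) ?mulr0 ?mul0r ?addr0 //; lia.
- move=> q /negbTE ->; by rewrite sizeB_leq ?sizeZ_leq ?size_linear.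
- by rewrite prE [a`__.+2]nth_default // mulr0 mul0r add0r; ring.
Qed.

(** When <mu, beta> is the product of [t] and all [u + v y_s], it shares with its slope along [q]
    the product of [t] and the factors with [s != q]. By homogeneity [bop] is the square of this
    times a function of [y q] alone, here [f]. *)
Definition prod_num (t u v : R) (f : {poly R}) q y : R :=
  f.[y q] * (t * \prod_(s | s != q) (u + v * y s)) ^+ 2.

Lemma numerators_prod t u v (f : {poly R}) : (size f <= n.+2)%N ->
  numerators 2 (prod_num t u v f)
    (fun r y => f`_n.+1 * (t * \prod_(s | s != r) (u + v * y s)) ^+ 2).
Proof.
move=> sf; split=> [p q y|y r].
  rewrite /prod_num /=; congr (_ * (_ * _) ^+ 2).
  by rewrite [RHS](reindex_inj (@perm_inj _ p)) /=; apply: eq_bigl => s; rewrite (inj_eq (@perm_inj _ p)).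
have n0 := ltn_ord r; have n1 : (n.-1 + 2 = n.+1)%N by lia.
pose k q := \prod_(s | (s != q) && (s != r)) (u + v * y s).
pose l := u%:P + v *: 'X : {poly R}.
exists (fun q => if q == r then (t * \prod_(s | s != r) (u + v * y s)) ^+ 2 *: f
  else (f.[y q] * (t * k q) ^+ 2) *: (l * l)); split; rewrite ?eqxx ?n1.
- move=> q z; rewrite /prod_num; have [->|qr] := eqVneq q r.
    rewrite updE hornerZ mulrC; congr (_ ^+ 2 * _); congr (_ * _).
    by apply: eq_bigr => s sr; rewrite updN.
  rewrite updN // hornerZ hornerM (bigD1 r) 1?eq_sym //= updE.
  rewrite [X in _ * (_ * (_ * X)) ^+ 2](_ : _ = k q); last first.
    by apply: eq_bigr => s /andP[_ sr]; rewrite updN.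
  by rewrite /l !hornerE /=; ring.
- exact: (leq_trans (size_scale_leq _ _)).
- move=> q /negbTE ->; apply: (leq_trans (size_scale_leq _ _)).
  by apply: (@size_mul_leqS _ _ _ 1 1); exact: size_linear.
- by rewrite coefZ mulrC.
Qed.

Variable I : 'I_n -> set R.
Hypothesis oI : forall s, open_interval (I s).
Hypothesis injI : forall y, box I y -> injective y.

Lemma gsum_symmetric1 b lead : numerators 1 b lead ->
  exists2 B, symmetric_tensor B & forall y, box I y -> gsum b y = tev B y.
Proof.
move=> nb; apply: symmetric_multiaffine => // [p y _|y r iy].
  by apply: gsum_perm; case: nb.
have [h [sh _ hE]] := gsum_line r nb iy; exists h`_0, h`_1 => z iz.
by rewrite hE // {1}(size_leq2E sh) !hornerE.
Qed.

(** By the form of [lead], subtracting [tau] times the square of [tev B y] removes the quadratic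
    term in every variable; the rest is symmetric and affine in each variable. *)
Lemma gsum_symmetric2 b lead B tau : symmetric_tensor B -> numerators 2 b lead ->
  (forall r y, lead r y = tau * slope r (tev B) y ^+ 2) ->
  exists2 B', symmetric_tensor B' &
    forall y, box I y -> gsum b y = tau * tev B y ^+ 2 + tev B' y.
Proof.
move=> sB nb lE.
have [p y _|y r iy|B' sB' hB'] := symmetric_multiaffine oI injI (f := fun y => gsum b y - tau * tev B y ^+ 2).
- by rewrite gsum_perm ?((symmetric_tensorP _).1 sB) //; case: nb.
- have [h [sh hl hE]] := gsum_line r nb iy.
  set M := tev B (upd y r 0); set N := slope r (tev B) y.
  pose g := h - tau *: (M%:P + N *: 'X) ^+ 2.
  have sg : (size g <= 2)%N.
    have s3 : (size ((M%:P + N *: 'X) ^+ 2)%R <= 3)%N.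
      by rewrite expr2; apply: (@size_mul_leqS _ _ _ 1 1); exact: size_linear.
    apply/leq_sizeP => j; rewrite leq_eqVlt => /predU1P[<-|j2]; last first.
      by rewrite coefB coefZ !nth_default ?mulr0 ?subr0 //; apply: leq_trans j2.
    rewrite coefB coefZ hl lE expr2 (@coefM_top _ _ _ 1 1) ?size_linear //.
    by rewrite !coefD !coefC !coefZ !coefX /= mulr1 add0r -expr2 subrr.
  exists g`_0, g`_1 => z iz; have : g.[z] = g`_0 + g`_1 * z by rewrite {1}(size_leq2E sg) !hornerE.
  move <-; rewrite hE // (@multiaffine_tev _ _ B) -/M -/N hornerD hornerN hornerZ horner_exp.
  by rewrite !hornerE /=; ring.
- by exists B' => // y Iy; rewrite -hB' // addrC subrK.
Qed.

(** The form of [lead] makes every slope of the difference between [gsum b] and [tau] times [tev B]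
    vanish. *)
Lemma gsum_cst1 b lead B tau : symmetric_tensor B -> numerators 1 b lead ->
  (forall r y, lead r y = tau * slope r (tev B) y) ->
  exists k, forall y, box I y -> gsum b y = tau * tev B y + k.
Proof.
move=> sB nb lE; have [y0 Iy0] := box_nonempty oI.
exists (gsum b y0 - tau * tev B y0) => y Iy; apply/eqP; rewrite addrC -subr_eq; apply/eqP.
apply: (@box_cst _ _ I (fun y => gsum b y - tau * tev B y)) => // {Iy}y r z Iy Iz.
have iy := injI Iy; have [h [sh hl hE]] := gsum_line r nb iy.
rewrite hE; last by apply: injI; exact: box_upd.
have -> : gsum b y = h.[y r] by rewrite -[in LHS](upd_id y r) hE ?upd_id.
rewrite (multiaffine_line y r z (@multiaffine_tev _ _ B)) (size_leq2E sh) hl lE !hornerE; ring.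
Qed.

End GroupSum.

(** * Groups of slots, and elements of h as sums of functions of one group *)

Section Groups.
Variables (R : realType) (k : nat) (d : 'I_k -> nat).
Implicit Types (x : slot d -> R) (T : tensor R (slot d)).

Definition grp (i : 'I_k) x : 'I_(d i) -> R := fun r => x (sl r).
Arguments grp : clear implicits.
Arguments grp i x r : rename.
Definition gbox (I : slot d -> set R) (i : 'I_k) : 'I_(d i) -> set R := fun r => I (sl r).

Lemma sl_eq (i : 'I_k) (q r : 'I_(d i)) : (sl q == sl r) = (q == r).
Proof. exact: eq_Tagged. Qed.

Lemma slot_ind (P : slot d -> Prop) : (forall i (r : 'I_(d i)), P (sl r)) -> forall s, P s.
Proof. by move=> H [i r]; apply: H. Qed.

Lemma grp_upd (i : 'I_k) (r : 'I_(d i)) x z : grp i (upd x (sl r) z) = upd (grp i x) r z.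
Proof. by apply/funext => q; rewrite /grp /upd sl_eq. Qed.

Lemma grp_updN (i j : 'I_k) (r : 'I_(d i)) x z : j != i -> grp j (upd x (sl r) z) = grp j x.
Proof.
move=> ji; apply/funext => q; rewrite /grp updN //.
by apply: contra ji => /eqP/(congr1 tag) /= ->.
Qed.

Definition emb (i : 'I_k) (y : 'I_(d i) -> R) : slot d -> R := untag 0 y.

Lemma grp_emb (i : 'I_k) (y : 'I_(d i) -> R) : grp i (emb y) = y.
Proof.
by apply/funext => r; rewrite /grp /emb (untagE 0 y (erefl : tag (sl r) = i)).
Qed.

Definition mix (i : 'I_k) x x' : slot d -> R := fun s => if tag s == i then x' s else x s.

Lemma grp_mix (i : 'I_k) x x' : grp i (mix i x x') = grp i x'.
Proof. by apply/funext => r; rewrite /grp /mix /= eqxx. Qed.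

Lemma grp_mixN (i j : 'I_k) x x' : j != i -> grp j (mix i x x') = grp j x.
Proof. by move=> /negbTE ji; apply/funext => r; rewrite /grp /mix /= ji. Qed.

Lemma box_mix I (i : 'I_k) x x' : box I x -> box I x' -> box I (mix i x x').
Proof. by move=> Ix Ix' s; rewrite /mix; case: ifP. Qed.

Lemma gbox_grp I (i : 'I_k) x : box I x -> box (@gbox I i) (grp i x).
Proof. by move=> Ix r; apply: Ix. Qed.

Lemma gbox_lift I (i : 'I_k) x (y : 'I_(d i) -> R) : box I x -> box (@gbox I i) y ->
  exists x', [/\ box I x', grp i x' = y & forall j, j != i -> grp j x' = grp j x].
Proof.
move=> Ix Iy; exists (mix i x (emb y)); split; last by move=> j; apply: grp_mixN.
  move=> s; rewrite /mix; case: eqP => [|_]; last exact: Ix.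
  case: s => j r /= ji; subst j; have := grp_emb y; move/(congr1 (fun f => f r)).
  by rewrite /grp /= => ->; apply: Iy.
by rewrite grp_mix grp_emb.
Qed.

(** The function form of an element of h. The constant term may be distributed over the groups at
    will, so [B] need not be unique. *)
Definition gfun (B : forall i : 'I_k, tensor R 'I_(d i)) x : R :=
  \sum_(i < k) tev (B i) (grp i x).

Lemma mu_pair_ins10_tev (i : 'I_k) (B : tensor R 'I_(d i)) x :
  mu_pair (ins10 B) x = tev B (grp i x).
Proof. by rewrite mu_pair_ins10 tevE. Qed.

Lemma mu_pair_sum (B : forall i : 'I_k, tensor R 'I_(d i)) x :
  mu_pair (\sum_(i < k) ins10 (B i)) x = gfun B x.
Proof.
by rewrite [LHS](tev_sum _ _ _ x); apply: eq_bigr => i _; apply: mu_pair_ins10_tev.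
Qed.

Lemma in_h_gfun T : in_h T -> exists B : forall i : 'I_k, tensor R 'I_(d i),
  (forall i, symmetric_tensor (B i)) /\ forall x, mu_pair T x = gfun B x.
Proof. by case=> B [sB ->]; exists B; split => // x; rewrite mu_pair_sum. Qed.

Lemma gfun_in_h (B : forall i : 'I_k, tensor R 'I_(d i)) :
  (forall i, symmetric_tensor (B i)) ->
  exists T, in_h T /\ forall x, mu_pair T x = gfun B x.
Proof.
move=> sB; exists (\sum_(i < k) ins10 (B i)); split; first by exists B.
exact: mu_pair_sum.
Qed.

Lemma slope_grp (i : 'I_k) (r : 'I_(d i)) (f : ('I_(d i) -> R) -> R) x :
  slope (sl r) (fun x => f (grp i x)) x = slope r f (grp i x).
Proof. by rewrite /slope !grp_upd. Qed.

Lemma slope_grpN (i j : 'I_k) (r : 'I_(d i)) (f : ('I_(d j) -> R) -> R) x : j != i ->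
  slope (sl r) (fun x => f (grp j x)) x = 0.
Proof. by move=> ji; rewrite /slope !grp_updN // subrr. Qed.

Lemma slope_gfun B (i : 'I_k) (r : 'I_(d i)) x :
  slope (sl r) (gfun B) x = slope r (tev (B i)) (grp i x).
Proof.
rewrite /slope /gfun (bigD1 i) //= [in X in _ - X](bigD1 i) //= !grp_upd.
rewrite (eq_bigr (fun j => tev (B j) (grp j x))); last first.
  by move=> j ji; rewrite grp_updN.
rewrite [X in _ - (_ + X)](eq_bigr (fun j => tev (B j) (grp j x))); last first.
  by move=> j ji; rewrite grp_updN.
ring.
Qed.

Lemma mu_pair_inj T U : (forall x, mu_pair T x = mu_pair U x) -> T = U.
Proof. exact: tev_inj. Qed.

Definition const_tensor (J : finType) (a : R) : tensor R J := a *: ptensor (fun _ => (1, 0)).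

Lemma tev_const (J : finType) (a : R) (x : J -> R) : tev (const_tensor J a) x = a.
Proof. by rewrite tevZ tev_ptensor big1 ?mulr1 // => s _ /=; ring. Qed.

Lemma symmetric_const n a : symmetric_tensor (const_tensor 'I_n a).
Proof. by apply/symmetric_tensorP => p y; rewrite !tev_const. Qed.

Lemma symmetricD n (B C : tensor R 'I_n) :
  symmetric_tensor B -> symmetric_tensor C -> symmetric_tensor (B + C).
Proof.
move=> /symmetric_tensorP sB /symmetric_tensorP sC; apply/symmetric_tensorP => p y.
by rewrite !tevD sB sC.
Qed.

Lemma symmetricZ n a (B : tensor R 'I_n) : symmetric_tensor B -> symmetric_tensor (a *: B).
Proof.
by move=> /symmetric_tensorP sB; apply/symmetric_tensorP => p y; rewrite !tevZ sB.
Qed.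

End Groups.
Arguments grp {R k d} i x r.
Arguments gbox {R k d} I i r.
Arguments gbox_grp {R k d I} i {x}.


Section Beta.
Variables (R : realType) (k : nat) (d : 'I_k -> nat) (beta : tensor R (slot d)).
Hypothesis hb : in_h beta.
Let L := mu_pair beta.

Lemma Sset_slope0 (i : 'I_k) (r : 'I_(d i)) x : i \notin Sset beta -> slope (sl r) L x = 0.
Proof.
rewrite inE negb_exists => /forallP c0; rewrite /slope /L !mu_pairE //.
apply/eqP; rewrite subr_eq0; apply/eqP; congr (_ + _); apply: eq_bigr => j _.
have [ji|ji] := eqVneq j i.
  by subst j; apply: eq_bigr => q _; have := c0 q; rewrite negbK => /eqP ->; rewrite !mul0r.
apply: eq_bigr => q _; congr (_ * elem_sym _ _).
by have := grp_updN r x 1 ji; have := grp_updN r x 0 ji; rewrite /grp => -> ->.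
Qed.

(** If the slope along one slot vanished identically, symmetry would carry this to the slot of a
    nonzero coefficient, and [tev_indep] would make that coefficient zero. So membership in S is
    visible on every slot of the group. *)
Lemma Sset_slope (i : 'I_k) (r : 'I_(d i)) : i \in Sset beta ->
  exists x, slope (sl r) L x != 0.
Proof.
rewrite inE => /existsP[q cq].
have [//|/forallNP h] := pselect (exists x, slope (sl r) L x != 0).
have h0 x : slope (sl r) L x = 0 by have /negP := h x; rewrite negbK => /eqP.
have [B [sB BE]] := in_h_gfun hb; have LE : L = gfun B by apply/funext.
have hq x : slope (sl q) L x = 0.
  rewrite LE slope_gfun; set y := grp i x.
  rewrite -(tpermL r q) -slope_perm //.
  by rewrite -(grp_emb (y \o tperm r q)) -slope_gfun -LE h0.
move: cq; rewrite /coef (@tev_indep _ _ beta (sl q) hq) ?eqxx //.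
by rewrite ffunE /= eqxx leqnn.
Qed.

End Beta.

(** * The extremality equation *)

Lemma derivs2_on_ext (R : realType) (I : set R) (A A1 A2 B : R -> R) : open_interval I ->
  (forall y, I y -> A y = B y) -> derivs2_on I A A1 A2 -> derivs2_on I B A1 A2.
Proof.
move=> oI AB dA y Iy; have [d1 d2] := dA y Iy; split => //.
exact: (is_derive_eq_on oI Iy AB).
Qed.

Lemma mdim_ge2 k (d : 'I_k -> nat) i j : i != j -> (d i + d j <= mdim d)%N.
Proof.
by move=> ij; rewrite /mdim (bigD1 i) //= (bigD1 j) ?addnA ?leq_addr // eq_sym.
Qed.

Lemma other_index k (i : 'I_k) : (2 <= k)%N -> exists j, j != i.
Proof.
move=> k2; have : (0 < #|predC1 i|)%N by rewrite cardC1 card_ord; lia.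
by case/card_gt0P => j ji; exists j.
Qed.

Section Extremality.
Variables (R : realType) (k : nat) (d : 'I_k -> nat) (beta : tensor R (slot d))
  (I : slot d -> set R).
Let L := mu_pair beta.
Local Notation c := (mdim d).+1.
Implicit Types (A : slot d -> R -> R) (x : slot d -> R).
Hypothesis oI : forall s, open_interval (I s).
Hypothesis L0 : forall x, box I x -> L x != 0.

Let maL : multiaffine L. Proof. exact: multiaffine_tev. Qed.

Lemma extremal_term A (A1 A2 : R -> R) (i : 'I_k) (r : 'I_(d i)) x : box I x ->
  derivs2_on (I (sl r)) (A (sl r)) A1 A2 ->
  L x ^+ (mdim d + 3) / Delta r x * partial (sl r) (partial (sl r)
     (fun y => A (sl r) (y (sl r)) / L y ^+ (mdim d + 1))) x =
  bop c (A (sl r) (x (sl r))) (A1 (x (sl r))) (A2 (x (sl r))) (L x) (slope (sl r) L x)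
    / gdelta r (grp i x).
Proof.
move=> Ix dA; set M := L (upd x (sl r) 0); set N := slope (sl r) L x.
have LE y : M + N * y = L (upd x (sl r) y) by rewrite maL mulrC.
have Ly y : I (sl r) y -> M + N * y != 0 by move=> Iy; rewrite LE; apply: L0; exact: box_upd.
have FE y : I (sl r) y -> A (sl r) (upd x (sl r) y (sl r)) / L (upd x (sl r) y) ^+ (mdim d + 1) =
    A (sl r) y / (M + N * y) ^+ c.
  by move=> Iy; rewrite updE addn1 LE.
have -> := @partial_partial _ _ _ (fun y => A (sl r) (y (sl r)) / L y ^+ (mdim d + 1)) _ x _ _ _
  (oI (sl r)) (Ix (sl r)) FE (derivs2_on_div c Ly dA).
rewrite LE upd_id addn3; have := L0 Ix; rewrite -/(gdelta r (grp i x)) => l0.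
have -> : Delta r x = gdelta r (grp i x) by [].
have u0 : L x ^+ (mdim d).+3 != 0 by rewrite expf_neq0.
by rewrite [LHS]mulrC mulrA divfK.
Qed.

(** The derivatives are arguments, so that one expression serves for the smooth functions at the
    start and for the polynomials replacing them. *)
Definition eqsum A A1 A2 x : R := \sum_(i < k) \sum_(r < d i)
  bop c (A (sl r) (x (sl r))) (A1 (sl r) (x (sl r))) (A2 (sl r) (x (sl r)))
    (L x) (slope (sl r) L x) / gdelta r (grp i x).

Lemma extremalE A A1 A2 : (forall s, derivs2_on (I s) (A s) (A1 s) (A2 s)) ->
  extremal beta I A <-> exists alpha, in_h alpha /\
    forall x, box I x -> eqsum A A1 A2 x = mu_pair alpha x.
Proof.
move=> dA; split=> -[alpha [ha E]]; exists alpha; split => // x Ix; rewrite -E //;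
  apply: eq_bigr => i _; apply: eq_bigr => r _; rewrite (extremal_term Ix (dA _)) //.
Qed.

Hypothesis injI : forall i y, box (gbox I i) y -> injective y.
Hypothesis hb : in_h beta.

(** On a line in a direction of group [p] the slopes along slots of the other groups are constant.
    Their terms therefore contribute to the coefficient at the square of the variable exactly
    [kappa] times the squared slope of <mu, beta> along the line. *)
Definition kappa (A2 : slot d -> R -> R) (p : 'I_k) x : R := \sum_(j | j != p)
  \sum_(r < d j) A2 (sl r) (x (sl r)) / gdelta r (grp j x).

Lemma slope2N (i j : 'I_k) (q : 'I_(d i)) (r : 'I_(d j)) x : i != j ->
  slope (sl r) (slope (sl q) L) x = 0.
Proof.
move=> ij; have [B [sB BE]] := in_h_gfun hb.
have -> : L = gfun B by apply/funext.
have -> : slope (sl q) (gfun B) = fun x => slope q (tev (B i)) (grp i x).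
  by apply/funext => u; rewrite slope_gfun.
exact: slope_grpN.
Qed.

(** The right-hand side is affine on the line, so the square terms of the other groups move to it
    with a minus sign, and [lagrange_nec] applies with [e = 2]. The values at the other coordinates
    of the group are the residue conditions. *)
Lemma eqsum_line A A1 A2 C (p : 'I_k) (r : 'I_(d p)) x :
  (forall x, box I x -> eqsum A A1 A2 x = gfun C x) -> box I x ->
  exists rho : {poly R}, [/\
    forall z, I (sl r) z -> bop c (A (sl r) z) (A1 (sl r) z) (A2 (sl r) z)
      (L (upd x (sl r) z)) (slope (sl r) L x) = rho.[z],
    (size rho <= (d p).+2)%N,
    rho`_(d p).+1 = - (slope (sl r) L x ^+ 2 * kappa A2 p x) &
    forall q : 'I_(d p), q != r -> rho.[x (sl q)] =
      bop c (A (sl q) (x (sl q))) (A1 (sl q) (x (sl q))) (A2 (sl q) (x (sl q)))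
        (L (upd x (sl r) (x (sl q)))) (slope (sl q) L (upd x (sl r) (x (sl q))))].
Proof.
move=> E Ix; set s := sl r.
have /choice[P hP] : forall t : slot d, exists P : {poly R}, [/\ (size P <= 3)%N,
    P`_2 = bop c (A t (x t)) (A1 t (x t)) (A2 t (x t)) (slope s L x) (slope s (slope t L) x) &
    forall z, bop c (A t (x t)) (A1 t (x t)) (A2 t (x t)) (L (upd x s z)) (slope t L (upd x s z))
      = P.[z]].
  move=> t; have [P [sP P2 PE]] := bop_quadratic c (A t (x t)) (A1 t (x t)) (A2 t (x t))
    (L (upd x s 0)) (slope s L x) (slope t L (upd x s 0)) (slope s (slope t L) x).
  by exists P; split => // z; rewrite -PE maL (multiaffine_slope t maL).
pose g := \sum_(j | j != p) \sum_(q < d j) (gdelta q (grp j x))^-1 *: P (sl q).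
pose h := (gfun C (upd x s 0))%:P + slope s (gfun C) x *: 'X - g.
have sh : (size h <= 3)%N.
  rewrite sizeB_leq ?(leq_trans (size_linear _ _)) //.
  apply: (leq_trans (size_sum _ _ _)); apply/bigmax_leqP => j _.
  apply: (leq_trans (size_sum _ _ _)); apply/bigmax_leqP => q _.
  by apply: sizeZ_leq; have [] := hP (sl q).
have gE z : gfun C (upd x s z) = gfun C (upd x s 0) + z * slope s (gfun C) x.
  rewrite slope_gfun /gfun (bigD1 p) //= [in RHS](bigD1 p) //= !grp_upd.
  rewrite (@multiaffine_tev _ _ (C p)) addrAC; congr (_ + _ + _).
  by apply: eq_bigr => j jp; rewrite !grp_updN.
have Es z : I s z ->
  bop c (A s z) (A1 s z) (A2 s z) (L (upd x s z)) (slope s L x) / gdelta r (upd (grp p x) r z) +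
  \sum_(q | q != r) (P (sl q)).[z] / gdelta q (upd (grp p x) r z) = h.[z].
  move=> Iz; have := E _ (box_upd Ix Iz); rewrite gE /eqsum (bigD1 p) //= (bigD1 r) //=.
  have gz : g.[z] = \sum_(i < k | i != p) \sum_(q < d i)
      bop c (A (sl q) (upd x s z (sl q))) (A1 (sl q) (upd x s z (sl q)))
        (A2 (sl q) (upd x s z (sl q))) (L (upd x s z)) (slope (sl q) L (upd x s z))
        / gdelta q (grp i (upd x s z)).
    rewrite horner_sum; apply: eq_bigr => j jp; rewrite horner_sum; apply: eq_bigr => q _.
    rewrite hornerZ grp_updN // mulrC; have [_ _ <-] := hP (sl q).
    by have := congr1 (fun f => f q) (grp_updN r x z jp); rewrite /grp => ->.
  rewrite -gz /h updE slope_upd grp_upd !hornerE.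
  rewrite (eq_bigr (fun q => (P (sl q)).[z] / gdelta q (upd (grp p x) r z))); last first.
    by move=> q qr; rewrite updN ?sl_eq //; have [_ _ ->] := hP (sl q).
  by rewrite [z * _]mulrC => <-; rewrite addrK.
have iy := injI (gbox_grp p Ix).
have zy z : I s z -> forall q, q != r -> z != grp p x q.
  move=> Iz; apply/(upd_injP _ _ iy); rewrite -grp_upd.
  by apply: injI (gbox_grp p _); exact: box_upd.
have [|rho [r1 r2 r3 r4]] := lagrange_nec iy zy Es _ sh.
  by move=> q _; have [] := hP (sl q).
have dp : ((d p).-1 + 2 = (d p).+1)%N by have := ltn_ord r; lia.
exists rho; split=> // [||q qr]; first by rewrite dp in r2.
- rewrite -dp r3 /h coefB coefD coefC coefZ coefX /= mulr0 !add0r; congr (- _).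
  rewrite coef_sum mulr_sumr; apply: eq_bigr => j jp.
  rewrite coef_sum mulr_sumr; apply: eq_bigr => q _.
  rewrite coefZ; have [_ -> _] := hP (sl q); rewrite slope2N // /bop; ring.
- by rewrite [LHS](r4 q qr); have [_ _ ->] := hP (sl q).
Qed.

Lemma extremal_poly A (d_gt0 : forall i, (0 < d i)%N) : (2 <= k)%N ->
  (forall s, smooth_on (I s) (A s)) -> extremal beta I A ->
  exists (a : slot d -> {poly R}) (C : forall i : 'I_k, tensor R 'I_(d i)),
  [/\ forall s y, I s y -> A s y = (a s).[y], forall i, symmetric_tensor (C i) &
     forall x, box I x -> eqsum (fun s => horner (a s)) (fun s => horner (deriv (a s)))
       (fun s => horner (deriv (deriv (a s)))) x = gfun C x].
Proof.
move=> k2 sA; have dA s := smooth_derivs2 (sA s).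
move=> /(extremalE dA)[alpha [/in_h_gfun[C [sC CE]] E]].
have {CE} E x : box I x -> _ := fun Ix => etrans (E x Ix) (CE x).
have /choice[a ha] : forall s, exists a : {poly R}, forall y, I s y -> A s y = a.[y].
  apply: slot_ind => p r; have [x Ix] := box_nonempty oI.
  have [rho [r1 r2 _ _]] := eqsum_line r E Ix.
  apply: (euler_ode_poly (c := c) (M := L (upd x (sl r) 0)) (N := slope (sl r) L x)
    (rho := rho) (oI (sl r)) (dA _)).
  - by move=> y Iy; rewrite mulrC -maL; apply: L0; exact: box_upd.
  (* A second group has at least one slot, so the size [d p + 2] allowed for [rho] is at most
     [m + 1 = c]. *)
  - move=> _; have [j jp] := other_index p k2; apply: (leq_trans r2).
    by have := mdim_ge2 d jp; have := d_gt0 j; lia.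
  - by move=> y Iy; rewrite mulrC -maL r1.
exists a, C; split => //.
have dA' s : derivs2_on (I s) (A s) (horner (deriv (a s))) (horner (deriv (deriv (a s)))).
  apply: (derivs2_on_ext (oI s) _ (@derivs2_on_poly R (I s) (a s))) => y Iy.
  by rewrite ha.
move=> x Ix; rewrite -E //; apply: eq_bigr => i _; apply: eq_bigr => r _.
rewrite -(extremal_term Ix (dA (sl r))) (extremal_term Ix (dA' (sl r))).
by rewrite ha //; apply: Ix.
Qed.

End Extremality.

Section GroupTerm.
Variables (R : realType) (n : nat) (I : 'I_n -> set R).
Hypothesis oI : forall s, open_interval (I s).
Hypothesis injI : forall y, box I y -> injective y.
Variables (c : nat) (B : tensor R 'I_n) (a : {poly R}).
Hypothesis sB : symmetric_tensor B.

Lemma bop_shift (Q : R) y :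
  \sum_q bop c a.[y q] (deriv a).[y q] (deriv (deriv a)).[y q] (tev B y + Q) (slope q (tev B) y)
     / gdelta q y =
  Q ^+ 2 * gsum (fun q y => (deriv (deriv a)).[y q]) y + 2 * Q * gsum (cross_num c B a) y
    + gsum (bop_num c B a) y.
Proof.
rewrite /gsum !mulr_sumr -!big_split /=; apply: eq_bigr => q _.
by rewrite /cross_num /bop_num /bop; ring.
Qed.

(** In the expansion by powers of [Q], the sum at [Q^2] is a constant, the one at [2 Q] is affine in
    [tev B y], and the last is quadratic up to a symmetric tensor. Collected in [tev B y + Q] and
    [tev B y] they give one explicit quadratic form, used in both directions of the theorem. *)
Lemma group_term : (0 < n)%N -> (size a <= n.+2)%N ->
  exists kk (B' : tensor R 'I_n), symmetric_tensor B' /\ forall y Q, box I y ->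
  \sum_q bop c a.[y q] (deriv a).[y q] (deriv (deriv a)).[y q] (tev B y + Q) (slope q (tev B) y)
     / gdelta q y =
  a`_n.+1 * (n%:R * (n%:R + 1) * (tev B y + Q) ^+ 2
    - 2 * c%:R * (n%:R + 1) * (tev B y + Q) * tev B y + c%:R * (c%:R + 1) * tev B y ^+ 2)
  + 2 * kk * Q + tev B' y.
Proof.
move=> n0 sa; have s2 : (size (deriv (deriv a)) <= n)%N.
  by apply/leq_sizeP => j nj; rewrite coef_deriv2 (coef_geq sa) ?mulr0.
have [kk hk] := gsum_cst1 oI injI sB (numerators_cross c sB sa) (fun r y => erefl).
have [B' sB' hB'] := gsum_symmetric2 oI injI sB (numerators_bop c sB sa) (fun r y => erefl).
exists kk, B'; split => // y Q Iy; rewrite bop_shift (gsum_horner_top n0 s2 (injI Iy)) hk // hB' //.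
rewrite coef_deriv2 prednK // -[in X in Q ^+ 2 * X](prednK n0) -natr1 prednK //.
have -> : n.-1%:R = n%:R - 1 :> R by rewrite -[in RHS](prednK n0) -natr1 addrK.
ring.
Qed.

End GroupTerm.

(** * Necessary conditions *)

Lemma size_deriv2 (R : realType) (p : {poly R}) n :
  (size (deriv (deriv p)) <= n)%N -> (size p <= n.+2)%N.
Proof.
move=> sp; apply/leq_sizeP => -[|[|j]] // nj.
have := coef_deriv2 p j; rewrite (coef_geq sp) //.
move/esym/eqP; rewrite !mulf_eq0 => /orP[/orP[]|/eqP//].
  by rewrite natr1 pnatr_eq0.
by rewrite -[2]/(2%:R) -natrD pnatr_eq0 addn2.
Qed.

(** On a line in direction [r] the other numerators are constants, and the residue at [z = y q] says
    that [f r] and [f q] agree at [y q]. As [y q] runs over an interval, the polynomials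
    coincide. *)
Lemma uniform_numerator (R : realType) n (I : 'I_n -> set R) e (f : 'I_n -> {poly R})
    (lead : ('I_n -> R) -> 'I_n -> R) :
  (0 < n)%N -> (forall s, open_interval (I s)) -> (forall y, box I y -> injective y) ->
  (forall y r, box I y -> exists h : {poly R}, [/\ (size h <= e.+1)%N, h`_e = lead y r &
    forall z, I r z -> gsum (fun q y => (f q).[y q]) (upd y r z) = h.[z]]) ->
  exists g : {poly R}, [/\ (size g <= (n.-1 + e).+1)%N, forall q, f q = g &
    forall y r, box I y -> g`_(n.-1 + e) = lead y r].
Proof.
move=> n0 oI injI H; have H' y r : box I y -> [/\ (size (f r) <= (n.-1 + e).+1)%N,
    (f r)`_(n.-1 + e) = lead y r & forall q, q != r -> (f r).[y q] = (f q).[y q]].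
  move=> Iy; have [h [sh hl hE]] := H y r Iy; have iy := injI _ Iy.
  have [||q qr||rho [r1 r2 r3 r4]] := @lagrange_nec _ _ e r y (horner (f r))
    (fun q => ((f q).[y q])%:P) h (I r) iy.
  - by move=> z Iz; apply/(upd_injP _ _ iy); apply: injI; exact: box_upd.
  - move=> z Iz; rewrite -hE // /gsum [RHS](bigD1 r) //= updE; congr (_ + _).
    by apply: eq_bigr => q qr; rewrite hornerC updN.
  - exact: leq_trans (size_polyC_leq1 _) _.
  - exact: sh.
  rewrite (poly_interval_eq (oI r) r1); split => //; first by rewrite r3.
  by move=> q /r4; rewrite hornerC.
have [y0 Iy0] := box_nonempty oI; pose r0 := Ordinal n0.
have fE q : f q = f r0.
  have [->//|qr] := eqVneq q r0; apply: (poly_interval_eq (oI q)) => z Iz.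
  have [_ _ /(_ q qr)] := H' (upd y0 q z) r0 (box_upd Iy0 Iz).
  by rewrite updE.
exists (f r0); split => //; first by have [] := H' y0 r0 Iy0.
by move=> y r Iy; have [_ <- _] := H' y r Iy; rewrite fE.
Qed.

Definition proportional (R : realType) (J : finType) (f g : (J -> R) -> R) :=
  forall x x', f x * g x' = f x' * g x.

(** For [e2 != 0] the form either splits into real linear factors, one of which vanishes identically
    and makes [f] and [g] proportional, or has negative discriminant, which contradicts [g x0 != 0].
    For [e2 = 0] it is [g] times a linear form. *)
Lemma quadratic_relation (R : realType) (J : finType) (f g : (J -> R) -> R) (e0 e1 e2 : R) :
  polyfun f -> polyfun g -> ~ proportional f g -> (exists x, g x != 0) ->
  (forall x, e0 * g x ^+ 2 + e1 * (g x * f x) + e2 * f x ^+ 2 = 0) -> e1 = 0 /\ e2 = 0.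
Proof.
move=> pf pg nprop [x0 gx0] H.
have lin u v : u != 0 -> (forall x, u * f x + v * g x = 0) -> False.
  move=> u0 E; apply: nprop => x x'; apply: (mulfI u0).
  have E1 : u * f x = - (v * g x) by apply/eqP; rewrite -addr_eq0 E.
  have E2 : u * f x' = - (v * g x') by apply/eqP; rewrite -addr_eq0 E.
  by rewrite !mulrA E1 E2; ring.
have plin u v : polyfun (fun x => u * f x + v * g x).
  by apply: polyfun_add; apply: polyfun_scale.
have [e20|e20] := eqVneq e2 0.
  split=> //; apply/eqP/negP => /negP e10.
  have [x|E|E] := polyfun_mulf0 pg (plin e1 e0).
  - by rewrite -[RHS](H x) e20; ring.
  - by rewrite E eqxx in gx0.
  - exact: lin e10 E.
exfalso; have e22 : 2 * e2 != 0 by rewrite mulf_neq0 ?pnatr_eq0.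
pose D := e1 ^+ 2 - 4 * e0 * e2.
have DE x : (2 * e2 * f x + e1 * g x) ^+ 2 = D * g x ^+ 2.
  apply/eqP; rewrite -subr_eq0; apply/eqP.
  transitivity (4 * e2 * (e0 * g x ^+ 2 + e1 * (g x * f x) + e2 * f x ^+ 2)).
    by rewrite /D; ring.
  by rewrite H mulr0.
have [D0|D0] := leP 0 D; last first.
  have := DE x0; have := sqr_ge0 (2 * e2 * f x0 + e1 * g x0) => h E.
  by move: h; rewrite E pmulr_lge0 ?exprn_even_gt0 // leNgt D0.
have [x|E|E] := polyfun_mulf0 (plin (2 * e2) (e1 - Num.sqrt D)) (plin (2 * e2) (e1 + Num.sqrt D)).
- transitivity ((2 * e2 * f x + e1 * g x) ^+ 2 - Num.sqrt D ^+ 2 * g x ^+ 2); first by ring.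
  by rewrite sqr_sqrtr // DE subrr.
- exact: lin e22 E.
- exact: lin e22 E.
Qed.

Lemma natr_neq (R : realType) (i j : nat) : i != j -> (i%:R - j%:R : R) != 0.
Proof. by move=> ij; rewrite subr_eq0 eqr_nat. Qed.

Lemma bpoly_top (R : realType) (m n : nat) (a : {poly R}) (M N : R) :
  N != 0 -> size a = n.+1 -> n != m.+1 -> n != m.+2 -> (bpoly m.+1 a M N)`_n != 0.
Proof.
move=> N0 sa n1 n2; rewrite coef_bpoly.
rewrite [a`__.+1]nth_default ?sa // [a`__.+2]nth_default ?sa // !mulr0 !addr0.
have an : a`_n != 0 by have := lead_coef_eq0 a; rewrite lead_coefE sa /= => ->; rewrite -size_poly_eq0 sa.
rewrite !mulf_neq0 ?expf_neq0 // ?natr_neq //.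
have -> : n%:R - m.+1%:R - 1 = n%:R - m.+2%:R :> R by rewrite -[m.+2%:R]natr1; ring.
exact: natr_neq.
Qed.

(* The pairs [(M, N)] of coefficients of [L = M + N z] range over a set on which
   no quadratic form involving [M] vanishes. *)
Lemma bpoly_degree (R : realType) (m n : nat) (a : {poly R}) (Omega : R -> R -> Prop) :
  (n < m)%N -> (exists M N, Omega M N /\ N != 0) ->
  (forall e0 e1 e2 : R, (forall M N, Omega M N ->
     e0 * N ^+ 2 + e1 * (N * M) + e2 * M ^+ 2 = 0) -> e1 = 0 /\ e2 = 0) ->
  (forall M N, Omega M N -> (size (bpoly m.+1 a M N) <= n.+2)%N) ->
  (m = n.+1 -> exists kap : R, forall M N, Omega M N ->
     (bpoly m.+1 a M N)`_n.+1 = - (N ^+ 2 * kap)) ->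
  (size a <= n.+2)%N.
Proof.
move=> nm [M [N [OM N0]]] quad sb coefn.
have top l : size a = l.+1 -> (n.+2 <= l)%N -> l != m.+1 -> l != m.+2 -> False.
  move=> sa nl l1 l2; have := bpoly_top M N0 sa l1 l2.
  by rewrite (coef_geq (sb _ _ OM)) // eqxx.
have a3 : (size a <= m.+3)%N.
  rewrite leqNgt; apply/negP => h; apply: (top (size a).-1); lia.
(* The degrees [m + 1] and [m + 2] escape the leading-term argument. The coefficient at [m] excludes
   them: it is a quadratic form in [M] and [N] whose entries at [N M] and [M^2] are multiples of
   these two coefficients. For [m = n + 1] its prescribed value only changes [e0]. *)
have [a1 a2] : a`_m.+1 = 0 /\ a`_m.+2 = 0.
  have [kap hk] : exists kap : R, forall M N, Omega M N ->
      (bpoly m.+1 a M N)`_m = - (N ^+ 2 * kap).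
    have [mn|mn] := eqVneq m n.+1; first by have [kap hk] := coefn mn; exists kap; rewrite mn in hk *.
    exists 0 => M' N' O'; rewrite (coef_geq (sb _ _ O')) ?mulr0 ?oppr0 //; lia.
  have [|e1 e2] := quad (2 * a`_m + kap) (- 2 * (m%:R + 1) * a`_m.+1)
    ((m%:R + 2) * (m%:R + 1) * a`_m.+2).
    move=> M' N' O'; have := hk _ _ O'; rewrite coef_bpoly -natr1 => /eqP.
    rewrite -addr_eq0 => /eqP E; rewrite -[RHS]E; ring.
  have m1 : m%:R + 1 != 0 :> R by rewrite natr1 pnatr_eq0.
  have m2 : m%:R + 2 != 0 :> R by rewrite -natrD pnatr_eq0 addn2.
  split; apply/eqP; [move/eqP: e1|move/eqP: e2]; rewrite !mulf_eq0 ?(negbTE m1) ?(negbTE m2).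
    by rewrite oppr_eq0 pnatr_eq0 /=.
  by [].
have a4 : (size a <= m.+1)%N.
  by apply/leq_sizeP => j; rewrite leq_eqVlt => /predU1P[<-//|];
    rewrite leq_eqVlt => /predU1P[<-//|]; apply: coef_geq.
rewrite leqNgt; apply/negP => h; apply: (top (size a).-1); lia.
Qed.

Lemma polyfun_cancel (R : realType) (J : finType) (f g : (J -> R) -> R) :
  polyfun f -> polyfun g -> (exists x, g x != 0) -> (forall x, f x * g x = 0) ->
  forall x, f x = 0.
Proof.
move=> pf pg [x0 gx0] fg; have [//|g0] := polyfun_mulf0 pf pg fg.
by rewrite g0 eqxx in gx0.
Qed.

Lemma polyfun_coord0 (R : realType) (J : finType) (p : {poly R}) (t : J) :
  (forall x : J -> R, p.[x t] = 0) -> p = 0.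
Proof. by move=> H; apply: poly_all_eq => y; rewrite horner0 -(H (fun=> y)). Qed.

Lemma polyfun_bop (R : realType) (J : finType) c (f0 f1 f2 f g : (J -> R) -> R) :
  polyfun f0 -> polyfun f1 -> polyfun f2 -> polyfun f -> polyfun g ->
  polyfun (fun x => bop c (f0 x) (f1 x) (f2 x) (f x) (g x)).
Proof.
move=> p0 p1 p2 pf pg; rewrite /bop; apply: polyfun_add; first apply: polyfun_sub.
- by apply: polyfun_mul => //; apply: polyfun_mul.
- by do 2!apply: polyfun_mul => //; apply: polyfun_mul => //; apply: polyfun_cst.
- apply: polyfun_mul; last exact: polyfun_mul.
  by apply: polyfun_mul => //; apply: polyfun_cst.
Qed.

Lemma size_leq3E (R : realType) (p : {poly R}) : (size p <= 3)%N ->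
  p = (p`_0)%:P + p`_1 *: 'X + p`_2 *: 'X^2.
Proof.
move=> sp; apply/polyP => -[|[|[|j]]];
  rewrite !coefD coefC !coefZ coefX coefXn /= ?mulr0 ?mulr1 ?addr0 ?add0r //.
exact: coef_geq sp _.
Qed.

Lemma bopB (R : realType) c (a0 a1 a2 b0 b1 b2 l N : R) :
  bop c (a0 - b0) (a1 - b1) (a2 - b2) l N = bop c a0 a1 a2 l N - bop c b0 b1 b2 l N.
Proof. by rewrite /bop; ring. Qed.

Section Necessity.
Variables (R : realType) (k : nat) (d : 'I_k -> nat) (beta : tensor R (slot d))
  (I : slot d -> set R) (a : slot d -> {poly R}) (C : forall i : 'I_k, tensor R 'I_(d i)).
Let L := mu_pair beta.
Local Notation c := (mdim d).+1.
Implicit Types (x : slot d -> R).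
Hypothesis d_gt0 : forall i, (0 < d i)%N.
Hypothesis oI : forall s, open_interval (I s).
Hypothesis injI : forall i y, box (gbox I i) y -> injective y.
Hypothesis hb : in_h beta.
Hypothesis E : forall x, box I x -> eqsum beta (fun s => horner (a s))
  (fun s => horner (deriv (a s))) (fun s => horner (deriv (deriv (a s)))) x = gfun C x.

Let maL : multiaffine L. Proof. exact: multiaffine_tev. Qed.
Let pfL : polyfun L. Proof. exact: polyfun_tev. Qed.

Definition kap (p : 'I_k) x := kappa (fun s => horner (deriv (deriv (a s)))) p x.

Lemma slope_eq (p : 'I_k) (r q : 'I_(d p)) x : x (sl r) = x (sl q) ->
  slope (sl r) L x = slope (sl q) L x.
Proof.
move=> xrq; have [B [sB BE]] := in_h_gfun hb.
have -> : L = gfun B by apply/funext.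
rewrite !slope_gfun; apply: (@equivariant_eq _ _ (fun q y => slope q (tev (B p)) y)) => //.
by move=> pi u y; apply: slope_perm.
Qed.

(** The slopes along [r] and [q] agree where the two coordinates do ([slope_eq]), so the residue
    condition compares the same operator on [a (sl r)] and [a (sl q)] and becomes an equation for
    their difference. *)
Lemma line_poly (p : 'I_k) (r : 'I_(d p)) x : box I x ->
  [/\ (size (bpoly c (a (sl r)) (L (upd x (sl r) 0)) (slope (sl r) L x)) <= (d p).+2)%N,
      (bpoly c (a (sl r)) (L (upd x (sl r) 0)) (slope (sl r) L x))`_(d p).+1 =
        - (slope (sl r) L x ^+ 2 * kap p x) &
      forall q : 'I_(d p), q != r ->
        bop c (a (sl r) - a (sl q)).[x (sl q)] (deriv (a (sl r) - a (sl q))).[x (sl q)]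
          (deriv (deriv (a (sl r) - a (sl q)))).[x (sl q)]
          (L (upd x (sl r) (x (sl q)))) (slope (sl r) L x) = 0].
Proof.
move=> Ix; have [rho [r1 r2 r3 r4]] := eqsum_line injI hb r E Ix.
have rE : bpoly c (a (sl r)) (L (upd x (sl r) 0)) (slope (sl r) L x) = rho.
  apply: (poly_interval_eq (oI (sl r))) => z Iz.
  by rewrite horner_bpoly -r1 // mulrC -maL.
rewrite rE; split => // q qr; have := r4 q qr; rewrite -rE horner_bpoly mulrC -maL => e.
rewrite !derivB !hornerD !hornerN bopB e.
rewrite -(@slope_eq p r q) ?updE ?updN ?sl_eq //.
by rewrite slope_upd subrr.
Qed.

(** * The residue equation and equality of two numerators of a group *)

Section Pair.
Variables (p : 'I_k) (r q : 'I_(d p)).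
Hypothesis qr : q != r.
Let s := sl r.
Let t := sl q.
Let D := a s - a t.

Let st : t != s. Proof. by rewrite sl_eq. Qed.

Lemma residue_all x : bop c D.[x t] (deriv D).[x t] (deriv (deriv D)).[x t]
  (L (upd x s (x t))) (slope s L x) = 0.
Proof.
apply: (polyfun_box0 oI (f := fun x => bop c D.[x t] (deriv D).[x t] (deriv (deriv D)).[x t]
  (L (upd x s (x t))) (slope s L x))) => [|{}x Ix]; last by have [_ _ ->] := line_poly r Ix.
apply: polyfun_bop; [exact: polyfun_coord..| |exact: polyfun_slope].
move=> cv; have [P hP] := @polyfun_upd _ _ s L 'X t pfL cv.
by exists P => z; rewrite -hP hornerX.
Qed.

(** Moving [x u] shifts [L] on the diagonal by a free multiple [w] of a nonzero slope and keeps the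
    slope along [s]. The coefficients of the residue equation at [w^2], [w] and 1 give in turn that
    the second derivative, the first derivative and [D] itself vanish. *)
Lemma same_numerator_third u : u != s -> u != t ->
  (forall x, slope u (slope s L) x = 0) -> (exists x, slope u L x != 0) ->
  (exists x, slope s L x != 0) -> a s = a t.
Proof.
move=> us ut sus su ss.
have sus' x : slope s (slope u L) x = 0 by rewrite slopeC.
have H x w : bop c D.[x t] (deriv D).[x t] (deriv (deriv D)).[x t]
    (L (upd (upd x s (x t)) u 0) + w * slope u L x) (slope s L x) = 0.
  have := residue_all (upd x u w); rewrite updN 1?eq_sym //.
  rewrite (updC _ _ _ us) (maL _ u w) (slope0_upd w (multiaffine_slope s maL) (sus x)).
  by rewrite (slope0_upd _ (multiaffine_slope u maL) (sus' x)).
have D2 : deriv (deriv D) = 0.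
  apply: (@polyfun_coord0 _ _ _ t); apply: (@polyfun_cancel _ _ _ (slope u L)) => //.
  - exact: polyfun_coord.
  - exact: polyfun_slope.
  apply: (@polyfun_cancel _ _ _ (slope u L)) => //.
  - by apply: polyfun_mul; [exact: polyfun_coord|exact: polyfun_slope].
  - exact: polyfun_slope.
  move=> x; apply: (@mulfI _ 2); first by rewrite pnatr_eq0.
  pose F w := bop c D.[x t] (deriv D).[x t] (deriv (deriv D)).[x t]
    (L (upd (upd x s (x t)) u 0) + w * slope u L x) (slope s L x).
  (* The second difference isolates the coefficient at [w^2]. *)
  transitivity (F 2 - 2 * F 1 + F 0); first by rewrite /F /bop; ring.
  by rewrite /F !H; ring.
have D1 : deriv D = 0.
  apply: (@polyfun_coord0 _ _ _ t); apply: (@polyfun_cancel _ _ _ (slope u L)) => //.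
  - exact: polyfun_coord.
  - exact: polyfun_slope.
  apply: (@polyfun_cancel _ _ _ (slope s L)) => //.
  - by apply: polyfun_mul; [exact: polyfun_coord|exact: polyfun_slope].
  - exact: polyfun_slope.
  move=> x; apply: (@mulfI _ (- 2 * c%:R)); first by rewrite mulf_neq0 ?oppr_eq0 ?pnatr_eq0.
  pose F w := bop c D.[x t] (deriv D).[x t] (deriv (deriv D)).[x t]
    (L (upd (upd x s (x t)) u 0) + w * slope u L x) (slope s L x).
  transitivity (F 1 - F 0); first by rewrite /F D2 /bop !horner0; ring.
  by rewrite /F !H; ring.
have D0 : D = 0.
  apply: (@polyfun_coord0 _ _ _ t); apply: (@polyfun_cancel _ _ _ (slope s L)) => //.
  - exact: polyfun_coord.
  - exact: polyfun_slope.
  apply: (@polyfun_cancel _ _ _ (slope s L)) => //.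
  - by apply: polyfun_mul; [exact: polyfun_coord|exact: polyfun_slope].
  - exact: polyfun_slope.
  move=> x; have h0 := H x 0.
  apply: (@mulfI _ (c%:R * (c%:R + 1))); first by rewrite mulf_neq0 ?natr1 ?pnatr_eq0.
  rewrite mulr0 -[RHS]h0 D1 deriv0 /bop !horner0; ring.
by apply/eqP; rewrite -subr_eq0 -/D D0.
Qed.

(** On the diagonal [L] is quadratic and its slope linear in [z], both with top coefficient the
    mixed slope [g]. Multiplied by [z^2], the equation has the top coefficient
    [(n - c) (n - c - 1) g^2] times that of [D], and the degree [n] of [D] is below [c]. *)
Lemma same_numerator_cross : (size D <= c)%N ->
  (exists x, slope t (slope s L) x != 0) -> a s = a t.
Proof.
move=> sD /(polyfun_box_neq0 oI (polyfun_slope t (polyfun_slope s pfL)))[x Ix g0].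
set g := slope t (slope s L) x in g0.
pose e := L (upd (upd x s 0) t 0); pose b := slope t L (upd x s 0) + slope s L (upd x t 0).
pose f := slope s L (upd x t 0).
pose Q := (e%:P + b *: 'X) + g *: 'X^2.
pose N := (f%:P + g *: 'X) * 'X.
pose Pi := (deriv (deriv D) * 'X^2) * (Q * Q) - (2 * c%:R) *: ((deriv D * 'X) * (Q * N))
  + (c%:R * (c%:R + 1)) *: (D * (N * N)).
have Pi0 : Pi = 0.
  apply: (poly_interval0 (oI t)) => z Iz.
  have [_ _ /(_ q qr)] := line_poly r (box_upd Ix Iz).
  rewrite -/s -/t -/D updE => h.
  have N1 : slope s L (upd x t z) = f + z * g by rewrite (multiaffine_slope s maL).
  have L1 : L (upd (upd x t z) s z) = e + b * z + g * z ^+ 2.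
    rewrite maL N1 (updC _ _ _ st) (maL (upd x s 0)) -/e /b -/f; ring.
  transitivity (z ^+ 2 * bop c D.[z] (deriv D).[z] (deriv (deriv D)).[z]
    (L (upd (upd x t z) s z)) (slope s L (upd x t z))); last by rewrite h mulr0.
  by rewrite N1 L1 /Pi /Q /N /bop !hornerE /=; ring.
have [D0|D0] := eqVneq D 0; first by apply/eqP; rewrite -subr_eq0 -/D D0.
exfalso; pose n := (size D).-1.
have sDn : (size D <= n.+1)%N by rewrite /n; lia.
have Dn : D`_n != 0 by have := lead_coef_eq0 D; rewrite lead_coefE => ->.
have sQ : (size Q <= 3)%N.
  by rewrite sizeD_leq ?sizeZ_leq ?size_polyXn // (leq_trans (size_linear _ _)).
have sN : (size N <= 3)%N.
  by apply: (@size_mul_leqS _ _ _ 1 1); rewrite ?size_linear ?size_polyX.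
have Q2 : Q`_2 = g by rewrite !coefD coefC !coefZ coefX coefXn /= mulr0 mulr1 !add0r.
have N2 : N`_2 = g by rewrite coefMX /= coefD coefC coefZ coefX /= mulr1 add0r.
have s2 : (size (deriv (deriv D) * 'X^2)%R <= n.+1)%N.
  by apply/leq_sizeP => j nj; rewrite coef_deriv2X2 (coef_geq sDn) // mulr0.
have s1 : (size (deriv D * 'X)%R <= n.+1)%N.
  by apply/leq_sizeP => j nj; rewrite coef_derivX (coef_geq sDn) // mulr0.
have := congr1 (fun P : {poly R} => P`_(n + (2 + 2))) Pi0.
rewrite coef0 coefD coefB !coefZ !(@coefM_top _ _ _ n (2 + 2)) ?size_mul_leqS //.
rewrite !(@coefM_top _ _ _ 2 2) // coef_deriv2X2 coef_derivX Q2 N2 => /eqP.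
have -> : n%:R * (n%:R - 1) * D`_n * (g * g) - 2 * c%:R * (n%:R * D`_n * (g * g)) +
    c%:R * (c%:R + 1) * (D`_n * (g * g)) =
    (n%:R - c%:R) * (n%:R - (c%:R + 1)) * (D`_n * (g * g)) by ring.
rewrite !mulf_eq0 (negbTE g0) (negbTE Dn) natr1 !subr_eq0 !eqr_nat /= !orbF.
by rewrite /n; lia.
Qed.

(** Needed for a group of two slots without mixed term. On the diagonal [L = e + 2 f z] while the
    slope is [f]. Up to [f^2], the top coefficient of [D] gets the factor [c^2 - 7 c + 8], whose
    discriminant 17 excludes integer roots; then the linear one gets [c (c - 3)], nonzero as
    [c >= 4]. *)
Lemma same_numerator_linear : (3 <= mdim d)%N -> (size D <= 3)%N ->
  (forall x, slope t (slope s L) x = 0) -> (exists x, slope s L x != 0) -> a s = a t.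
Proof.
move=> m3 sD ts0 /(polyfun_box_neq0 oI (polyfun_slope s pfL))[x Ix f0].
set f := slope s L x in f0; pose e := L (upd (upd x s 0) t 0).
have sN z : slope s L (upd x t z) = f by apply: slope0_upd; [exact: multiaffine_slope|exact: ts0].
have tN : slope t L (upd x s 0) = f.
  rewrite -(slope_upd L t (upd x s 0) 0) -(@slope_eq p r q) ?updE 1?updN ?updE 1?eq_sym //.
  by rewrite -(updC _ _ _ st) slope_upd sN.
have H z : I t z -> bop c D.[z] (deriv D).[z] (deriv (deriv D)).[z] (e + 2 * f * z) f = 0.
  move=> Iz; have [_ _ /(_ q qr)] := line_poly r (box_upd Ix Iz).
  rewrite -/s -/t -/D updE sN => <-; congr bop.
  by rewrite maL sN (updC _ _ _ st) (maL (upd x s 0)) -/e tN; ring.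
have DE := size_leq3E sD.
set u := D`_0 in DE; set v := D`_1 in DE; set w := D`_2 in DE.
have D1 : deriv D = v%:P + (2 * w) *: 'X.
  by rewrite DE !derivD derivC !derivZ derivX derivXn /=; apply: poly_all_eq => y; rewrite !hornerE /=; ring.
have D2 : deriv (deriv D) = (2 * w)%:P.
  by rewrite D1 derivD derivC derivZ derivX; apply: poly_all_eq => y; rewrite !hornerE.
pose cR : R := c%:R.
pose k2 := f ^+ 2 * w * (cR ^+ 2 - 7 * cR + 8).
pose k1 := 8 * w * e * f - 2 * cR * f * (2 * f * v + 2 * w * e) + cR * (cR + 1) * f ^+ 2 * v.
pose k0 := 2 * w * e ^+ 2 - 2 * cR * f * v * e + cR * (cR + 1) * f ^+ 2 * u.
have /polyP K : k0%:P + k1 *: 'X + k2 *: 'X^2 = 0 :> {poly R}.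
  apply: (poly_interval0 (oI t)) => z Iz; rewrite -(H z Iz) D2 D1 DE /bop /k0 /k1 /k2 -/cR.
  by rewrite !hornerE /=; ring.
have K2 : k2 = 0.
  by have := K 2%N; rewrite !coefD coefC !coefZ coefX coefXn coef0 /= mulr0 mulr1 !add0r.
have K1 : k1 = 0.
  by have := K 1%N; rewrite !coefD coefC !coefZ coefX coefXn coef0 /= mulr0 mulr1 addr0 add0r.
have K0 : k0 = 0.
  by have := K 0%N; rewrite !coefD coefC !coefZ coefX coefXn coef0 /= !mulr0 !addr0.
have w0 : w = 0.
  have n0 : cR ^+ 2 - 7 * cR + 8 != 0.
    rewrite addrAC subr_eq0 -natrX -!natrD -natrM eqr_nat.
    have : (c >= 4)%N by lia.
    move: c => C0; have [|C7 _] := leqP C0 7; last by nia.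
    by do 8?case: C0 => [|C0] //.
  by move/eqP: K2; rewrite /k2 mulf_eq0 (negbTE n0) orbF mulf_eq0 (negbTE (expf_neq0 2 f0)) => /eqP.
have v0 : v = 0.
  have n0 : cR * (cR - 3) != 0 by rewrite mulf_neq0 ?pnatr_eq0 // subr_eq0 eqr_nat; lia.
  have : f ^+ 2 * (cR * (cR - 3)) * v = 0 by rewrite -K1 /k1 w0; ring.
  by move/eqP; rewrite mulf_eq0 (negbTE (mulf_neq0 (expf_neq0 2 f0) n0)) => /eqP.
have u0 : u = 0.
  have n0 : cR * (cR + 1) != 0 by rewrite mulf_neq0 ?natr1 ?pnatr_eq0.
  have : f ^+ 2 * (cR * (cR + 1)) * u = 0 by rewrite -K0 /k0 w0 v0; ring.
  by move/eqP; rewrite mulf_eq0 (negbTE (mulf_neq0 (expf_neq0 2 f0) n0)) => /eqP.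
apply/eqP; rewrite -subr_eq0 -/D DE u0 v0 w0; apply/eqP.
by apply: poly_all_eq => y; rewrite !hornerE /=; ring.
Qed.

End Pair.
End Necessity.

Lemma slope2_perm (R : realType) n (B : tensor R 'I_n) (p : {perm 'I_n}) q r y :
  symmetric_tensor B ->
  slope q (slope r (tev B)) (y \o p) = slope (p q) (slope (p r) (tev B)) y.
Proof. by move=> sB; rewrite {1}/slope !upd_perm !slope_perm. Qed.

Lemma polyfun_quadratic (R : realType) (J : finType) (f g : (J -> R) -> R) e0 e1 e2 :
  polyfun f -> polyfun g ->
  polyfun (fun x => e0 * g x ^+ 2 + e1 * (g x * f x) + e2 * f x ^+ 2).
Proof.
move=> pf pg; have sq h : polyfun h -> polyfun (fun x : J -> R => h x ^+ 2).
  by move=> ph; apply: polyfun_mul.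
by apply: polyfun_add; [apply: polyfun_add|]; apply: polyfun_scale;
  [exact: sq|exact: polyfun_mul|exact: sq].
Qed.

(** * Degrees and leading coefficients of the numerators *)

Section NecessityCases.
Variables (R : realType) (k : nat) (d : 'I_k -> nat) (beta : tensor R (slot d))
  (I : slot d -> set R) (a : slot d -> {poly R})
  (B C : forall i : 'I_k, tensor R 'I_(d i)).
Let L := mu_pair beta.
Local Notation c := (mdim d).+1.
Implicit Types (x : slot d -> R).
Hypothesis d_gt0 : forall i, (0 < d i)%N.
Hypothesis k2 : (2 <= k)%N.
Hypothesis oI : forall s, open_interval (I s).
Hypothesis injI : forall i y, box (gbox I i) y -> injective y.
Hypothesis hb : in_h beta.
Hypothesis L0 : forall x, box I x -> L x != 0.
Hypothesis sB : forall i, symmetric_tensor (B i).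
Hypothesis LB : forall x, L x = gfun B x.
Hypothesis sC : forall i, symmetric_tensor (C i).
Hypothesis E : forall x, box I x -> eqsum beta (fun s => horner (a s))
  (fun s => horner (deriv (a s))) (fun s => horner (deriv (deriv (a s)))) x = gfun C x.

Let maL : multiaffine L. Proof. exact: multiaffine_tev. Qed.
Let pfL : polyfun L. Proof. exact: polyfun_tev. Qed.
Let LE : L = gfun B. Proof. exact/funext. Qed.
Let S := Sset beta.

Definition a2sum (i : 'I_k) x : R :=
  \sum_(r < d i) (deriv (deriv (a (sl r)))).[x (sl r)] / gdelta r (grp i x).

Lemma kapE p x : kap a p x = \sum_(j | j != p) a2sum j x.
Proof. by []. Qed.

Lemma mdim_gt p : (d p < mdim d)%N.
Proof.
have [j jp] := other_index p k2; have := mdim_ge2 d jp; have := d_gt0 j; lia.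
Qed.

Lemma slopeL (i : 'I_k) (r : 'I_(d i)) x : slope (sl r) L x = slope r (tev (B i)) (grp i x).
Proof. by rewrite LE slope_gfun. Qed.

Lemma off_tev (i : 'I_k) y y' : i \notin S -> tev (B i) y = tev (B i) y'.
Proof.
move=> iS; apply: (@box_cst _ _ (fun=> setT)) => // u r z _ _.
apply: slope0_upd; first exact: multiaffine_tev.
by rewrite -[u]grp_emb -slopeL; apply: Sset_slope0.
Qed.

Lemma off_L (i : 'I_k) x x' : i \notin S -> (forall j, j != i -> grp j x = grp j x') ->
  L x = L x'.
Proof.
move=> iS xx'; rewrite !LB; apply: eq_bigr => j _.
by have [->|ji] := eqVneq j i; [exact: off_tev|rewrite xx'].
Qed.

(** If [L^2] were constant, one of [L - L x0] and [L + L x0] would vanish identically and [L] would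
    have no slope in any direction. *)
Lemma L_sq_neq : (exists j, j \in S) -> exists x1 x2, [/\ box I x1, box I x2 &
  L x1 ^+ 2 != L x2 ^+ 2].
Proof.
move=> [j jS]; have [x0 Ix0] := box_nonempty oI.
apply: contrapT => H.
have sq x : L x ^+ 2 = L x0 ^+ 2.
  apply/eqP; rewrite -subr_eq0; apply/eqP.
  apply: (polyfun_box0 oI (f := fun x => L x ^+ 2 - L x0 ^+ 2)) => [|{}x Ix].
    by apply: polyfun_sub; [apply: polyfun_mul|apply: polyfun_cst].
  by apply/eqP; rewrite subr_eq0; apply/negP => /negP h; apply: H; exists x, x0.
have [y ny] := Sset_slope hb (Ordinal (d_gt0 j)) jS.
have [||x|h|h] := @polyfun_mulf0 _ _ (fun x => L x - L x0) (fun x => L x + L x0).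
- by apply: polyfun_sub => //; apply: polyfun_cst.
- by apply: polyfun_add => //; apply: polyfun_cst.
- by rewrite -subr_sqr sq subrr.
- case/negP: ny; rewrite /slope -(subr0 (mu_pair beta _)) -[X in X - _ - _](subrK (L x0)).
  by rewrite h -[X in _ - X](subrK (L x0)) h !add0r subr0 subrr.
- case/negP: ny; rewrite /slope -[X in X - _](addrK (L x0)) h.
  by rewrite -[X in _ - X](addrK (L x0)) h subrr.
Qed.

Definition rest (i : 'I_k) x : R := \sum_(j | j != i) \sum_(r < d j)
  bop c (a (sl r)).[x (sl r)] (deriv (a (sl r))).[x (sl r)] (deriv (deriv (a (sl r)))).[x (sl r)]
    (L x) (slope (sl r) L x) / gdelta r (grp j x).

Definition restC (i : 'I_k) x : R := \sum_(j | j != i) tev (C j) (grp j x).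

Lemma grpE (j : 'I_k) (r : 'I_(d j)) x x' : grp j x = grp j x' -> x (sl r) = x' (sl r).
Proof. by move/(congr1 (fun f => f r)). Qed.

Lemma rest_off (i : 'I_k) x x' : i \notin S -> (forall j, j != i -> grp j x = grp j x') ->
  rest i x = rest i x'.
Proof.
move=> iS xx'; apply: eq_bigr => j ji; apply: eq_bigr => r _.
by rewrite !slopeL (off_L iS xx') (grpE r (xx' j ji)) xx'.
Qed.

Lemma restC_off (i : 'I_k) x x' : (forall j, j != i -> grp j x = grp j x') ->
  restC i x = restC i x'.
Proof. by move=> xx'; apply: eq_bigr => j ji; rewrite xx'. Qed.

Lemma E_group (i : 'I_k) x : i \notin S -> box I x ->
  L x ^+ 2 * a2sum i x + rest i x = tev (C i) (grp i x) + restC i x.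
Proof.
move=> iS Ix; have := E Ix; rewrite /eqsum /gfun (bigD1 i) //= [in RHS](bigD1 i) //= => <-.
congr (_ + _); rewrite /a2sum mulr_sumr; apply: eq_bigr => r _.
by rewrite Sset_slope0 // -/L /bop; ring.
Qed.

Lemma a2sum_grp (i : 'I_k) x x' : grp i x = grp i x' -> a2sum i x = a2sum i x'.
Proof. by move=> xx'; apply: eq_bigr => r _; rewrite (grpE r xx') xx'. Qed.

(** [L] and the terms of the other groups ignore group [i]. Subtracting the equations for two values
    of this group leaves [L^2] times the difference of the sums equal to a quantity independent of
    the other groups; since [L^2] is not constant, the difference is zero. *)
Lemma a2sum_const (i : 'I_k) x x' : i \notin S -> (exists j, j \in S) ->
  box I x -> box I x' -> a2sum i x = a2sum i x'.
Proof.
move=> iS jS Ix Ix'.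
have H u : box I u -> L u ^+ 2 * (a2sum i x - a2sum i x') = tev (C i) (grp i x) - tev (C i) (grp i x').
  move=> Iu; have off v j : j != i -> grp j (mix i u v) = grp j u by exact: grp_mixN.
  have e := E_group iS (box_mix i Iu Ix); have e' := E_group iS (box_mix i Iu Ix').
  rewrite (off_L iS (off x)) (rest_off iS (off x)) (restC_off (off x)) grp_mix
    (a2sum_grp (grp_mix i u x)) in e.
  rewrite (off_L iS (off x')) (rest_off iS (off x')) (restC_off (off x')) grp_mix
    (a2sum_grp (grp_mix i u x')) in e'.
  apply: (addIr (restC i u - rest i u)).
  transitivity (L u ^+ 2 * a2sum i x + rest i u - (L u ^+ 2 * a2sum i x' + rest i u)
     + restC i u - rest i u); first by ring.
  by rewrite e e'; ring.
have [x1 [x2 [I1 I2 n12]]] := L_sq_neq jS.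
have : (L x1 ^+ 2 - L x2 ^+ 2) * (a2sum i x - a2sum i x') = 0 by rewrite mulrBl !H // subrr.
by move/eqP; rewrite mulf_eq0 !subr_eq0 (negbTE n12) => /eqP.
Qed.

Lemma off_numerator (i : 'I_k) : i \notin S -> (exists j, j \in S) ->
  exists g : {poly R}, [/\ (size g <= d i)%N, forall r : 'I_(d i), deriv (deriv (a (sl r))) = g &
    forall x, box I x -> a2sum i x = g`_(d i).-1].
Proof.
move=> iS jS; have [x0 Ix0] := box_nonempty oI.
have [||y r Iy|g [sg fg lg]] := @uniform_numerator _ _ (gbox I i) 0
  (fun r => deriv (deriv (a (sl r)))) (fun _ _ => a2sum i x0) (d_gt0 i).
- by move=> s; apply: oI.
- exact: injI.
- exists (a2sum i x0)%:P; split; rewrite ?size_polyC_leq1 ?coefC // => z Iz.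
  have [x [Ix xE _]] := gbox_lift Ix0 (box_upd Iy Iz).
  by rewrite hornerC (a2sum_const iS jS Ix0 Ix) -xE.
have di := d_gt0 i; exists g; split; first by rewrite addn0 prednK in sg.
- by move=> r; rewrite fg.
- move=> x Ix; rewrite (a2sum_const iS jS Ix Ix0).
  by have := lg _ (Ordinal di) (gbox_grp i Ix0); rewrite addn0.
Qed.

(** With [L] constant the sum of second derivatives need not be constant, only affine in each
    variable; hence [e = 1], one degree more than in [off_numerator]. *)
Lemma constant_numerators (i : 'I_k) : S = finset.set0 -> exists g : {poly R},
  (size g <= (d i).+1)%N /\ forall r : 'I_(d i), deriv (deriv (a (sl r))) = g.
Proof.
move=> S0; have [x0 Ix0] := box_nonempty oI.
have iS : i \notin S by rewrite S0 inE.
have Lc x x' : L x = L x' by rewrite !LB; apply: eq_bigr => j _; apply: off_tev; rewrite S0 inE.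
have l0 := L0 Ix0.
have [||y r Iy|g [sg fg _]] := @uniform_numerator _ _ (gbox I i) 1
  (fun r => deriv (deriv (a (sl r))))
  (fun y r => (L x0 ^+ 2)^-1 * slope r (tev (C i)) y) (d_gt0 i).
- by move=> s; apply: oI.
- exact: injI.
- have [x [Ix xE xN]] := gbox_lift Ix0 Iy.
  exists ((L x0 ^+ 2)^-1 *: ((tev (C i) (upd y r 0) + restC i x - rest i x)%:P
    + slope r (tev (C i)) y *: 'X)); split.
  + by rewrite sizeZ_leq ?size_linear.
  + by rewrite coefZ coefD coefC coefZ coefX /= mulr1 add0r.
  move=> z Iz; have Iu := box_upd Ix (Iz : I (sl r) z).
  have off j : j != i -> grp j (upd x (sl r) z) = grp j x by move=> ji; rewrite grp_updN.
  have e := E_group iS Iu.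
  rewrite (rest_off iS off) (restC_off off) grp_upd xE (Lc _ x0) (@multiaffine_tev _ _ (C i)) in e.
  have -> : gsum (fun q y => (deriv (deriv (a (sl q)))).[y q]) (upd y r z) = a2sum i (upd x (sl r) z).
    by rewrite /a2sum /gsum grp_upd xE; apply: eq_bigr => q _; rewrite -[in RHS]/(grp i _ q) grp_upd xE.
  apply: (mulfI (expf_neq0 2 l0)); apply: (addIr (rest i x)); rewrite e hornerZ mulVKf ?expf_neq0 //.
  by rewrite !hornerE /=; ring.
by exists g; split => //; have := d_gt0 i; move: sg; rewrite addn1 prednK.
Qed.

Lemma slope_box (p : 'I_k) (r : 'I_(d p)) : p \in S ->
  exists2 x, box I x & slope (sl r) L x != 0.
Proof. by move=> pS; apply: (polyfun_box_neq0 oI (polyfun_slope _ pfL)); apply: Sset_slope. Qed.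

(** For a slope that is not identically zero: [L] is the slope along [s] times an affine function of
    [x s]. *)
Definition split_slot s := proportional (fun x => L (upd x s 0)) (slope s L).

(** Moving a slot of the other group changes the value of [L] at [x s = 0] but not the slope along
    [s]. *)
Lemma not_split_two (p j : 'I_k) (r : 'I_(d p)) : p \in S -> j \in S -> j != p ->
  ~ split_slot (sl r).
Proof.
move=> pS jS jp H; pose u := sl (Ordinal (d_gt0 j)); set s := sl r in H.
have [x nx] := polyfun_mul_neq0 (polyfun_slope s pfL) (polyfun_slope u pfL)
  (Sset_slope hb r pS) (Sset_slope hb (Ordinal (d_gt0 j)) jS).
have us : u != s by apply: contra jp => /eqP/(congr1 tag) /= ->.
have sus v : slope u (slope s L) v = 0 by apply: slope2N; rewrite // eq_sym.
have h := H x (upd x u (x u + 1)); move: h.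
rewrite (slope0_upd _ (multiaffine_slope s maL) (sus x)) (updC _ _ _ us).
rewrite (multiaffine_line _ u _ maL) updN // (slope0_upd _ (multiaffine_slope u maL)); last first.
  by rewrite slopeC.
move=> /eqP; rewrite -subr_eq0 => /eqP h; move: nx.
rewrite (_ : _ * _ = 0) ?eqxx // -[RHS]oppr0 -h; ring.
Qed.

Lemma numerator_degree (p : 'I_k) (r : 'I_(d p)) : p \in S -> ~ split_slot (sl r) ->
  (mdim d = (d p).+1 -> exists kp, forall x, box I x -> kap a p x = kp) ->
  (size (a (sl r)) <= (d p).+2)%N.
Proof.
move=> pS np hk; set s := sl r in np *.
apply: (@bpoly_degree _ (mdim d) (d p) (a s)
  (fun M N => exists2 x, box I x & M = L (upd x s 0) /\ N = slope s L x)).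
- exact: mdim_gt.
- by have [x Ix nx] := slope_box r pS; exists (L (upd x s 0)), (slope s L x); split => //; exists x.
- move=> e0 e1 e2 H; apply: (quadratic_relation (e0 := e0) (polyfun_updc s 0 pfL) (polyfun_slope s pfL) np).
    exact: Sset_slope.
  apply: (polyfun_box0 oI) => [|x Ix]; last by apply: H; exists x.
  exact: polyfun_quadratic (polyfun_updc s 0 pfL) (polyfun_slope s pfL).
- by move=> M N [x Ix [-> ->]]; have [] := line_poly oI injI hb E r Ix.
- move=> md; have [kp hkp] := hk md; exists kp => M N [x Ix [-> ->]].
  by have [_ -> _] := line_poly oI injI hb E r Ix; rewrite hkp.
Qed.

Lemma numerator_lead (p : 'I_k) (r : 'I_(d p)) x : box I x -> slope (sl r) L x != 0 ->
  (size (a (sl r)) <= (d p).+2)%N ->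
  ((mdim d)%:R - (d p)%:R) * ((mdim d)%:R + 1 - (d p)%:R) * (a (sl r))`_(d p).+1 = - kap a p x.
Proof.
move=> Ix nx sa; have [_ h _] := line_poly oI injI hb E r Ix.
apply: (mulfI (expf_neq0 2 nx)); rewrite mulrN -h coef_bpoly.
by rewrite [(a (sl r))`_(d p).+2](coef_geq sa) // [(a (sl r))`_(d p).+3](coef_geq sa) // -!natr1; ring.
Qed.

Lemma same_numerator_two (p j : 'I_k) (r q : 'I_(d p)) : p \in S -> j \in S -> j != p ->
  a (sl r) = a (sl q).
Proof.
move=> pS jS jp; have [->//|qr] := eqVneq q r.
have uN (v : 'I_(d p)) : sl (Ordinal (d_gt0 j)) != sl v.
  by apply: contra jp => /eqP/(congr1 tag) /= ->.
have sus x : slope (sl (Ordinal (d_gt0 j))) (slope (sl r) L) x = 0.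
  by apply: slope2N; rewrite // eq_sym.
exact: (same_numerator_third oI injI hb E qr (uN r) (uN q) sus
  (Sset_slope hb _ jS) (Sset_slope hb r pS)).
Qed.

(** Three situations: a nonzero mixed slope; a zero one and a third slot in the group, whose mixed
    slopes vanish by symmetry; or exactly two slots. *)
Lemma same_numerator_single (p : 'I_k) : p \in S ->
  (forall r : 'I_(d p), (size (a (sl r)) <= (d p).+2)%N) ->
  (exists kp, forall x, box I x -> kap a p x = kp) ->
  forall r q : 'I_(d p), a (sl r) = a (sl q).
Proof.
move=> pS sa [kp hk] r q; have [->//|qr] := eqVneq q r.
have mg := mdim_gt p.
have sD : (size (a (sl r) - a (sl q))%R <= (d p).+2)%N by rewrite sizeB_leq.
have [|/forallNP g0] := pselect (exists x, slope (sl q) (slope (sl r) L) x != 0).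
  by apply: (same_numerator_cross oI injI hb E qr); apply: (leq_trans sD); lia.
have {}g0 x : slope (sl q) (slope (sl r) L) x = 0 by have /negP := g0 x; rewrite negbK => /eqP.
have [u /andP[ur uq]|none] := pickP [pred u : 'I_(d p) | (u != r) && (u != q)].
  have slopeP : slope (sl r) L = fun x => slope r (tev (B p)) (grp p x).
    by apply/funext => v; rewrite slopeL.
  have sus x : slope (sl u) (slope (sl r) L) x = 0.
    rewrite slopeP slope_grp.
    have -> : grp p x = (grp p x \o tperm q u) \o tperm q u.
      by apply/funext => v /=; rewrite tpermK.
    rewrite slope2_perm // tpermR (tpermD qr ur).
    have := g0 (emb (grp p x \o tperm q u)).
    by rewrite slopeP slope_grp grp_emb.
  have ur' : sl u != sl r by rewrite sl_eq.
  have uq' : sl u != sl q by rewrite sl_eq.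
  exact: (same_numerator_third oI injI hb E qr ur' uq' sus (Sset_slope hb u pS) (Sset_slope hb r pS)).
have dp : (d p = 2)%N.
  have n0 : #|predC (pred2 r q)| = 0%N.
    by apply: eq_card0 => v; have := none v; rewrite !inE negb_or.
  by have := cardC (pred2 r q); rewrite card_ord card2 eq_sym qr n0.
apply: (same_numerator_linear oI injI hb E qr) => //; first by lia.
- apply/leq_sizeP => i; rewrite leq_eqVlt => /predU1P[<-|i3]; last first.
    by apply: (coef_geq sD); rewrite dp.
  have [x Ix nx] := slope_box r pS; have [x' Ix' nx'] := slope_box q pS.
  have e := numerator_lead Ix nx (sa r); have e' := numerator_lead Ix' nx' (sa q).
  rewrite hk // in e; rewrite hk // -e dp in e'; rewrite coefB; apply/eqP; rewrite subr_eq0 eq_sym.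
  have m3 : ((mdim d)%:R - 2) * ((mdim d)%:R + 1 - 2) != 0 :> R.
    have -> : (mdim d)%:R + 1 - 2 = (mdim d)%:R - 1%:R :> R by ring.
    by rewrite mulf_neq0 // natr_neq //; lia.
  by apply/eqP/(mulfI m3).
- exact: Sset_slope.
Qed.

Lemma single_L (p : 'I_k) x x' : S = [set p]%SET -> grp p x = grp p x' -> L x = L x'.
Proof.
move=> Sp xx'; rewrite !LB; apply: eq_bigr => j _.
have [jp|jp] := eqVneq j p; first by subst j; rewrite xx'.
by apply: off_tev; rewrite Sp inE.
Qed.

(** [L] vanishes when [x_r = - rho], hence by symmetry when any coordinate of the group is [- rho].
    On the grid with nodes [- rho] and [1 - rho] both multi-affine sides then agree, [t] being the
    value at the only remaining point. *)
Lemma split_product (p : 'I_k) (r : 'I_(d p)) : S = [set p]%SET -> split_slot (sl r) ->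
  exists t rho, t != 0 /\ forall x, L x = t * \prod_(q < d p) (rho + x (sl q)).
Proof.
move=> Sp H; have pS : p \in S by rewrite Sp inE.
have [x0 nx0] := Sset_slope hb r pS; set s := sl r in H nx0.
pose rho := L (upd x0 s 0) / slope s L x0.
have Lr x : L x = slope s L x * (rho + x s).
  have Mx : L (upd x s 0) = rho * slope s L x.
    by apply: (mulIf nx0); rewrite (H x x0) /rho; field.
  by rewrite -[in LHS](upd_id x s) maL Mx; ring.
pose P y := L (emb (y : 'I_(d p) -> R)).
have LP x : L x = P (grp p x) by apply: (single_L Sp); rewrite grp_emb.
have pP (pi : {perm 'I_(d p)}) y : P (y \o pi) = P y.
  rewrite /P !LB /gfun (bigD1 p) //= [in RHS](bigD1 p) //= !grp_emb.
  congr (_ + _); first exact: ((symmetric_tensorP _).1 (@sB p)).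
  by apply: eq_bigr => j jp; apply: off_tev; rewrite Sp inE.
have P_upd y q z : P (upd y q z) = L (upd (emb y) (sl q) z) by rewrite LP grp_upd grp_emb.
have mP : multiaffine P by move=> y q z; rewrite P_upd maL -P_upd /slope -!P_upd.
have P0 y q : y q = - rho -> P y = 0.
  move=> yq; rewrite -(pP (tperm q r)) {1}/P Lr.
  have -> : emb (y \o tperm q r) s = y q.
    by rewrite -[LHS]/(grp p _ r) grp_emb /= tpermR.
  by rewrite yq subrr mulr0.
pose t := P (fun=> 1 - rho); pose U : tensor R 'I_(d p) := t *: ptensor (fun=> (rho, 1)).
have UE y : tev U y = t * \prod_(q < d p) (rho + y q).
  by rewrite tevZ tev_ptensor; congr (_ * _); apply: eq_bigr => q _ /=; rewrite mulr1.
have PU y : P y = tev U y.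
  apply: (@box_ind _ _ (fun=> setT) (fun=> [set z | z = - rho \/ z = 1 - rho])
    (fun y => P y = tev U y)) => // {}y.
    move=> Zy; have [[q yq]|none] := pselect (exists q, y q = - rho).
      by rewrite (P0 y q yq) UE (bigD1 q) //= yq subrr mul0r mulr0.
    have yE : y = fun=> 1 - rho.
      by apply/funext => q; case: (Zy q) => // yq; case: none; exists q.
    by rewrite UE yE big1 ?mulr1 // => q _; rewrite addrCA subrr addr0.
  move=> q _ hZ; have := hZ (- rho) (or_introl erefl); have := hZ (1 - rho) (or_intror erefl).
  have mU := @multiaffine_tev _ _ U.
  rewrite !(multiaffine_line y q _ mP) !(multiaffine_line y q _ mU) => e1 e0.
  have es : slope q P y = slope q (tev U) y.
    apply/eqP; rewrite -subr_eq0; apply/eqP.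
    transitivity (P y + (1 - rho - y q) * slope q P y - (P y + (- rho - y q) * slope q P y)
      - (tev U y + (1 - rho - y q) * slope q (tev U) y
      - (tev U y + (- rho - y q) * slope q (tev U) y))); first by ring.
    by rewrite e1 e0; ring.
  by move: e0; rewrite es => /addIr.
have LU x : L x = t * \prod_(q < d p) (rho + x (sl q)) by rewrite LP PU UE.
exists t, rho; split => //; have [x Ix] := box_nonempty oI.
by apply: contra (L0 Ix) => /eqP t0; rewrite LU t0 mul0r.
Qed.

(** [L] and its slope along [r] share the factor [N r x], whose square comes out of the operator.
    What remains is independent of [x], so degree and residue conditions concern
    [bpoly c (a (sl r)) rho 1] directly. *)
Lemma product_numerator (p : 'I_k) t rho : t != 0 ->
  (forall x, L x = t * \prod_(q < d p) (rho + x (sl q))) ->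
  exists Y : {poly R}, [/\ (size Y <= (d p).+2)%N,
    forall r : 'I_(d p), bpoly c (a (sl r)) rho 1 = Y &
    forall x, box I x -> Y`_(d p).+1 = - kap a p x].
Proof.
move=> t0 LU; pose N (r : 'I_(d p)) x := t * \prod_(q < d p | q != r) (rho + x (sl q)).
have Lupd r x z : L (upd x (sl r) z) = N r x * (rho + z).
  rewrite LU (bigD1 r) //= updE /N -mulrA [X in _ * X]mulrC; congr (_ * (_ * _)).
  by apply: eq_bigr => q qr; rewrite updN ?sl_eq.
have NE r x : slope (sl r) L x = N r x by rewrite /slope !Lupd; ring.
have N0 r x : box I x -> N r x != 0.
  move=> /L0; rewrite -[x in L x](upd_id x (sl r)) Lupd; apply: contra => /eqP ->.
  by rewrite mul0r.
have scale (b : {poly R}) u : bpoly c b (u * rho) u = u ^+ 2 *: bpoly c b rho 1.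
  by apply: poly_all_eq => y; rewrite hornerZ !horner_bpoly /bop; ring.
have ME r x : L (upd x (sl r) 0) = N r x * rho by rewrite Lupd addr0.
have [x0 Ix0] := box_nonempty oI.
have H (r : 'I_(d p)) x : box I x -> (size (bpoly c (a (sl r)) rho 1) <= (d p).+2)%N /\
    (bpoly c (a (sl r)) rho 1)`_(d p).+1 = - kap a p x.
  move=> Ix; have [] := line_poly oI injI hb E r Ix.
  rewrite -/L ME NE scale => h1 h2 _; have n2 := expf_neq0 2 (N0 r x Ix).
  split; first by rewrite size_scale // in h1.
  by apply: (mulfI n2); rewrite mulrN -h2 coefZ.
have same (r q : 'I_(d p)) : bpoly c (a (sl r)) rho 1 = bpoly c (a (sl q)) rho 1.
  have [->//|qr] := eqVneq q r; apply: (poly_interval_eq (oI (sl q))) => z Iz.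
  have [_ _ /(_ q qr)] := line_poly oI injI hb E r (box_upd Ix0 Iz).
  rewrite -/L updE Lupd NE => h; have n2 := expf_neq0 2 (N0 r _ (box_upd Ix0 Iz)).
  apply/eqP; rewrite -subr_eq0 !horner_bpoly -bopB; apply/eqP; apply: (mulfI n2).
  by rewrite mulr0 -h !derivB !hornerD !hornerN /bop; ring.
pose r0 := Ordinal (d_gt0 p); exists (bpoly c (a (sl r0)) rho 1); split.
- by have [] := H r0 x0 Ix0.
- by move=> r; apply: same.
- by move=> x Ix; have [] := H r0 x Ix.
Qed.

(** Here [m = d p + 1], and [kap] is a function of the only variable [x t] of group [j]. Fixing
    [x t = y0] makes it constant; the point is to find a [y0] for which [L] at [x s = 0] and the
    slope along [s] stay non-proportional. *)
Lemma numerator_degree_pair (p j : 'I_k) (r : 'I_(d p)) : j != p ->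
  (forall i, i = p \/ i = j) -> d j = 1%N -> (1 < d p)%N -> p \in S -> j \in S ->
  (size (a (sl r)) <= (d p).+2)%N.
Proof.
move=> jp pj dj dp pS jS; pose t := sl (Ordinal (d_gt0 j)); set s := sl r.
have ts : t != s by apply: contra jp => /eqP/(congr1 tag) /= ->.
have tst x : slope t (slope s L) x = 0 by apply: slope2N; rewrite // eq_sym.
have stt x : slope s (slope t L) x = 0 by rewrite slopeC.
have Nt x y : slope s L (upd x t y) = slope s L x.
  by apply: slope0_upd; first exact: multiaffine_slope.
have Tnz := Sset_slope hb (Ordinal (d_gt0 j)) jS; have Nnz := Sset_slope hb r pS.
have [y0 [Iy0 np]] : exists y0, I t y0 /\
    ~ proportional (fun x => L (upd (upd x t y0) s 0)) (fun x => slope s L (upd x t y0)).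
  apply: contrapT => H.
  have Hy y x x' : I t y -> L (upd (upd x t y) s 0) * slope s L x' =
      L (upd (upd x' t y) s 0) * slope s L x.
    move=> Iy; have pr : proportional (fun x => L (upd (upd x t y) s 0))
        (fun x => slope s L (upd x t y)) by apply: contrapT => h; apply: H; exists y.
    by have := pr x x'; rewrite !Nt.
  pose M x := L (upd (upd x t 0) s 0).
  (* If every [y0] failed, then [M] and the slope along [t], the two coefficients in [y], would both
     be proportional to the slope along [s]. *)
  have MT x x' : M x * slope s L x' = M x' * slope s L x /\
      slope t L x * slope s L x' = slope t L x' * slope s L x.
    pose f := (M x * slope s L x' - M x' * slope s L x)%:P +
      (slope t L x * slope s L x' - slope t L x' * slope s L x) *: 'X.
    have Lty u y : L (upd (upd u t y) s 0) = M u + y * slope t L u.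
      rewrite (updC _ _ _ ts) maL (slope0_upd _ (multiaffine_slope t maL)); last exact: stt.
      by rewrite /M (updC _ _ _ ts).
    have f0 : f = 0.
      apply: (poly_interval0 (oI t)) => y Iy; have := Hy y x x' Iy; rewrite !Lty => e.
      transitivity ((M x + y * slope t L x) * slope s L x' - (M x' + y * slope t L x') * slope s L x).
        by rewrite !hornerE /=; ring.
      by rewrite e subrr.
    split; apply/eqP; rewrite -subr_eq0; apply/eqP.
      by have := congr1 (fun P : {poly R} => P`_0) f0; rewrite coefD coefC coefZ coefX coef0 /= mulr0 addr0.
    by have := congr1 (fun P : {poly R} => P`_1) f0; rewrite coefD coefC coefZ coefX coef0 /= mulr1 add0r.
  have [q qr] : exists q : 'I_(d p), q != r.
    have : (0 < #|predC1 r|)%N by rewrite cardC1 card_ord; lia.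
    by case/card_gt0P => q qr; exists q.
  pose u := sl q; have us : u != s by rewrite sl_eq.
  have ut : u != t by apply: contra jp => /eqP/(congr1 tag) /= ->.
  have uT x : slope u (slope t L) x = 0 by apply: slope2N.
  (* A second slot [u] of group [p] does not enter the slope along [t], hence not the slope along
     [s] either; yet it changes [M], which contradicts proportionality. *)
  have uN x : slope u (slope s L) x = 0.
    apply: (@polyfun_cancel _ _ _ (slope t L)) => // [||{}x].
    - exact/polyfun_slope/polyfun_slope.
    - exact: polyfun_slope.
    have [_ e] := MT x (upd x u (x u + 1)).
    rewrite (slope0_upd _ (multiaffine_slope t maL) (uT x)) in e.
    rewrite (multiaffine_line _ u _ (multiaffine_slope s maL)) in e.
    by move/eqP: e; rewrite -subr_eq0 => /eqP e; rewrite -[RHS]e; ring.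
  have [x nx] := polyfun_mul_neq0 (polyfun_slope u pfL) (polyfun_slope s pfL)
    (Sset_slope hb q pS) Nnz.
  have [e _] := MT x (upd x u (x u + 1)); move: e.
  rewrite (slope0_upd _ (multiaffine_slope s maL) (uN x)) /M.
  rewrite (updC _ _ _ ut) (updC _ _ _ us) (multiaffine_line _ u _ maL).
  rewrite !updN // (slope0_upd _ (multiaffine_slope u maL)); last by rewrite slopeC uN.
  rewrite (slope0_upd _ (multiaffine_slope u maL)); last by rewrite slopeC uT.
  move=> /eqP; rewrite -subr_eq0 => /eqP e; move: nx.
  rewrite (_ : _ * _ = 0) ?eqxx // -[RHS]oppr0 -e; ring.
have [x1 Ix1 nx1] := slope_box r pS.
apply: (@bpoly_degree _ (mdim d) (d p) (a s)
  (fun M N => exists x, [/\ box I x, x t = y0, M = L (upd x s 0) & N = slope s L x])).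
- exact: mdim_gt.
- exists (L (upd (upd x1 t y0) s 0)), (slope s L x1); split => //.
  by exists (upd x1 t y0); split; rewrite ?updE ?Nt //; apply: box_upd.
- move=> e0 e1 e2 H; apply: (quadratic_relation (e0 := e0) _ _ np).
  + exact: (polyfun_updc t y0 (polyfun_updc s 0 pfL)).
  + exact: (polyfun_updc t y0 (polyfun_slope s pfL)).
  + by have [x nx] := Nnz; exists x; rewrite Nt.
  apply: (polyfun_box0 oI) => [|x Ix].
    exact: polyfun_quadratic (polyfun_updc t y0 (polyfun_updc s 0 pfL))
      (polyfun_updc t y0 (polyfun_slope s pfL)).
  by apply: H; exists (upd x t y0); split; rewrite ?updE //; apply: box_upd.
- by move=> M N [x [Ix _ -> ->]]; have [] := line_poly oI injI hb E r Ix.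
- move=> _; exists (kap a p (upd x1 t y0)) => M N [x [Ix xt -> ->]].
  have [_ -> _] := line_poly oI injI hb E r Ix; congr (- (_ * _)).
  rewrite !kapE; apply: eq_bigr => i ip; case: (pj i) => ii; first by rewrite ii eqxx in ip.
  subst i; apply: a2sum_grp; apply/funext => q.
  have -> : q = Ordinal (d_gt0 j) by apply/val_inj; have := ltn_ord q; rewrite /=; lia.
  by rewrite /grp -/t xt updE.
Qed.

Lemma interval_neq (s : slot d) y : exists2 z, I s z & z != y.
Proof.
apply: contrapT => H.
have /eqP : 'X - y%:P = 0 :> {poly R}; last by rewrite polyXsubC_eq0.
apply: (poly_interval0 (oI s)) => z Iz; rewrite hornerXsubC; apply/eqP.
by rewrite subr_eq0; apply/negP => /negP zy; apply: H; exists z.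
Qed.

Lemma sum_mix (W : 'I_k -> (slot d -> R) -> R) (p : 'I_k) x x' :
  (forall i u v, grp i u = grp i v -> W i u = W i v) ->
  \sum_i W i (mix p x x') = \sum_i W i x + (W p x' - W p x).
Proof.
move=> HW; rewrite (bigD1 p) //= [in RHS](bigD1 p) //= (HW p _ x') ?grp_mix //.
rewrite (eq_bigr (fun i => W i x)); first by ring.
by move=> i ip; apply: HW; rewrite grp_mixN.
Qed.

(* Comparing the equation at the four points obtained by moving the groups [p] and
   [j] independently isolates the coefficient of the product [P_p P_j], which
   must vanish because an element of h has no mixed terms. *)
Lemma mixed_relation (p j : 'I_k) (Y : 'I_k -> {poly R}) (kp : 'I_k -> R) :
  p \in S -> j \in S -> j != p ->
  (forall i, i \in S -> (size (Y i) <= (d i).+2)%N) ->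
  (forall i, i \in S -> forall r : 'I_(d i), a (sl r) = Y i) ->
  (forall i x, i \notin S -> box I x -> a2sum i x = kp i) ->
  \sum_i (if i \in S then (d i)%:R * ((d i)%:R + 1) * (Y i)`_(d i).+1 else kp i) =
  c%:R * (((d p)%:R + 1) * (Y p)`_(d p).+1 + ((d j)%:R + 1) * (Y j)`_(d j).+1).
Proof.
move=> pS jS jp sY aY hk.
pose G i := if i \in S then (d i)%:R * ((d i)%:R + 1) * (Y i)`_(d i).+1 else kp i.
pose v i := if i \in S then ((d i)%:R + 1) * (Y i)`_(d i).+1 else 0.
(* Normal form of one group: the coefficients of [L^2] and of [L] times [tev (B i)] are explicit,
   and [kW.2] collects what depends on this group alone. *)
have /choice[kW hW] : forall i, exists kW : R * ((slot d -> R) -> R),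
    (forall u w, grp i u = grp i w -> kW.2 u = kW.2 w) /\
    forall x, box I x -> \sum_(r < d i)
      bop c (a (sl r)).[x (sl r)] (deriv (a (sl r))).[x (sl r)] (deriv (deriv (a (sl r)))).[x (sl r)]
      (L x) (slope (sl r) L x) / gdelta r (grp i x) =
    G i * L x ^+ 2 - 2 * c%:R * (v i * tev (B i) (grp i x)) * L x + 2 * kW.1 * L x + kW.2 x.
  move=> i; rewrite /G /v; have [iS|iS] := boolP (i \in S); last first.
    exists (0, fun=> 0); split => // x Ix /=; rewrite -(hk i x iS Ix) /a2sum.
    rewrite [RHS](_ : _ = L x ^+ 2 * a2sum i x); last by rewrite /a2sum; ring.
    rewrite /a2sum mulr_sumr; apply: eq_bigr => r _.
    by rewrite Sset_slope0 // -/L /bop; ring.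
  have [kk [B' [sB' hB']]] := group_term (fun s => oI (sl s)) (@injI i) c (@sB i) (d_gt0 i) (sY i iS).
  exists (kk, fun x => (Y i)`_(d i).+1 * (c%:R * (c%:R + 1) * tev (B i) (grp i x) ^+ 2)
    - 2 * kk * tev (B i) (grp i x) + tev B' (grp i x)); split => [u w uw|x Ix] /=; first by rewrite uw.
  have Q : tev (B i) (grp i x) + (L x - tev (B i) (grp i x)) = L x by rewrite addrC subrK.
  have := hB' (grp i x) (L x - tev (B i) (grp i x)) (gbox_grp i Ix); rewrite Q => e.
  rewrite (eq_bigr (fun r => bop c (Y i).[grp i x r] (deriv (Y i)).[grp i x r]
    (deriv (deriv (Y i))).[grp i x r] (L x) (slope r (tev (B i)) (grp i x)) / gdelta r (grp i x))).
    by rewrite e; ring.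
  by move=> r _; rewrite aY // slopeL.
pose s := sl (Ordinal (d_gt0 p)); pose t := sl (Ordinal (d_gt0 j)).
have [x Ix nx] := polyfun_box_neq0 oI (polyfun_mul (polyfun_slope s pfL) (polyfun_slope t pfL))
  (polyfun_mul_neq0 (polyfun_slope s pfL) (polyfun_slope t pfL)
    (Sset_slope hb (Ordinal (d_gt0 p)) pS) (Sset_slope hb (Ordinal (d_gt0 j)) jS)).
have [zs Izs nzs] := interval_neq s (x s); have [zt Izt nzt] := interval_neq t (x t).
pose x' := upd (upd x s zs) t zt.
have Ix' : box I x' by apply: box_upd => //; apply: box_upd.
pose P i (u : slot d -> R) := tev (B i) (grp i u).
have Pd : P p x' - P p x = (zs - x s) * slope s L x.
  rewrite /P /x' grp_updN 1?eq_sym // grp_upd (multiaffine_line _ _ _ (@multiaffine_tev _ _ (B p))).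
  by rewrite slopeL; rewrite addrAC subrr add0r.
have Pe : P j x' - P j x = (zt - x t) * slope t L x.
  rewrite /P /x' grp_upd grp_updN // (multiaffine_line _ _ _ (@multiaffine_tev _ _ (B j))).
  by rewrite slopeL; rewrite addrAC subrr add0r.
set dl := P p x' - P p x in Pd; set ep := P j x' - P j x in Pe.
have dlep : dl * ep != 0.
  move: nx; rewrite mulf_eq0 negb_or => /andP[n1 n2].
  by rewrite Pd Pe !mulf_neq0 // subr_eq0.
pose V u := \sum_i v i * P i u; pose W u := \sum_i (kW i).2 u.
pose D u := gfun C u - W u; pose K := \sum_i (kW i).1; pose Gm := \sum_i G i.
have EQ u : box I u -> Gm * L u ^+ 2 - 2 * c%:R * V u * L u + 2 * K * L u = D u.
  move=> Iu; rewrite /D -(E Iu) /eqsum -/L (eq_bigr _ (fun i _ => (hW i).2 u Iu)).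
  have -> : \sum_i (G i * L u ^+ 2 - 2 * c%:R * (v i * tev (B i) (grp i u)) * L u
      + 2 * (kW i).1 * L u + (kW i).2 u) =
      Gm * L u ^+ 2 - 2 * c%:R * V u * L u + 2 * K * L u + W u.
    by rewrite 3!big_split /= sumrN -!mulr_suml -!mulr_sumr.
  by rewrite addrK.
have dep (F : 'I_k -> (slot d -> R) -> R) :
    (forall i u w, grp i u = grp i w -> F i u = F i w) ->
    [/\ \sum_i F i (mix p x x') = \sum_i F i x + (F p x' - F p x),
        \sum_i F i (mix j x x') = \sum_i F i x + (F j x' - F j x) &
        \sum_i F i (mix j (mix p x x') x') =
          \sum_i F i x + (F p x' - F p x) + (F j x' - F j x)].
  move=> HF; split; [exact: sum_mix|exact: sum_mix|].
  by rewrite sum_mix // (HF j (mix p x x') x) ?sum_mix // grp_mixN.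
have PHF i u w : grp i u = grp i w -> P i u = P i w by rewrite /P => ->.
have LP u : L u = \sum_i P i u by exact: LB.
have [L1 L2 L3] := dep P PHF; rewrite -!LP -/dl -/ep in L1 L2 L3.
have vPHF i u w : grp i u = grp i w -> v i * P i u = v i * P i w by move=> uw; rewrite (PHF i u w uw).
have [V1 V2 V3] := dep (fun i u => v i * P i u) vPHF.
have DHF i u w : grp i u = grp i w ->
    tev (C i) (grp i u) - (kW i).2 u = tev (C i) (grp i w) - (kW i).2 w.
  by move=> uw; rewrite uw ((hW i).1 u w uw).
have [D1 D2 D3] := dep (fun i u => tev (C i) (grp i u) - (kW i).2 u) DHF.
have DE u : D u = \sum_i (tev (C i) (grp i u) - (kW i).2 u) by rewrite /D /gfun /W sumrB.
have VE u : \sum_i v i * P i u = V u by [].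
rewrite -!DE in D1 D2 D3; rewrite !VE in V1 V2 V3.
have I1 := box_mix p Ix Ix'; have I2 := box_mix j Ix Ix'; have I3 := box_mix j I1 Ix'.
have e0 := EQ x Ix; have e1 := EQ _ I1; have e2 := EQ _ I2; have e3 := EQ _ I3.
rewrite L1 V1 D1 in e1; rewrite L2 V2 D2 in e2; rewrite L3 V3 D3 in e3.
have vpE : v p * P p x' - v p * P p x = v p * dl by rewrite /dl; ring.
have vjE : v j * P j x' - v j * P j x = v j * ep by rewrite /ep; ring.
rewrite vpE in e1 e3; rewrite vjE in e2 e3.
have vE i : i \in S -> v i = ((d i)%:R + 1) * (Y i)`_(d i).+1 by rewrite /v => ->.
rewrite -!vE // -/Gm; apply: (mulfI dlep); apply: (@mulfI _ 2); first by rewrite pnatr_eq0.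
apply/eqP; rewrite -subr_eq0; apply/eqP.
set TD := D x in e0 e1 e2 e3.
set dD1 := tev (C p) _ - _ - (_ - _) in e1 e3; set dD2 := tev (C j) _ - _ - (_ - _) in e2 e3.
(* The mixed second difference of [D] is zero because [D] is a sum of functions of one group each;
   that of [L^2] is [2 dl ep], and that of [V L] is [(v p + v j) dl ep]. *)
transitivity ((TD + dD1 + dD2) - (TD + dD1) - (TD + dD2) + TD); last by ring.
by rewrite -e3 -e1 -e2 -e0; ring.
Qed.

End NecessityCases.

(** * Sufficient conditions *)

Lemma dep_choice (K : Type) (T : K -> Type) (P : forall i, T i -> Prop) :
  (forall i, exists u, P i u) -> exists f : forall i, T i, forall i, P i (f i).
Proof. by move=> H; exists (fun i => projT1 (cid (H i))) => i; apply: (projT2 (cid (H i))). Qed.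

Lemma derivs2_on_unique (R : realType) (I : set R) (f f1 f2 g g1 g2 : R -> R) :
  open_interval I -> (forall y, I y -> f y = g y) ->
  derivs2_on I f f1 f2 -> derivs2_on I g g1 g2 -> forall y, I y -> f2 y = g2 y.
Proof.
move=> oI fg df dg.
have fg1 y : I y -> f1 y = g1 y.
  move=> Iy; have [df1 _] := df y Iy; have [[_ <-] _] := dg y Iy.
  by have [_ <-] := is_derive_eq_on oI Iy fg df1.
move=> y Iy; have [_ df2] := df y Iy; have [_ [_ <-]] := dg y Iy.
by have [_ <-] := is_derive_eq_on oI Iy fg1 df2.
Qed.

Section Sufficiency.
Variables (R : realType) (k : nat) (d : 'I_k -> nat) (beta : tensor R (slot d))
  (I : slot d -> set R) (A : slot d -> R -> R) (B : forall i : 'I_k, tensor R 'I_(d i)).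
Let L := mu_pair beta.
Local Notation c := (mdim d).+1.
Implicit Types (x : slot d -> R).
Hypothesis d_gt0 : forall i, (0 < d i)%N.
Hypothesis oI : forall s, open_interval (I s).
Hypothesis sA : forall s, smooth_on (I s) (A s).
Hypothesis L0 : forall x, box I x -> L x != 0.
Hypothesis injI : forall i y, box (gbox I i) y -> injective y.
Hypothesis hb : in_h beta.
Hypothesis sB : forall i, symmetric_tensor (B i).
Hypothesis LB : forall x, L x = gfun B x.
Let S := Sset beta.
Let A1 s := derive1 (A s).
Let A2 s := derive1n 2 (A s).
Let dA s : derivs2_on (I s) (A s) (A1 s) (A2 s). Proof. exact: smooth_derivs2. Qed.

Lemma extremal_gfun (T : forall i : 'I_k, tensor R 'I_(d i)) :
  (forall i, symmetric_tensor (T i)) ->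
  (forall x, box I x -> eqsum beta A A1 A2 x = gfun T x) -> extremal beta I A.
Proof.
move=> sT E; apply/(extremalE oI L0 (@dA)); have [al [hal alE]] := gfun_in_h sT.
by exists al; split => // x Ix; rewrite alE E.
Qed.

Lemma slopeLB (i : 'I_k) (r : 'I_(d i)) x : slope (sl r) L x = slope r (tev (B i)) (grp i x).
Proof. by rewrite (_ : L = gfun B) ?slope_gfun //; apply/funext. Qed.

Lemma A_poly (s : slot d) (a : {poly R}) : (forall y, I s y -> A s y = a.[y]) ->
  forall y, I s y -> A1 s y = (deriv a).[y] /\ A2 s y = (deriv (deriv a)).[y].
Proof.
move=> Aa y Iy; have dp := @derivs2_on_poly R (I s) a.
split; last exact: (derivs2_on_unique (oI s) Aa (@dA s) dp Iy).
have [d1 _] := @dA s y Iy; have [_ <-] := is_derive_eq_on (oI s) Iy Aa d1.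
by have [[_ <-] _] := dp y Iy.
Qed.

Lemma A_second (s : slot d) (f : R -> R) : (exists G, antiderivative2 (I s) f G /\
  forall y, I s y -> A s y = G y) -> forall y, I s y -> A2 s y = f y.
Proof.
move=> [G [/antiderivative2_derivs2 dG AG]].
exact: (derivs2_on_unique (oI s) AG (@dA s) dG).
Qed.

Definition group_sum (i : 'I_k) x : R := \sum_(r < d i)
  bop c (A (sl r) (x (sl r))) (A1 (sl r) (x (sl r))) (A2 (sl r) (x (sl r)))
    (L x) (slope (sl r) L x) / gdelta r (grp i x).

Lemma off_group (i : 'I_k) (Y : {poly R}) x : i \notin S -> (size Y <= d i)%N ->
  (forall (r : 'I_(d i)) y, I (sl r) y -> A2 (sl r) y = Y.[y]) -> box I x ->
  group_sum i x = L x ^+ 2 * Y`_(d i).-1.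
Proof.
move=> iS sY AY Ix; rewrite -(gsum_horner_top (d_gt0 i) sY (injI (gbox_grp i Ix))) mulr_sumr.
apply: eq_bigr => r _; rewrite Sset_slope0 // -/L AY; last exact: Ix.
by rewrite /bop -[x (sl r)]/(grp i x r); ring.
Qed.

Lemma sufficient_const t (Y : 'I_k -> {poly R}) (nu0 nu1 : slot d -> R) :
  (forall x, L x = t) -> (forall p, (size (Y p) <= (d p + 2).+1)%N) ->
  (forall p (q : 'I_(d p)) y, I (sl q) y ->
     A (sl q) y = (Y p).[y] + nu0 (sl q) + nu1 (sl q) * y) -> extremal beta I A.
Proof.
move=> Lt sY AY.
have /dep_choice[T hT] : forall i, exists T : tensor R 'I_(d i), symmetric_tensor T /\
    forall y, box (gbox I i) y -> gsum (fun q y => (deriv (deriv (Y i))).[y q]) y = tev T y.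
  move=> i; have sf : (size (deriv (deriv (Y i))) <= ((d i).-1 + 1).+1)%N.
    rewrite addn1 prednK //; apply/leq_sizeP => j nj; rewrite coef_deriv2 (coef_geq (sY i)) ?mulr0 //; lia.
  have [T sT TE] := gsum_symmetric1 (fun s => oI (sl s)) (@injI i) (numerators_horner sf).
  by exists T.
apply: (@extremal_gfun (fun i => t ^+ 2 *: T i)) => [i|x Ix]; first by apply: symmetricZ; case: (hT i).
apply: eq_bigr => i _; have [_ hT'] := hT i; rewrite tevZ -hT'; last exact: gbox_grp.
rewrite /gsum mulr_sumr; apply: eq_bigr => r _.
have AY' y : I (sl r) y -> A (sl r) y = (Y i + ((nu0 (sl r))%:P + nu1 (sl r) *: 'X)).[y].
  by move=> Iy; rewrite AY // !hornerE /=; ring.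
have [_ ->] := A_poly AY' (Ix (sl r)).
have -> : slope (sl r) (mu_pair beta) x = 0 by rewrite /slope -/L !Lt subrr.
have -> : deriv (deriv (Y i + ((nu0 (sl r))%:P + nu1 (sl r) *: 'X))) = deriv (deriv (Y i)).
  by rewrite !derivD !derivC derivZ derivX derivZ -[1]/(1%:P) derivC scaler0 !addr0.
by rewrite -/L Lt /bop; ring.
Qed.

(** By [gsum_symmetric2] group [p] contributes the top coefficient of [Y p] over [b^2], times [L^2],
    plus a symmetric tensor; every other group contributes its top coefficient times [L^2]. The
    relation cancels all the squares. *)
Lemma sufficient_product (p : 'I_k) t a b (Y : 'I_k -> {poly R}) :
  b != 0 -> (forall i, i != p -> i \notin S) -> (forall x, L x = t * \prod_(q < d p) (a + b * x (sl q))) ->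
  (size (Y p) <= (d p).+2)%N -> (forall i, i != p -> (size (Y i) <= d i)%N) ->
  (forall q : 'I_(d p), exists G, antiderivative2 (I (sl q))
      (fun y => (Y p).[y] / (a + b * y) ^+ (mdim d + 3)) G /\
    forall y, I (sl q) y -> A (sl q) y = (a + b * y) ^+ (mdim d + 1) * G y) ->
  (forall i (r : 'I_(d i)), i != p -> exists G, antiderivative2 (I (sl r)) (fun y => (Y i).[y]) G /\
    forall y, I (sl r) y -> A (sl r) y = G y) ->
  (Y p)`_(d p).+1 / b ^+ 2 + \sum_(i | i != p) (Y i)`_(d i).-1 = 0 ->
  extremal beta I A.
Proof.
move=> b0 Sp LU sYp sYi AYp AYi rel.
pose N (r : 'I_(d p)) x := t * \prod_(q < d p | q != r) (a + b * x (sl q)).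
have Lupd r x z : L (upd x (sl r) z) = N r x * (a + b * z).
  rewrite LU (bigD1 r) //= updE /N -mulrA [X in _ * X]mulrC; congr (_ * (_ * _)).
  by apply: eq_bigr => q qr; rewrite updN ?sl_eq.
have LN r x : L x = N r x * (a + b * x (sl r)) by rewrite -Lupd upd_id.
have NE r x : slope (sl r) L x = N r x * b by rewrite /slope !Lupd; ring.
have [x0 Ix0] := box_nonempty oI.
have l0 (r : 'I_(d p)) y : I (sl r) y -> a + b * y != 0.
  move=> Iy; have := L0 (box_upd Ix0 Iy); rewrite Lupd.
  by apply: contra => /eqP ->; rewrite mulr0.
have bopY (r : 'I_(d p)) y : I (sl r) y ->
    bop c (A (sl r) y) (A1 (sl r) y) (A2 (sl r) y) (a + b * y) b = (Y p).[y].
  move=> Iy; have [G [/antiderivative2_derivs2 dG AG]] := AYp r.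
  have dV := derivs2_on_div c (@l0 r) (@dA (sl r)).
  have VG u : I (sl r) u -> A (sl r) u / (a + b * u) ^+ c = G u.
    by move=> Iu; rewrite AG // addn1 mulrC mulKf // expf_neq0 // (l0 r).
  have := derivs2_on_unique (oI (sl r)) VG dV dG Iy; rewrite addn3.
  by move/(divIf (expf_neq0 _ (l0 r y Iy))).
pose U : tensor R 'I_(d p) := t *: ptensor (fun=> (a, b)).
have UE y : tev U y = t * \prod_(q < d p) (a + b * y q).
  by rewrite tevZ tev_ptensor; congr (_ * _); apply: eq_bigr => q _ /=; rewrite mulrC.
have sU : symmetric_tensor U.
  apply/symmetric_tensorP => pi y; rewrite !UE; congr (_ * _).
  by rewrite [RHS](reindex_inj (@perm_inj _ pi)).
have slopeU r y : slope r (tev U) y = b * (t * \prod_(q < d p | q != r) (a + b * y q)).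
  rewrite /slope !UE !(bigD1 (P := predT) r) //= !updE.
  rewrite (eq_bigr (fun q => a + b * y q)); last by move=> q qr; rewrite updN.
  rewrite [X in _ - t * (_ * X)](eq_bigr (fun q => a + b * y q)); last by move=> q qr; rewrite updN.
  by ring.
have lE r y : (Y p)`_(d p).+1 * (t * \prod_(q < d p | q != r) (a + b * y q)) ^+ 2 =
    (Y p)`_(d p).+1 / b ^+ 2 * slope r (tev U) y ^+ 2 by rewrite slopeU; field.
have [B' sB' hB'] := gsum_symmetric2 (fun s => oI (sl s)) (@injI p) sU (numerators_prod t a b sYp) lE.
have /dep_choice[T hT] : forall i, exists T : tensor R 'I_(d i), symmetric_tensor T /\
    forall x, tev T (grp i x) = if i == p then tev B' (grp p x) else 0.
  move=> i; have [->|ip] := eqVneq i p; first by exists B'.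
  by exists (const_tensor _ 0); split; [exact: symmetric_const|move=> x; rewrite tev_const].
apply: (@extremal_gfun T) => [i|x Ix]; first by case: (hT i).
transitivity (\sum_i group_sum i x); first by [].
rewrite /gfun (eq_bigr _ (fun i _ => (hT i).2 x)) (bigD1 p) //= [in RHS](bigD1 p) //= eqxx.
rewrite [in RHS]big1 ?addr0; last by move=> i /negbTE ->.
have -> : group_sum p x = gsum (prod_num t a b (Y p)) (grp p x).
  apply: eq_bigr => r _; congr (_ / _).
  rewrite /prod_num -[grp p x r]/(x (sl r)) -(bopY r _ (Ix _)) -[t * _]/(N r x).
  by rewrite (LN r) -/L NE /bop; ring.
rewrite hB'; last exact: gbox_grp.
have -> : tev U (grp p x) = L x by rewrite UE LU.
rewrite (eq_bigr (fun i => L x ^+ 2 * (Y i)`_(d i).-1)); last first.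
  move=> i ip; apply: off_group => // [||r y Iy]; first exact: Sp.
    exact: sYi.
  by apply: A_second Iy; apply: AYi.
by rewrite -mulr_sumr addrAC (mulrC _ (L x ^+ 2)) -mulrDr rel mulr0 add0r.
Qed.

(** Modulo h, a group of S contributes a quadratic form in [L] and its own part of [L], any other
    group a multiple of [L^2]; it suffices that these add up to an affine function of [L]. *)
Lemma sufficient_poly (Y : 'I_k -> {poly R}) e0 e1 :
  (forall i, i \in S -> (size (Y i) <= (d i).+2)%N) ->
  (forall i, i \in S -> forall (r : 'I_(d i)) y, I (sl r) y -> A (sl r) y = (Y i).[y]) ->
  (forall i, i \notin S -> (size (Y i) <= d i)%N) ->
  (forall i, i \notin S -> forall (r : 'I_(d i)) y, I (sl r) y -> A2 (sl r) y = (Y i).[y]) ->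
  (forall x, box I x ->
    \sum_(i in S) (Y i)`_(d i).+1 * ((d i)%:R * ((d i)%:R + 1) * L x ^+ 2
      - 2 * c%:R * ((d i)%:R + 1) * L x * tev (B i) (grp i x)
      + c%:R * (c%:R + 1) * tev (B i) (grp i x) ^+ 2)
    + L x ^+ 2 * \sum_(i | i \notin S) (Y i)`_(d i).-1 = e1 * L x + e0) ->
  (0 < k)%N -> extremal beta I A.
Proof.
move=> sY AY sY' AY' rel k0.
have /dep_choice[T hT] : forall i, exists T : R * tensor R 'I_(d i), symmetric_tensor T.2 /\
    forall x, box I x -> group_sum i x = 2 * T.1 * (L x - tev (B i) (grp i x)) + tev T.2 (grp i x) +
     if i \in S then (Y i)`_(d i).+1 * ((d i)%:R * ((d i)%:R + 1) * L x ^+ 2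
      - 2 * c%:R * ((d i)%:R + 1) * L x * tev (B i) (grp i x)
      + c%:R * (c%:R + 1) * tev (B i) (grp i x) ^+ 2) else L x ^+ 2 * (Y i)`_(d i).-1.
  move=> i; have [iS|iS] := boolP (i \in S); last first.
    exists (0, const_tensor _ 0); split; first exact: symmetric_const.
    move=> x Ix; rewrite tev_const mulr0 mul0r !add0r; apply: off_group => //; first exact: sY'.
    exact: AY'.
  have [kk [B' [sB' hB']]] := group_term (fun s => oI (sl s)) (@injI i) c (@sB i) (d_gt0 i) (sY i iS).
  exists (kk, B'); split => // x Ix /=.
  have Q : tev (B i) (grp i x) + (L x - tev (B i) (grp i x)) = L x by rewrite addrC subrK.
  have := hB' (grp i x) (L x - tev (B i) (grp i x)) (gbox_grp i Ix); rewrite Q => e.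
  rewrite /group_sum (eq_bigr (fun r => bop c (Y i).[grp i x r] (deriv (Y i)).[grp i x r]
    (deriv (deriv (Y i))).[grp i x r] (L x) (slope r (tev (B i)) (grp i x)) / gdelta r (grp i x))).
    by rewrite e; ring.
  move=> r _; have [-> ->] := A_poly (AY i iS r) (Ix (sl r)).
  by rewrite AY ?slopeLB //; apply: Ix.
pose K := \sum_i (T i).1.
have kn : (k%:R : R) != 0 by rewrite pnatr_eq0; lia.
(* The constant [e0] is shared equally by the [k] groups, as [gfun] has no separate constant
   term. *)
apply: (@extremal_gfun (fun i => (e1 + 2 * K) *: B i + ((- (2 * (T i).1)) *: B i + (T i).2)
   + const_tensor _ (e0 / k%:R))) => [i|x Ix].
  apply: symmetricD; last exact: symmetric_const.
  by do 2!(apply: symmetricD; first exact: symmetricZ); case: (hT i).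
transitivity (\sum_i group_sum i x); first by [].
rewrite (eq_bigr _ (fun i _ => (hT i).2 x Ix)) big_split /=.
have -> : \sum_i (if i \in S then (Y i)`_(d i).+1 * ((d i)%:R * ((d i)%:R + 1) * L x ^+ 2
      - 2 * c%:R * ((d i)%:R + 1) * L x * tev (B i) (grp i x)
      + c%:R * (c%:R + 1) * tev (B i) (grp i x) ^+ 2) else L x ^+ 2 * (Y i)`_(d i).-1) =
   e1 * L x + e0.
  rewrite -rel // (bigID (mem S)) /= mulr_sumr; congr (_ + _); apply: eq_bigr => i.
    by move=> ->.
  by move=> /negbTE ->.
rewrite /gfun; under [RHS]eq_bigr do rewrite !tevD tevZ tevZ tev_const.
rewrite !big_split /=.
have -> : \sum_(i < k) e0 / k%:R = e0.
  by rewrite sumr_const card_ord -[LHS]mulr_natl mulrC divfK.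
have -> : \sum_i (e1 + 2 * K) * tev (B i) (grp i x) = (e1 + 2 * K) * L x.
  by rewrite -mulr_sumr LB.
have -> : \sum_i 2 * (T i).1 * (L x - tev (B i) (grp i x)) =
    2 * K * L x + \sum_i - (2 * (T i).1) * tev (B i) (grp i x).
  rewrite /K; move: (L x) => l; rewrite mulr_sumr mulr_suml -big_split /=; apply: eq_bigr => i _; ring.
by ring.
Qed.

(** Up to a constant [K] the part of group [p] is all of [L], so its form is a polynomial in [L].
    With [n = d p], the factor at [L^2] is [n (n + 1) - 2 c (n + 1) + c (c + 1) = (m - n) (m + 1 -
    n)], which the relation cancels. *)
Lemma sufficient_single (p : 'I_k) (Y : 'I_k -> {poly R}) : S = [set p]%SET ->
  (forall i, i \in S -> (size (Y i) <= (d i).+2)%N) ->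
  (forall i, i \in S -> forall (r : 'I_(d i)) y, I (sl r) y -> A (sl r) y = (Y i).[y]) ->
  (forall i, i \notin S -> (size (Y i) <= d i)%N) ->
  (forall i, i \notin S -> forall (r : 'I_(d i)) y, I (sl r) y -> A2 (sl r) y = (Y i).[y]) ->
  ((mdim d)%:R - (d p)%:R) * ((mdim d)%:R + 1 - (d p)%:R) * (Y p)`_(d p).+1
    + \sum_(i | i \notin S) (Y i)`_(d i).-1 = 0 -> extremal beta I A.
Proof.
move=> Sp sY AY sY' AY' rel; have k0 : (0 < k)%N by apply: leq_trans (ltn_ord p).
pose K := \sum_(i | i != p) tev (B i) (fun=> 0).
have LP x : tev (B p) (grp p x) = L x - K.
  rewrite LB /gfun (bigD1 p) //= -addrA [X in _ + X](_ : _ = 0) ?addr0 //.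
  apply/eqP; rewrite subr_eq0; apply/eqP; apply: eq_bigr => i ip.
  apply: (@box_cst _ _ (fun=> setT)) => // u r z _ _.
  apply: slope0_upd; first exact: multiaffine_tev.
  by rewrite -[u]grp_emb -slopeLB; apply: Sset_slope0; rewrite // -/S Sp inE.
set gm := (Y p)`_(d p).+1 in rel; pose n : R := (d p)%:R.
apply: (@sufficient_poly Y (gm * (c%:R * (c%:R + 1) * K ^+ 2))
  (gm * (2 * c%:R * (n + 1) * K - 2 * c%:R * (c%:R + 1) * K))) => // x Ix.
rewrite Sp big_set1 LP -Sp -/gm -/n -(natr1 (mdim d)).
have := rel; rewrite -/n; set kp := \sum_(i | i \notin S) _ => /eqP; rewrite addrC addr_eq0 => /eqP ->.
by ring.
Qed.

(** For [m = d p + d j], with [L] the sum of the two parts, the quadratic forms of the two groups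
    are identical, so opposite leading coefficients cancel them. *)
Lemma sufficient_pair (p j : 'I_k) (Y : 'I_k -> {poly R}) : j != p ->
  (forall i, i = p \/ i = j) -> p \in S -> j \in S -> (mdim d = d p + d j)%N ->
  (forall i, (size (Y i) <= (d i).+2)%N) ->
  (forall i (r : 'I_(d i)) y, I (sl r) y -> A (sl r) y = (Y i).[y]) ->
  (Y p)`_(d p).+1 + (Y j)`_(d j).+1 = 0 -> extremal beta I A.
Proof.
move=> jp pj pS jS md sY AY rel; have k0 : (0 < k)%N by apply: leq_trans (ltn_ord p).
have allS i : i \in S by case: (pj i) => ->.
have sum2 (F : 'I_k -> R) : \sum_i F i = F p + F j.
  rewrite (bigD1 p) //= (bigD1 j) //= big1 ?addr0 // => i /andP[ip ij].
  by case: (pj i) ip ij => ->; rewrite eqxx.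
apply: (@sufficient_poly Y 0 0) => [i _|i _|i|i|x Ix|];
  [exact: sY|exact: AY|by rewrite allS|by rewrite allS| |exact: k0].
rewrite [X in _ + _ * X]big1 ?mulr0 ?addr0; last by move=> i; rewrite allS.
rewrite (eq_bigl predT) // sum2 LB /gfun sum2.
move/eqP: rel; rewrite addrC addr_eq0 => /eqP ->.
by rewrite -(natr1 (mdim d)) md natrD; ring.
Qed.

Lemma sufficient_low_degree (Y : 'I_k -> {poly R}) : (0 < k)%N ->
  (forall i, i \in S -> (size (Y i) <= (d i).+1)%N) ->
  (forall i, i \in S -> forall (r : 'I_(d i)) y, I (sl r) y -> A (sl r) y = (Y i).[y]) ->
  (forall i, i \notin S -> (size (Y i) <= d i)%N) ->
  (forall i, i \notin S -> forall (r : 'I_(d i)) y, I (sl r) y -> A2 (sl r) y = (Y i).[y]) ->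
  \sum_(i | i \notin S) (Y i)`_(d i).-1 = 0 -> extremal beta I A.
Proof.
move=> k0 sY AY sY' AY' rel; apply: (@sufficient_poly Y 0 0) => // [i iS|x Ix].
  exact: leqW (sY i iS).
rewrite rel mulr0 mul0r !addr0 big1 // => i iS.
by rewrite (coef_geq (sY i iS)) // mul0r.
Qed.

End Sufficiency.

(** * The cases of the theorem *)

Lemma box_injective (R : realType) k (d : 'I_k -> nat) (I : slot d -> set R) :
  (forall s, open_interval (I s)) ->
  (forall x, box I x -> forall i (r : 'I_(d i)), Delta r x != 0) ->
  forall i y, box (gbox I i) y -> injective y.
Proof.
move=> oI D0 i y Iy q r yqr; have [x0 Ix0] := box_nonempty oI.
have [x [Ix xE _]] := gbox_lift Ix0 Iy; apply/eqP/negP => /negP qr.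
have := D0 x Ix i q; rewrite /Delta (bigD1 r) 1?eq_sym //=.
have -> : x (sl q) = x (sl r) by rewrite -[LHS]/(grp i x q) -[RHS]/(grp i x r) xE.
by rewrite subrr mul0r eqxx.
Qed.

Lemma partial_slope (R : realType) (J : finType) s (f : (J -> R) -> R) x :
  multiaffine f -> partial s f x = slope s f x.
Proof.
move=> mf; rewrite /partial.
have -> : (fun y => f (upd x s y)) = horner ((f (upd x s 0))%:P + slope s f x *: 'X).
  by apply/funext => y; rewrite mf !hornerE /=; ring.
rewrite derive1E; have [_ ->] := is_derive_poly ((f (upd x s 0))%:P + slope s f x *: 'X) (x s).
by rewrite derivD derivC derivZ derivX !hornerE.
Qed.

(** Two points at which the values at [x s = 0] and the slopes have nonzero determinant give, for
    every [z], a regular linear system for [a.[z]] and [b.[z]]. *)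
Lemma not_split_indep (R : realType) k (d : 'I_k -> nat) (beta : tensor R (slot d)) s :
  ~ split_slot beta s -> indep_with_partial s (mu_pair beta).
Proof.
move=> ns a b H; set L := mu_pair beta in H ns.
have maL : multiaffine L by apply: multiaffine_tev.
have [x1 [x2 n12]] : exists x1 x2, L (upd x1 s 0) * slope s L x2 - L (upd x2 s 0) * slope s L x1 != 0.
  apply: contrapT => h; apply: ns => x1 x2; apply/eqP; rewrite -subr_eq0.
  by apply: contrapT => /negP h'; apply: h; exists x1, x2.
have Hz x z : a.[z] * (L (upd x s 0) + z * slope s L x) + b.[z] * slope s L x = 0.
  by have := H (upd x s z); rewrite updE partial_slope // slope_upd maL.
have a0 z : a.[z] = 0.
  apply: (mulIf n12); rewrite mul0r.
  transitivity ((a.[z] * (L (upd x1 s 0) + z * slope s L x1) + b.[z] * slope s L x1) * slope s L x2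
    - (a.[z] * (L (upd x2 s 0) + z * slope s L x2) + b.[z] * slope s L x2) * slope s L x1); first by ring.
  by rewrite !Hz; ring.
have b0 z : b.[z] = 0.
  have h1 := Hz x1 z; have h2 := Hz x2 z; rewrite a0 mul0r add0r in h1; rewrite a0 mul0r add0r in h2.
  apply: (mulIf n12); rewrite mul0r.
  transitivity (L (upd x1 s 0) * (b.[z] * slope s L x2) - L (upd x2 s 0) * (b.[z] * slope s L x1)).
    by ring.
  by rewrite h1 h2; ring.
by split; apply: poly_all_eq => z; rewrite horner0.
Qed.

Lemma ord_eq1 n (q r : 'I_n) : n = 1%N -> q = r.
Proof. by move=> n1; subst n; rewrite !ord1. Qed.

Lemma mdim_pair k (d : 'I_k -> nat) p j : j != p -> (forall i, i = p \/ i = j) ->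
  (mdim d = d p + d j)%N.
Proof.
move=> jp pj; rewrite /mdim (bigD1 p) //= (bigD1 j) //= big1 ?addn0 // => i /andP[ip ij].
by case: (pj i) ip ij => ->; rewrite eqxx.
Qed.

Lemma mdim_gt_pair k (d : 'I_k -> nat) p j i : (forall i, 0 < d i)%N ->
  j != p -> i != p -> i != j -> (d p + d j < mdim d)%N.
Proof.
move=> d0 jp ip ij; rewrite /mdim (bigD1 p) //= (bigD1 j) //= (bigD1 i) ?ip //=.
by have := d0 i; lia.
Qed.

Lemma ord_eq2_cases n (p j : 'I_n) : n = 2%N -> j != p -> forall i, i = p \/ i = j.
Proof.
move=> n2; subst n => jp i; have [->|ip] := eqVneq i p; [by left|right].
apply/val_inj; move: jp ip; rewrite -!val_eqE /=.
by case: i j p => [[|[|i]] hi] [[|[|j]] hj] [[|[|p]] hp].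
Qed.

Lemma ord_pair_eq2 n (p j : 'I_n) : j != p -> (forall i, i = p \/ i = j) -> n = 2%N.
Proof.
move=> jp pj; have : #|'I_n| = #|pred2 p j|.
  by apply: eq_card => i; rewrite !inE; case: (pj i) => ->; rewrite eqxx ?orbT.
by rewrite card_ord card2 eq_sym jp.
Qed.

Lemma mdim_succ_structure k (d : 'I_k -> nat) p : (forall i, 0 < d i)%N -> (2 <= k)%N ->
  mdim d = (d p).+1 -> exists j, structure_d1 d p j.
Proof.
move=> d0 k2 md; have [j jp] := other_index p k2; exists j.
have pj i : i = p \/ i = j.
  have [->|ip] := eqVneq i p; [by left|]; have [->|ij] := eqVneq i j; [by right|].
  by have := mdim_gt_pair d0 jp ip ij; have := d0 j; rewrite md; lia.
have dj : d j = 1%N by have := mdim_pair d jp pj; rewrite md; lia.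
by split; rewrite // 1?eq_sym //; exact: ord_pair_eq2 jp pj.
Qed.

Lemma set1_or_other (T : finType) (S : {set T}) p : p \in S ->
  S = [set p]%SET \/ exists2 j, j \in S & j != p.
Proof.
move=> pS; have [->|nS] := eqVneq S [set p]%SET; [by left|right].
apply: contrapT => h; move/eqP: nS; apply; apply/setP => j; rewrite [RHS]inE.
have [->|jp] := eqVneq j p; first by [].
by apply/negbTE/negP => jS; apply: h; exists j.
Qed.

Section Conclusion.
Variables (R : realType) (k : nat) (d : 'I_k -> nat) (beta : tensor R (slot d))
  (I : slot d -> set R) (a : slot d -> {poly R})
  (B C : forall i : 'I_k, tensor R 'I_(d i)).
Let L := mu_pair beta.
Local Notation c := (mdim d).+1.
Implicit Types (x : slot d -> R).
Hypothesis d_gt0 : forall i, (0 < d i)%N.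
Hypothesis k2 : (2 <= k)%N.
Hypothesis oI : forall s, open_interval (I s).
Hypothesis injI : forall i y, box (gbox I i) y -> injective y.
Hypothesis hb : in_h beta.
Hypothesis L0 : forall x, box I x -> L x != 0.
Hypothesis sB : forall i, symmetric_tensor (B i).
Hypothesis LB : forall x, L x = gfun B x.
Hypothesis E : forall x, box I x -> eqsum beta (fun s => horner (a s))
  (fun s => horner (deriv (a s))) (fun s => horner (deriv (deriv (a s)))) x = gfun C x.
Let S := Sset beta.

Lemma single_split (p : 'I_k) (r : 'I_(d p)) : S = [set p]%SET -> d p = 1%N ->
  split_slot beta (sl r).
Proof.
move=> Sp dp x x'; have grpr u : grp p (upd u (sl r) 0) = fun=> 0.
  apply/funext => q; have -> : q = r by apply: ord_eq1.
  by rewrite /grp updE.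
have e0 : L (upd x (sl r) 0) = L (upd x' (sl r) 0).
  by apply: (single_L hb LB Sp); rewrite !grpr.
have e1 : L (upd x (sl r) 1) = L (upd x' (sl r) 1).
  apply: (single_L hb LB Sp); apply/funext => q; have -> : q = r by apply: ord_eq1.
  by rewrite /grp !updE.
by rewrite /slope -/L e0 e1.
Qed.

(** [Y i] plays two roles, as in the classification: the common numerator for [i] in S, the common
    second derivative otherwise. In the first role too the sum of second derivatives is a top
    coefficient, by [gsum_horner_top]. *)
Lemma numerator_family : (exists j, j \in S) ->
  (forall p, p \in S -> forall r q : 'I_(d p), a (sl r) = a (sl q)) ->
  (forall p, p \in S -> forall r : 'I_(d p), (size (a (sl r)) <= (d p).+2)%N) ->
  exists Y : 'I_k -> {poly R},
  [/\ forall i, i \in S -> (size (Y i) <= (d i).+2)%N,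
      forall i, i \in S -> forall r : 'I_(d i), a (sl r) = Y i,
      forall i, i \notin S -> (size (Y i) <= d i)%N,
      forall i, i \notin S -> forall r : 'I_(d i), deriv (deriv (a (sl r))) = Y i &
      forall i x, box I x -> a2sum a i x =
        if i \in S then (d i)%:R * ((d i)%:R + 1) * (Y i)`_(d i).+1 else (Y i)`_(d i).-1].
Proof.
move=> jS aS sS; have /choice[Y hY] : forall i, exists g : {poly R},
    (i \in S -> (size g <= (d i).+2)%N /\ forall r : 'I_(d i), a (sl r) = g) /\
    (i \notin S -> [/\ (size g <= d i)%N, forall r : 'I_(d i), deriv (deriv (a (sl r))) = g &
     forall x, box I x -> a2sum a i x = g`_(d i).-1]).
  move=> i; have [iS|iS] := boolP (i \in S).
    by exists (a (sl (Ordinal (d_gt0 i)))); split => // _; split; [apply: sS|move=> r; apply: aS].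
  by have [g hg] := off_numerator d_gt0 oI injI hb LB E iS jS; exists g.
exists Y; split.
- by move=> i iS; case: ((hY i).1 iS).
- by move=> i iS; case: ((hY i).1 iS).
- by move=> i iS; case: ((hY i).2 iS).
- by move=> i iS; case: ((hY i).2 iS).
move=> i x Ix; have [iS|iS] := boolP (i \in S); last by have [_ _ ->] := (hY i).2 iS.
have [sY aY] := (hY i).1 iS.
have s2 : (size (deriv (deriv (Y i))) <= d i)%N.
  by apply/leq_sizeP => j nj; rewrite coef_deriv2 (coef_geq sY) ?mulr0.
have := gsum_horner_top (d_gt0 i) s2 (injI (gbox_grp i Ix)).
rewrite coef_deriv2 prednK // => e; rewrite /a2sum (eq_bigr (fun r =>
  (deriv (deriv (Y i))).[grp i x r] / gdelta r (grp i x))); last by move=> r _; rewrite aY.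
rewrite [LHS]e; have -> : (d i).-1%:R = (d i)%:R - 1 :> R by rewrite -[in RHS](prednK (d_gt0 i)) -natr1 addrK.
by ring.
Qed.

Lemma lead_relation (p : 'I_k) (Y : 'I_k -> {poly R}) : p \in S ->
  (forall i, i \in S -> (size (Y i) <= (d i).+2)%N) ->
  (forall i, i \in S -> forall r : 'I_(d i), a (sl r) = Y i) ->
  (forall i x, box I x -> a2sum a i x =
     if i \in S then (d i)%:R * ((d i)%:R + 1) * (Y i)`_(d i).+1 else (Y i)`_(d i).-1) ->
  ((mdim d)%:R - (d p)%:R) * ((mdim d)%:R + 1 - (d p)%:R) * (Y p)`_(d p).+1 +
  \sum_(i | i != p) (if i \in S then (d i)%:R * ((d i)%:R + 1) * (Y i)`_(d i).+1
    else (Y i)`_(d i).-1) = 0.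
Proof.
move=> pS sY aY hk; pose r := Ordinal (d_gt0 p); have [x Ix nx] := slope_box oI hb r pS.
have := numerator_lead oI injI hb E Ix nx; rewrite aY // => /(_ (sY p pS)) ->.
rewrite kapE; apply/eqP; rewrite addrC subr_eq0; apply/eqP.
by apply: eq_bigr => i ip; rewrite hk.
Qed.

(* The two linear relations for each pair of groups of S force the leading
   coefficients to vanish: their determinant is positive as [m > d_p + d_j]. *)
Lemma low_degree (p j : 'I_k) (Y : 'I_k -> {poly R}) : p \in S -> j \in S -> j != p ->
  (d p + d j < mdim d)%N ->
  (forall i, i \in S -> (size (Y i) <= (d i).+2)%N) ->
  (forall i, i \in S -> forall r : 'I_(d i), a (sl r) = Y i) ->
  (forall i x, box I x -> a2sum a i x =
     if i \in S then (d i)%:R * ((d i)%:R + 1) * (Y i)`_(d i).+1 else (Y i)`_(d i).-1) ->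
  (Y p)`_(d p).+1 = 0.
Proof.
move=> pS jS jp md sY aY hk.
pose w (i : 'I_k) : R := if i \in S then (d i)%:R * ((d i)%:R + 1) * (Y i)`_(d i).+1
  else (Y i)`_(d i).-1.
have mx : \sum_i w i =
    c%:R * (((d p)%:R + 1) * (Y p)`_(d p).+1 + ((d j)%:R + 1) * (Y j)`_(d j).+1).
  apply: (mixed_relation d_gt0 oI injI hb sB LB E pS jS jp sY aY) => i x iS Ix.
  by rewrite hk // (negbTE iS).
have lead i : i \in S -> ((mdim d)%:R - (d i)%:R) * ((mdim d)%:R + 1 - (d i)%:R) * (Y i)`_(d i).+1
    + (\sum_i w i - (d i)%:R * ((d i)%:R + 1) * (Y i)`_(d i).+1) = 0.
  move=> iS; rewrite -[RHS](lead_relation iS sY aY hk) ; congr (_ + _).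
  by rewrite (bigD1 i) //= [w i]/w iS addrAC subrr add0r.
have rp := lead p pS; have rj := lead j jS; rewrite mx in rp rj.
set u := (Y p)`_(d p).+1 in rp rj *; set v := (Y j)`_(d j).+1 in rp rj.
pose m : R := (mdim d)%:R; pose n : R := (d p)%:R; pose l : R := (d j)%:R.
have c0 : (c%:R : R) != 0 by rewrite pnatr_eq0.
have cE : c%:R = m + 1 :> R by rewrite -natr1.
(* Once the mixed relation is inserted, the coefficient of [u] is [(m + 1) (m + 1 - n)], so
   [c = m + 1] divides out. *)
have r1 : (m + 1 - n) * u + (l + 1) * v = 0.
  by apply: (mulfI c0); rewrite mulr0 -rp cE -/m -/n -/l; ring.
have r2 : (n + 1) * u + (m + 1 - l) * v = 0.
  by apply: (mulfI c0); rewrite mulr0 -rj cE -/m -/n -/l; ring.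
(* At [m = d p + d j] this determinant is zero, which is why a structure of two groups keeps a free
   leading coefficient. *)
have det : (m + 1 - n) * (m + 1 - l) - (l + 1) * (n + 1) != 0.
  have h : n + l + 1 <= m by rewrite -natrD natr1 ler_nat.
  have n0 : 0 <= n by []; have l0 : 0 <= l by [].
  by rewrite lt0r_neq0 //; nra.
apply: (mulfI det); rewrite mulr0.
transitivity ((m + 1 - l) * ((m + 1 - n) * u + (l + 1) * v) - (l + 1) * ((n + 1) * u + (m + 1 - l) * v)).
  by ring.
by rewrite r1 r2; ring.
Qed.

End Conclusion.

Section Numerators.
Variables (R : realType) (k : nat) (d : 'I_k -> nat) (beta : tensor R (slot d))
  (I : slot d -> set R) (a : slot d -> {poly R})
  (B C : forall i : 'I_k, tensor R 'I_(d i)).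
Let L := mu_pair beta.
Implicit Types (x : slot d -> R).
Hypothesis d_gt0 : forall i, (0 < d i)%N.
Hypothesis k2 : (2 <= k)%N.
Hypothesis not_Segre : ~ (forall i, d i = 1%N).
Hypothesis oI : forall s, open_interval (I s).
Hypothesis injI : forall i y, box (gbox I i) y -> injective y.
Hypothesis hb : in_h beta.
Hypothesis L0 : forall x, box I x -> L x != 0.
Hypothesis sB : forall i, symmetric_tensor (B i).
Hypothesis LB : forall x, L x = gfun B x.
Hypothesis E : forall x, box I x -> eqsum beta (fun s => horner (a s))
  (fun s => horner (deriv (a s))) (fun s => horner (deriv (deriv (a s)))) x = gfun C x.
Let S := Sset beta.

Lemma kap_const p : S = [set p]%SET -> exists kp : R, forall x, box I x -> kap a p x = kp.
Proof.
move=> Sp; have [x0 Ix0] := box_nonempty oI; exists (kap a p x0) => x Ix.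
rewrite !kapE; apply: eq_bigr => i ip; apply: (a2sum_const d_gt0 oI hb LB E) => //.
  by rewrite -/S Sp inE.
by exists p; rewrite -/S Sp inE.
Qed.

Lemma structure_cases i1 i2 : structure_d1 d i1 i2 ->
  [/\ forall i, i = i1 \/ i = i2, mdim d = (d i1).+1 & (1 < d i1)%N].
Proof.
case=> k2' i12 d2; have ic : forall i, i = i1 \/ i = i2.
  by apply: ord_eq2_cases; rewrite // eq_sym.
have md : mdim d = (d i1).+1 by rewrite (@mdim_pair _ d i1 i2) 1?eq_sym // d2 addn1.
split=> //; rewrite ltn_neqAle d_gt0 andbT; apply/eqP => d1; apply: not_Segre => i.
by case: (ic i) => ->.
Qed.

(** For the degree bound, [numerator_degree] asks that [kap] be constant only if [m = d p + 1]. That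
    holds when S is [{p}]; otherwise there are two groups, the second with one slot, and
    [numerator_degree_pair] takes over. *)
Lemma nonsplit_numerators : (exists j, j \in S) ->
  (forall p (r : 'I_(d p)), p \in S -> ~ split_slot beta (sl r)) ->
  exists Y : 'I_k -> {poly R},
  [/\ forall i, i \in S -> (size (Y i) <= (d i).+2)%N,
      forall i, i \in S -> forall r : 'I_(d i), a (sl r) = Y i,
      forall i, i \notin S -> (size (Y i) <= d i)%N,
      forall i, i \notin S -> forall r : 'I_(d i), deriv (deriv (a (sl r))) = Y i &
      forall i x, box I x -> a2sum a i x =
        if i \in S then (d i)%:R * ((d i)%:R + 1) * (Y i)`_(d i).+1 else (Y i)`_(d i).-1].
Proof.
move=> jS ns; have sz p : p \in S -> forall r : 'I_(d p), (size (a (sl r)) <= (d p).+2)%N.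
  move=> pS r; have [Sp|[j jS' jp]] := set1_or_other pS.
    by apply: (numerator_degree d_gt0 k2 oI injI hb E pS (ns p r pS)) => _; apply: kap_const.
  have [md|md] := eqVneq (mdim d) (d p).+1; last first.
    by apply: (numerator_degree d_gt0 k2 oI injI hb E pS (ns p r pS)) => e; rewrite e eqxx in md.
  have [j' st] := mdim_succ_structure d_gt0 k2 md; have [pj _ dp] := structure_cases st.
  have jj : j = j' by case: (pj j) jp => // ->; rewrite eqxx.
  by subst j'; have [_ _ dj] := st; exact: (numerator_degree_pair d_gt0 k2 oI injI hb E r jp).
apply: (numerator_family d_gt0 oI injI hb LB E) => // p pS r q.
have [Sp|[j jS' jp]] := set1_or_other pS.
  by apply: (same_numerator_single d_gt0 k2 oI injI hb sB LB E pS (sz p pS)); apply: kap_const.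
exact: (same_numerator_two d_gt0 oI injI hb E r q pS jS' jp).
Qed.

End Numerators.

(** * Necessity, case by case *)

Section NecessaryForms.
Variables (R : realType) (k : nat) (d : 'I_k -> nat) (beta : tensor R (slot d))
  (I : slot d -> set R) (A : slot d -> R -> R) (a : slot d -> {poly R})
  (B C : forall i : 'I_k, tensor R 'I_(d i)).
Let L := mu_pair beta.
Hypothesis d_gt0 : forall i, (0 < d i)%N.
Hypothesis k2 : (2 <= k)%N.
Hypothesis not_Segre : ~ (forall i, d i = 1%N).
Hypothesis oI : forall s, open_interval (I s).
Hypothesis injI : forall i y, box (gbox I i) y -> injective y.
Hypothesis hb : in_h beta.
Hypothesis L0 : forall x, box I x -> L x != 0.
Hypothesis sB : forall i, symmetric_tensor (B i).
Hypothesis LB : forall x, L x = gfun B x.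
Hypothesis sA : forall s, smooth_on (I s) (A s).
Hypothesis Aa : forall s y, I s y -> A s y = (a s).[y].
Hypothesis E : forall x, box I x -> eqsum beta (fun s => horner (a s))
  (fun s => horner (deriv (a s))) (fun s => horner (deriv (deriv (a s)))) x = gfun C x.
Let S := Sset beta.

Let A2a s y : I s y -> derive1n 2 (A s) y = (deriv (deriv (a s))).[y].
Proof. by move=> Isy; have [_] := A_poly oI (@sA) (@Aa s) Isy. Qed.

Lemma antiderivative_numerator s (f : {poly R}) : deriv (deriv (a s)) = f -> exists G : R -> R,
  antiderivative2 (I s) (fun x => f.[x]) G /\ forall x, I s x -> A s x = G x.
Proof.
move=> <-; exists (A s); split=> [|x Ix]; last by [].
apply/antiderivative2_derivs2 => y Iy; have [d1 d2] := smooth_derivs2 (@sA s) Iy.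
by split; [exact: d1|rewrite -A2a].
Qed.

Lemma necessary_const : S = finset.set0 -> exists t : R,
  [/\ t != 0, beta = t *: ptensor (fun _ => (1, 0)) &
      exists (Y : 'I_k -> {poly R}) (nu0 nu1 : slot d -> R),
        (forall p, (size (Y p) <= (d p + 2).+1)%N) /\
        (forall p (q : 'I_(d p)) x, I (sl q) x ->
           A (sl q) x = (Y p).[x] + nu0 (sl q) + nu1 (sl q) * x)].
Proof.
move=> S0; have [x0 Ix0] := box_nonempty oI.
have Lc x : L x = L x0.
  by rewrite !LB; apply: eq_bigr => i _; apply: (off_tev hb LB); rewrite -/S S0 inE.
exists (L x0); split; first exact: L0.
  by apply: mu_pair_inj => x; rewrite -/L Lc [RHS](tev_const (L x0) x).
pose a0 i := a (sl (Ordinal (d_gt0 i))).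
have D2 i (q : 'I_(d i)) : (size (a (sl q) - a0 i)%R <= 2)%N.
  have [g [_ hg]] := constant_numerators d_gt0 oI injI hb L0 LB E i S0.
  by apply: (@size_deriv2 _ _ 0); rewrite !derivB !hg subrr size_poly0.
(* The numerator of the first slot serves as the common polynomial; equal second derivatives leave
   affine differences. *)
exists a0, (fun s => (a s - a0 (tag s))`_0), (fun s => (a s - a0 (tag s))`_1); split.
  move=> i; have [g [sg hg]] := constant_numerators d_gt0 oI injI hb L0 LB E i S0.
  by rewrite addn2; apply: size_deriv2; rewrite hg.
move=> i q x Ix; have e : (a (sl q) - a0 i).[x] = (a (sl q) - a0 i)`_0 + (a (sl q) - a0 i)`_1 * x.
  by rewrite {1}(size_leq2E (D2 i q)) !hornerE.
by rewrite Aa //= -addrA -e hornerD hornerN addrCA subrr addr0.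
Qed.

Lemma necessary_product p (r : 'I_(d p)) : S = [set p]%SET -> split_slot beta (sl r) ->
  exists t a b : R, [/\ t != 0, b != 0, beta = ins10 (t *: tpow (d p) (a, b)) &
    exists Y : 'I_k -> {poly R},
      [/\ (size (Y p) <= (d p + 1).+1)%N,
          (forall i, i != p -> (size (Y i) <= (d i - 1).+1)%N),
          (forall q : 'I_(d p), exists G : R -> R,
             antiderivative2 (I (sl q)) (fun x => (Y p).[x] / (a + b * x) ^+ (mdim d + 3)) G /\
             forall x, I (sl q) x -> A (sl q) x = (a + b * x) ^+ (mdim d + 1) * G x),
          (forall i (r : 'I_(d i)), i != p -> exists G : R -> R,
             antiderivative2 (I (sl r)) (fun x => (Y i).[x]) G /\
             forall x, I (sl r) x -> A (sl r) x = G x) &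
          (Y p)`_(d p + 1) / b ^+ 2 + \sum_(i < k | i != p) (Y i)`_(d i - 1) = 0]].
Proof.
move=> Sp spl; have [t [rho [t0 Lt]]] := split_product oI hb L0 sB LB Sp spl.
have jS : exists j, j \in S by exists p; rewrite Sp inE.
have [Yp [sY aY lY]] := product_numerator d_gt0 oI injI hb L0 E t0 Lt.
have [x0 Ix0] := box_nonempty oI.
have /choice[g hg] : forall i, exists g : {poly R}, i != p ->
    [/\ (size g <= d i)%N, forall r : 'I_(d i), deriv (deriv (a (sl r))) = g &
        forall x, box I x -> a2sum a i x = g`_(d i).-1].
  move=> i; have [->|ip] := eqVneq i p; first by exists 0.
  have iS : i \notin S by rewrite Sp inE.
  by have [g hg] := off_numerator d_gt0 oI injI hb LB E iS jS; exists g.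
exists t, rho, 1; split; rewrite ?oner_neq0 //.
  apply: mu_pair_inj => x; rewrite Lt mu_pair_ins10_tev tevZ tev_ptensor.
  by congr (_ * _); apply: eq_bigr => q _; rewrite /= mulr1.
exists (fun i => if i == p then Yp else g i); rewrite eqxx; split.
- by rewrite addn1.
- by move=> i ip; rewrite (negbTE ip) subn1 prednK //; case: (hg i ip).
- move=> q; have nz y : I (sl q) y -> rho + 1 * y != 0.
    move=> Iy; have := L0 (box_upd Ix0 Iy); rewrite [L _]Lt mulf_eq0 (negbTE t0) /=.
    by move/prodf_neq0 => /(_ q isT); rewrite updE mul1r.
  (* The antiderivative is forced by the shape of [A], and [derivs2_on_div] computes its second
     derivative. *)
  exists (fun y => A (sl q) y / (rho + 1 * y) ^+ (mdim d + 1)); split; last first.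
    by move=> y Iy; rewrite mulrC divfK // expf_neq0 // nz.
  apply/antiderivative2_derivs2; rewrite addn1.
  have := derivs2_on_div (mdim d).+1 nz (@derivs2_on_poly R (I (sl q)) (a (sl q))).
  move/(derivs2_on_eq (B := fun y => A (sl q) y / (rho + 1 * y) ^+ (mdim d).+1) (oI _)).
  have eA y : I (sl q) y -> (a (sl q)).[y] / (rho + 1 * y) ^+ (mdim d).+1 =
    A (sl q) y / (rho + 1 * y) ^+ (mdim d).+1 by move=> Iy; rewrite Aa.
  by move/(_ eA) => h y Iy; have := h y Iy; rewrite -horner_bpoly aY addn3.
- by move=> i r' ip; rewrite (negbTE ip); apply: antiderivative_numerator; case: (hg i ip).
rewrite expr1n divr1 addn1 (lY x0 Ix0) kapE; apply/eqP; rewrite addrC subr_eq0; apply/eqP.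
by apply: eq_bigr => i ip; rewrite (negbTE ip) subn1; have [_ _ ->] := hg i ip.
Qed.

Section Nonsplit.
Hypothesis jS : exists j, j \in S.
Hypothesis ns : forall p (r : 'I_(d p)), p \in S -> ~ split_slot beta (sl r).

Lemma necessary_d1 i1 i2 : structure_d1 d i1 i2 ->
  (exists q : 'I_(d i1), indep_with_partial (sl q) (mu_pair beta)) /\
  exists Y P2 : {poly R},
    [/\ (size P2 <= 3)%N,
        (forall (r : 'I_(d i2)) x, I (sl r) x -> A (sl r) x = P2.[x]),
        (size Y <= (mdim d).+1)%N,
        (forall (r : 'I_(d i1)) x, I (sl r) x -> A (sl r) x = Y.[x]) &
        (forall (r : 'I_(d i2)) x, I (sl r) x ->
           2 * Y`_(mdim d) + derive1n 2 (A (sl r)) x = 0)].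
Proof.
move=> st; have [ic md d1] := structure_cases d_gt0 not_Segre st; have [_ i12 d2] := st.
(* Otherwise S would be the one-slot group [i2], and [L], affine in a single variable, would be
   split. *)
have i1S : i1 \in S.
  apply: contrapT => /negP i1S; have [j jS'] := jS.
  have Si2 : S = [set i2]%SET.
    apply/setP => i; rewrite [RHS]inE; case: (ic i) => ->; first by rewrite (negbTE i1S) (negbTE i12).
    by rewrite eqxx; case: (ic j) jS' i1S => -> // ->.
  apply: (@ns i2 (Ordinal (d_gt0 i2))); first by rewrite Si2 inE.
  exact: (single_split hb LB).
have [Y [sY aY sY' aY' hY]] := nonsplit_numerators d_gt0 k2 not_Segre oI injI hb sB LB E jS ns.
split; first by exists (Ordinal (d_gt0 i1)); apply/not_split_indep/ns.
have e2 (r : 'I_(d i2)) : r = Ordinal (d_gt0 i2) by apply: ord_eq1.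
have := lead_relation d_gt0 oI injI hb E i1S sY aY hY.
(* Here the factor [(m - d) (m + 1 - d)] equals 2. *)
have m1 : (mdim d)%:R - (d i1)%:R = 1 :> R by rewrite md -natr1 addrC addKr.
rewrite m1 mul1r addrAC m1 (big_pred1 i2); last first.
  by move=> i /=; case: (ic i) => ->; rewrite ?eqxx ?[i2 == i1]eq_sym (negbTE i12).
move=> rel; rewrite d2 -md in rel; exists (Y i1), (a (sl (Ordinal (d_gt0 i2)))).
have s2 : (size (deriv (deriv (a (sl (Ordinal (d_gt0 i2)))))) <= 1)%N.
  have [i2S|i2S] := boolP (i2 \in S); last by rewrite aY' //; have := sY' i2 i2S; rewrite d2.
  rewrite aY //; apply/leq_sizeP => j j0; rewrite coef_deriv2 nth_default ?mulr0 //.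
  by apply: leq_trans (sY i2 i2S) _; rewrite d2.
split.
- exact: size_deriv2.
- by move=> r y Iy; rewrite Aa // (e2 r).
- by rewrite md sY.
- by move=> r y Iy; rewrite Aa // aY.
move=> r y Iy; rewrite A2a // (e2 r) (size1_polyC s2) hornerC -[RHS]rel; congr (_ + _).
have [i2S|i2S] := boolP (i2 \in S); last by rewrite aY'.
by rewrite aY // coef_deriv2 /=; ring.
Qed.

Lemma necessary_general : ~ (exists i1 i2 : 'I_k, structure_d1 d i1 i2) ->
  exists (p : 'I_k) (q : 'I_(d p)), [/\ indep_with_partial (sl q) (mu_pair beta),
    ~ (exists i1 i2 : 'I_k, structure_d1 d i1 i2) &
    exists Y : 'I_k -> {poly R},
      [/\ (forall j, j \in Sset beta -> (size (Y j) <= (d j + 1).+1)%N),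
          (forall j (s : 'I_(d j)), j \in Sset beta ->
             forall x, I (sl s) x -> A (sl s) x = (Y j).[x]),
          (forall i, i \notin Sset beta -> (size (Y i) <= (d i - 1).+1)%N),
          (forall i (r : 'I_(d i)), i \notin Sset beta -> exists G : R -> R,
             antiderivative2 (I (sl r)) (fun x => (Y i).[x]) G /\
             forall x, I (sl r) x -> A (sl r) x = G x) &
          exactly_one3
            (Sset beta = [set p]%SET /\
             ((mdim d)%:R - (d p)%:R) * ((mdim d)%:R + 1 - (d p)%:R) * (Y p)`_(d p + 1)
             + \sum_(i < k | i \notin Sset beta) (Y i)`_(d i - 1) = 0)
            (exists p' : 'I_k,
               [/\ p' != p, Sset beta = [set p; p']%SET, mdim d = (d p + d p')%N &
                   (Y p)`_(d p + 1) + (Y p')`_(d p' + 1) = 0])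
            [/\ (2 <= #|Sset beta|)%N, (3 <= k)%N,
                (forall j, j \in Sset beta -> (size (Y j) <= (d j).+1)%N) &
                \sum_(i < k | i \notin Sset beta) (Y i)`_(d i - 1) = 0]]].
Proof.
move=> nst; have [p pS] := jS; exists p, (Ordinal (d_gt0 p)).
have [Y [sY aY sY' aY' hY]] := nonsplit_numerators d_gt0 k2 not_Segre oI injI hb sB LB E jS ns.
split=> //; first exact/not_split_indep/ns.
exists Y; split.
- by move=> j jS'; rewrite addn1 sY.
- by move=> j s jS' y Iy; rewrite Aa // aY.
- by move=> j jS'; rewrite subn1 prednK // sY'.
- by move=> i r iS; apply: antiderivative_numerator; apply: aY'.
have rel := lead_relation d_gt0 oI injI hb E pS sY aY hY.
have sumE : \sum_(i < k | i \notin S) (Y i)`_(d i - 1) = \sum_(i < k | i \notin S) (Y i)`_(d i).-1.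
  by apply: eq_bigr => i _; rewrite subn1.
rewrite /exactly_one3 -/S sumE addn1.
have [Sp|[j jS' jp]] := set1_or_other pS.
- constructor 1; split.
  + split=> //; rewrite -[RHS]rel; congr (_ + _); apply: eq_big => i; first by rewrite Sp inE.
    by move=> /negbTE ->.
  + by case=> p' [p'p Sp' _ _]; have := set22 p p'; rewrite -Sp' Sp inE (negbTE p'p).
  + by case; rewrite Sp cards1.
have nSp : S <> [set p]%SET by move=> Sp; move: jS'; rewrite Sp inE (negbTE jp).
have [ic|nic] := pselect (forall i, i = p \/ i = j).
  have md := mdim_pair d jp ic.
  have Spj : S = [set p; j]%SET.
    by apply/setP => i; rewrite [RHS]in_set2; case: (ic i) => ->; rewrite eqxx ?orbT.
  constructor 2; split; first by case.
  + exists j; split=> //; rewrite addn1.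
    (* Since [m - d p = d j], the leading relation is [d j (d j + 1)] times the sum of the two
       leading coefficients. *)
    have dj : (d j)%:R * ((d j)%:R + 1) != 0 :> R by rewrite natr1 -natrM pnatr_eq0 -lt0n muln_gt0 d_gt0.
    apply: (mulfI dj); rewrite mulr0 -[RHS]rel md (big_pred1 j) => [|i /=]; last first.
      by case: (ic i) => ->; rewrite ?eqxx ?[p == j]eq_sym (negbTE jp).
    by rewrite jS' natrD; ring.
  + by have k2' := ord_pair_eq2 jp ic; case=> _; rewrite leqNgt [X in (X < _)%N]k2'.
have [i ip ij] : exists2 i, i != p & i != j.
  apply: contrapT => h; apply: nic => i; have [->|ip] := eqVneq i p; [by left|].
  by have [->|ij] := eqVneq i j; [by right|case: h; exists i].
have k3 : (3 <= k)%N.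
  rewrite -[X in (_ <= X)%N](card_ord k); have <- : #|(i |: [set p; j])%SET| = 3%N.
    by rewrite cardsU1 cards2 !inE (negbTE ip) (negbTE ij) eq_sym jp.
  exact: max_card.
(* Three groups exist, so any two groups of S leave out a third and [low_degree] applies to them. *)
have low l l' : l \in S -> l' \in S -> l' != l -> (Y l)`_(d l).+1 = 0.
  move=> lS lS' ll; apply: (low_degree d_gt0 oI injI hb sB LB E lS lS' ll _ sY aY hY).
  have [|ni] := pselect (forall u, u = l \/ u = l'); last first.
    have [u ul ul'] : exists2 u, u != l & u != l'.
      apply: contrapT => h; apply: ni => u; have [->|ip'] := eqVneq u l; [by left|].
      by have [->|ij'] := eqVneq u l'; [by right|case: h; exists u].
    exact: (mdim_gt_pair d_gt0 ll ul ul').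
  by move=> h; move: jp ip ij; case: (h i) (h j) (h p) => -> [] -> [] ->; rewrite ?eqxx.
have low' l : l \in S -> (Y l)`_(d l).+1 = 0.
  by move=> lS; have [->|lp] := eqVneq l p; [exact: low pS jS' jp|apply: (low l p); rewrite // eq_sym].
constructor 3; split; first by case.
  case=> p' [p'p _ md _]; have [e|jp'] := eqVneq j p'.
    by subst p'; have := mdim_gt_pair d_gt0 p'p ip ij; rewrite md ltnn.
  by have := mdim_gt_pair d_gt0 p'p jp jp'; rewrite md ltnn.
split=> //.
- by apply/card_gt1P; exists p, j; rewrite pS jS' eq_sym.
- move=> l lS; apply/leq_sizeP => n; rewrite leq_eqVlt => /orP[/eqP<-|ln]; first exact: low'.
  by rewrite nth_default // (leq_trans (sY l lS)).
rewrite -[RHS]rel low' // mulr0 add0r big_mkcond [RHS]big_mkcond; apply: eq_bigr => l _ /=.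
have [lS|lS] := boolP (l \in S); first by rewrite low' // mulr0 if_same.
by case: eqP lS => // ->; rewrite pS.
Qed.

End Nonsplit.
End NecessaryForms.

Lemma indep_Sset (R : realType) k (d : 'I_k -> nat) (beta : tensor R (slot d)) p (q : 'I_(d p)) :
  in_h beta -> indep_with_partial (sl q) (mu_pair beta) -> p \in Sset beta.
Proof.
move=> hb ind; apply: contrapT => /negP pS; have [x|_ /eqP] := ind 0 1; last by rewrite oner_eq0.
by rewrite horner0 mul0r add0r partial_slope ?Sset_slope0 ?mulr0 //; exact: multiaffine_tev.
Qed.

(** * Sufficiency, case by case *)

Section SufficientForms.
Variables (R : realType) (k : nat) (d : 'I_k -> nat) (beta : tensor R (slot d))
  (I : slot d -> set R) (A : slot d -> R -> R) (B : forall i : 'I_k, tensor R 'I_(d i)).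
Let L := mu_pair beta.
Hypothesis d_gt0 : forall i, (0 < d i)%N.
Hypothesis k2 : (2 <= k)%N.
Hypothesis not_Segre : ~ (forall i, d i = 1%N).
Hypothesis oI : forall s, open_interval (I s).
Hypothesis sA : forall s, smooth_on (I s) (A s).
Hypothesis L0 : forall x, box I x -> L x != 0.
Hypothesis injI : forall i y, box (gbox I i) y -> injective y.
Hypothesis hb : in_h beta.
Hypothesis sB : forall i, symmetric_tensor (B i).
Hypothesis LB : forall x, L x = gfun B x.
Let S := Sset beta.

Lemma sufficient_ins10 p t a b (Y : 'I_k -> {poly R}) : b != 0 ->
  beta = ins10 (t *: tpow (d p) (a, b)) -> (size (Y p) <= (d p + 1).+1)%N ->
  (forall i, i != p -> (size (Y i) <= (d i - 1).+1)%N) ->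
  (forall q : 'I_(d p), exists G : R -> R,
     antiderivative2 (I (sl q)) (fun x => (Y p).[x] / (a + b * x) ^+ (mdim d + 3)) G /\
     forall x, I (sl q) x -> A (sl q) x = (a + b * x) ^+ (mdim d + 1) * G x) ->
  (forall i (r : 'I_(d i)), i != p -> exists G : R -> R,
     antiderivative2 (I (sl r)) (fun x => (Y i).[x]) G /\
     forall x, I (sl r) x -> A (sl r) x = G x) ->
  (Y p)`_(d p + 1) / b ^+ 2 + \sum_(i < k | i != p) (Y i)`_(d i - 1) = 0 ->
  extremal beta I A.
Proof.
move=> b0 be sp si hp hi rel.
have Lt x : L x = t * \prod_(q < d p) (a + b * x (sl q)).
  rewrite /L be mu_pair_ins10_tev tevZ tev_ptensor.
  by congr (_ * _); apply: eq_bigr => q _; rewrite /= mulrC.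
have offp i : i != p -> i \notin S.
  move=> ip; apply/negP => iS; have [x /eqP[]] := Sset_slope hb (Ordinal (d_gt0 i)) iS.
  by rewrite /slope be !mu_pair_ins10_tev !grp_updN 1?eq_sym ?subrr.
apply: (sufficient_product d_gt0 oI sA L0 injI hb b0 offp Lt (Y := Y)) => //.
- by rewrite -addn1.
- by move=> i ip; rewrite -(prednK (d_gt0 i)) -subn1 si.
rewrite -addn1 -[RHS]rel; congr (_ + _); first by apply: eq_bigr => i _; rewrite subn1.
Qed.

(** One condition covers two situations: for [i2] in S it says that the two leading coefficients are
    opposite, otherwise it is the relation of [sufficient_single] with factor 2. *)
Lemma sufficient_d1 i1 i2 (q : 'I_(d i1)) (Y P2 : {poly R}) : structure_d1 d i1 i2 ->
  indep_with_partial (sl q) (mu_pair beta) -> (size P2 <= 3)%N ->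
  (forall (r : 'I_(d i2)) x, I (sl r) x -> A (sl r) x = P2.[x]) ->
  (size Y <= (mdim d).+1)%N -> (forall (r : 'I_(d i1)) x, I (sl r) x -> A (sl r) x = Y.[x]) ->
  (forall (r : 'I_(d i2)) x, I (sl r) x -> 2 * Y`_(mdim d) + derive1n 2 (A (sl r)) x = 0) ->
  extremal beta I A.
Proof.
move=> st ind sP AP sY AY rel; have [ic md d1] := structure_cases d_gt0 not_Segre st.
have [_ i12 d2] := st; have i21 : i2 == i1 = false by rewrite eq_sym (negbTE i12).
have i1S := indep_Sset hb ind.
have AP2 (r : 'I_(d i2)) y : I (sl r) y -> derive1n 2 (A (sl r)) y = (deriv (deriv P2)).[y].
  by move=> Iy; have [_] := A_poly oI sA (@AP r) Iy.
have sP2 : (size (deriv (deriv P2)) <= 1)%N.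
  by apply/leq_sizeP => j j0; rewrite coef_deriv2 nth_default ?mulr0 // (leq_trans sP).
have [y Iy] := box_nonempty oI; have := rel (Ordinal (d_gt0 i2)) _ (Iy _).
rewrite AP2 // (size1_polyC sP2) hornerC coef_deriv2 => lead.
have [i2S|i2S] := boolP (i2 \in S).
  apply: (sufficient_pair d_gt0 oI sA L0 injI hb sB LB (p := i1) (j := i2)
    (Y := fun i => if i == i1 then Y else P2)) => //; rewrite ?eqxx ?i21 //.
  - by rewrite md d2 addn1.
  - by move=> i; case: (ic i) => ->; rewrite ?eqxx ?i21 ?d2 -?md.
  - by move=> i; case: (ic i) => ->; rewrite ?eqxx ?i21.
  rewrite d2 -md; have two : (2 : R) != 0 by rewrite pnatr_eq0.
  by apply: (mulfI two); rewrite mulr0 -[RHS]lead /=; ring.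
have Si1 : S = [set i1]%SET.
  by apply/setP => i; rewrite [RHS]finset.in_set1; case: (ic i) => ->; rewrite ?eqxx ?i21 // (negbTE i2S).
apply: (sufficient_single d_gt0 oI sA L0 injI hb sB LB (p := i1)
    (Y := fun i => if i == i1 then Y else deriv (deriv P2))) => //; rewrite ?eqxx //.
- by move=> i; rewrite -/S Si1 finset.in_set1 => /eqP ->; rewrite eqxx -md.
- by move=> i; rewrite -/S Si1 finset.in_set1 => /eqP ->; rewrite eqxx.
- by move=> i; rewrite -/S Si1 finset.in_set1 => ne; rewrite (negbTE ne); case: (ic i) ne => ->; rewrite ?eqxx // d2.
- by move=> i; rewrite -/S Si1 finset.in_set1 => ne; rewrite (negbTE ne); case: (ic i) ne => ->; rewrite ?eqxx.
have m1 : (mdim d)%:R - (d i1)%:R = 1 :> R by rewrite md -natr1 addrC addKr.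
rewrite m1 mul1r addrAC m1 (big_pred1 i2); last first.
  by move=> i /=; rewrite -/S Si1 finset.in_set1; case: (ic i) => ->; rewrite ?eqxx ?i21 ?(negbTE i12).
by rewrite i21 d2 -md coef_deriv2 -[RHS]lead /=; ring.
Qed.

Lemma sufficient_general p (q : 'I_(d p)) (Y : 'I_k -> {poly R}) :
  indep_with_partial (sl q) (mu_pair beta) ->
  (forall j, j \in Sset beta -> (size (Y j) <= (d j + 1).+1)%N) ->
  (forall j (s : 'I_(d j)), j \in Sset beta -> forall x, I (sl s) x -> A (sl s) x = (Y j).[x]) ->
  (forall i, i \notin Sset beta -> (size (Y i) <= (d i - 1).+1)%N) ->
  (forall i (r : 'I_(d i)), i \notin Sset beta -> exists G : R -> R,
     antiderivative2 (I (sl r)) (fun x => (Y i).[x]) G /\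
     forall x, I (sl r) x -> A (sl r) x = G x) ->
  [\/ Sset beta = [set p]%SET /\
      ((mdim d)%:R - (d p)%:R) * ((mdim d)%:R + 1 - (d p)%:R) * (Y p)`_(d p + 1)
      + \sum_(i < k | i \notin Sset beta) (Y i)`_(d i - 1) = 0,
      exists p' : 'I_k,
        [/\ p' != p, Sset beta = [set p; p']%SET, mdim d = (d p + d p')%N &
            (Y p)`_(d p + 1) + (Y p')`_(d p' + 1) = 0] |
      (forall j, j \in Sset beta -> (size (Y j) <= (d j).+1)%N) /\
      \sum_(i < k | i \notin Sset beta) (Y i)`_(d i - 1) = 0] ->
  extremal beta I A.
Proof.
move=> ind sY AY sY' AG.
have sz i : i \in Sset beta -> (size (Y i) <= (d i).+2)%N by rewrite -addn1; exact: sY.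
have sz' i : i \notin Sset beta -> (size (Y i) <= d i)%N.
  by move=> iS; rewrite -(prednK (d_gt0 i)) -subn1 sY'.
have A2 i : i \notin Sset beta -> forall (r : 'I_(d i)) y, I (sl r) y ->
    derive1n 2 (A (sl r)) y = (Y i).[y].
  by move=> iS r; apply: (A_second oI sA (AG i r iS)).
have sumE : \sum_(i < k | i \notin Sset beta) (Y i)`_(d i - 1) =
    \sum_(i < k | i \notin Sset beta) (Y i)`_(d i).-1.
  by apply: eq_bigr => i _; rewrite subn1.
rewrite sumE addn1 => -[[Sp rel]|[p' [p'p Spp md rel]]|[low rel]].
- by apply: (sufficient_single d_gt0 oI sA L0 injI hb sB LB Sp sz _ sz' A2 rel) => i iS r; apply: AY.
- have ic i : i = p \/ i = p'.
    have [->|ip] := eqVneq i p; [by left|]; have [->|ip'] := eqVneq i p'; [by right|].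
    by have := mdim_gt_pair d_gt0 p'p ip ip'; rewrite md ltnn.
  have iS i : i \in Sset beta by rewrite Spp in_set2; case: (ic i) => ->; rewrite eqxx ?orbT.
  apply: (sufficient_pair d_gt0 oI sA L0 injI hb sB LB p'p ic (iS p) (iS p') md (Y := Y)) => //.
  + by move=> i; apply: sz.
  + by move=> i r; apply: AY.
  by rewrite -[RHS]rel addn1.
by apply: (sufficient_low_degree d_gt0 oI sA L0 injI hb sB LB (ltnW k2) low _ sz' A2 rel) => i iS r; apply: AY.
Qed.

End SufficientForms.

Unset Implicit Arguments.

Theorem theorem4p4p1 (R : realType) (k : nat) (d : 'I_k -> nat)
    (beta : tensor R (slot d)) (I : slot d -> set R) (A : slot d -> R -> R)
    (d_gt0 : forall i, (0 < d i)%N)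
    (not_Veronese : (2 <= k)%N)
    (not_Segre : ~ (forall i, d i = 1%N))
    (geom : separable_geometry beta I A) :
  extremal beta I A <->
  [\/ (* (1) *)
      exists t : R,
        [/\ t != 0,
            beta = t *: ptensor (fun _ => (1, 0)) &
            exists (Y : 'I_k -> {poly R}) (nu0 nu1 : slot d -> R),
              (forall p, (size (Y p) <= (d p + 2).+1)%N) /\
              (forall p (q : 'I_(d p)) x, I (sl q) x ->
                 A (sl q) x = (Y p).[x] + nu0 (sl q) + nu1 (sl q) * x)],
      (* (2) *)
      exists (p : 'I_k) (t a b : R),
        [/\ t != 0, b != 0,
            beta = ins10 (t *: tpow (d p) (a, b)) &
            exists Y : 'I_k -> {poly R},
              [/\ (size (Y p) <= (d p + 1).+1)%N,
                  (forall i, i != p -> (size (Y i) <= (d i - 1).+1)%N),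
                  (forall q : 'I_(d p), exists G : R -> R,
                     antiderivative2 (I (sl q))
                       (fun x => (Y p).[x] / (a + b * x) ^+ (mdim d + 3)) G /\
                     forall x, I (sl q) x ->
                       A (sl q) x = (a + b * x) ^+ (mdim d + 1) * G x),
                  (forall i (r : 'I_(d i)), i != p -> exists G : R -> R,
                     antiderivative2 (I (sl r)) (fun x => (Y i).[x]) G /\
                     forall x, I (sl r) x -> A (sl r) x = G x) &
                  (Y p)`_(d p + 1) / b ^+ 2
                  + \sum_(i < k | i != p) (Y i)`_(d i - 1) = 0]],
      (* (3) *)
      exists i1 i2 : 'I_k,
        [/\ structure_d1 d i1 i2,
            (exists q : 'I_(d i1), indep_with_partial (sl q) (mu_pair beta)) &
            exists Y P2 : {poly R},
              [/\ (size P2 <= 3)%N,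
                  (forall (r : 'I_(d i2)) x, I (sl r) x -> A (sl r) x = P2.[x]),
                  (size Y <= (mdim d).+1)%N,
                  (forall (r : 'I_(d i1)) x, I (sl r) x -> A (sl r) x = Y.[x]) &
                  (forall (r : 'I_(d i2)) x, I (sl r) x ->
                     2 * Y`_(mdim d) + derive1n 2 (A (sl r)) x = 0)]] |
      (* (4) *)
      exists (p : 'I_k) (q : 'I_(d p)),
        [/\ indep_with_partial (sl q) (mu_pair beta),
            ~ (exists i1 i2 : 'I_k, structure_d1 d i1 i2) &
            exists Y : 'I_k -> {poly R},
              [/\ (forall j, j \in Sset beta -> (size (Y j) <= (d j + 1).+1)%N),
                  (forall j (s : 'I_(d j)), j \in Sset beta ->
                     forall x, I (sl s) x -> A (sl s) x = (Y j).[x]),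
                  (forall i, i \notin Sset beta -> (size (Y i) <= (d i - 1).+1)%N),
                  (forall i (r : 'I_(d i)), i \notin Sset beta ->
                     exists G : R -> R,
                       antiderivative2 (I (sl r)) (fun x => (Y i).[x]) G /\
                       forall x, I (sl r) x -> A (sl r) x = G x) &
                  exactly_one3
                    (* (a) *)
                    (Sset beta = [set p]%SET /\
                     ((mdim d)%:R - (d p)%:R) * ((mdim d)%:R + 1 - (d p)%:R)
                       * (Y p)`_(d p + 1)
                     + \sum_(i < k | i \notin Sset beta) (Y i)`_(d i - 1) = 0)
                    (* (b) *)
                    (exists p' : 'I_k,
                       [/\ p' != p, Sset beta = [set p; p']%SET,
                           mdim d = (d p + d p')%N &
                           (Y p)`_(d p + 1) + (Y p')`_(d p' + 1) = 0])
                    (* (c) *)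
                    [/\ (2 <= #|Sset beta|)%N, (3 <= k)%N,
                        (forall j, j \in Sset beta -> (size (Y j) <= (d j).+1)%N) &
                        \sum_(i < k | i \notin Sset beta) (Y i)`_(d i - 1) = 0]]]].
Proof.
have oI := sg_interval geom; have hb := sg_beta geom; have L0 := sg_sigma_neq0 geom.
have sA := sg_smooth geom; have injI := box_injective oI (sg_Delta_neq0 geom).
have [B [sB LB]] := in_h_gfun hb; split.
  move=> ext; have [a [C [Aa sC E]]] := extremal_poly oI L0 injI hb d_gt0 not_Veronese sA ext.
  have [S0|[j jS]] := set_0Vmem (Sset beta).
    by constructor 1; exact: (necessary_const d_gt0 oI injI hb L0 LB Aa E S0).
  have [[p [r [Sp spl]]]|nspl] := pselect (exists p (r : 'I_(d p)),
      Sset beta = [set p]%SET /\ split_slot beta (sl r)).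
    constructor 2; exists p.
    exact: (necessary_product d_gt0 oI injI hb L0 sB LB sA Aa E Sp spl).
  have jS' : exists j, j \in Sset beta by exists j.
  (* With a second group in S no slot is split, so excluding split slots for one-element S excludes
     them all. *)
  have ns p (r : 'I_(d p)) : p \in Sset beta -> ~ split_slot beta (sl r).
    move=> pS spl; have [Sp|[i iS ip]] := set1_or_other pS; first by apply: nspl; exists p, r.
    by case: (not_split_two d_gt0 hb (p := p) (j := i) (r := r) pS iS ip).
  have [[i1 [i2 st]]|nst] := pselect (exists i1 i2 : 'I_k, structure_d1 d i1 i2).
    constructor 3; exists i1, i2.
    by have [] := necessary_d1 d_gt0 not_Veronese not_Segre oI injI hb sB LB sA Aa E jS' ns st.
  constructor 4.
  exact: (necessary_general d_gt0 not_Veronese not_Segre oI injI hb sB LB sA Aa E jS' ns nst).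
case=> [[t [_ be [Y [nu0 [nu1 [sY AY]]]]]]|[p [t [a [b [_ b0 be [Y [sp si hp hi rel]]]]]]]|
  [i1 [i2 [st [q ind] [Y [P2 [sP AP sY AY rel]]]]]]|[p [q [ind _ [Y [sY AY sY' AG h]]]]]].
- apply: (sufficient_const d_gt0 oI sA L0 injI _ sY AY) => x.
  by rewrite be; exact: tev_const.
- exact: (sufficient_ins10 d_gt0 oI sA L0 injI hb b0 be sp si hp hi rel).
- exact: (sufficient_d1 d_gt0 not_Segre oI sA L0 injI hb sB LB st ind sP AP sY AY rel).
apply: (sufficient_general d_gt0 not_Veronese oI sA L0 injI hb sB LB ind sY AY sY' AG).
by case: h => [[ha _ _]|[_ hb' _]|[_ _ [_ _ hc1 hc2]]]; [constructor 1|constructor 2|constructor 3].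
Qed.
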